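(* Let $d$ be a non-zero natural number and assume that $d$ is odd. Then $$\mathcal{Z}^{\mu_d}\simeq\{(a,u,v,e)\in\mathbb{C}^4\mid (e-da)(e+da)e^{d-2}=uv\},$$ where $\mathcal{Z}^{\mu_d}$ is the fixed point subvariety (with its reduced structure) of the generic Calogero-Moser space $\mathcal{Z}$ of the dihedral group of order $2d$ under the group $\mu_d\subset\mathbb{C}^\times$ of $d$-th roots of unity, and $\simeq$ denotes isomorphism of algebraic varieties.
   Context: Let $\zeta$ be a primitive $d$-th root of unity. $V=\mathbb{C}^2$ has canonical basis $(x,y)$, $V^*$ dual basis $(X,Y)$. For $i\in\mathbb{Z}/d\mathbb{Z}$, $s_i=\begin{pmatrix}0&\zeta^i\\ \zeta^{-i}&0\end{pmatrix}$, $\alpha_i^\vee=\zeta^ix-y$, $\alpha_i=X-\zeta^iY$; $W=\langle s_0,s_1\rangle$ is dihedral of order $2d$, $\mathrm{Ref}(W)=\{s_i\}$ is its set of reflections. $\mathcal{C}$ is the space of functions $\mathrm{Ref}(W)\to\mathbb{C}$ constant on conjugacy classes (one-dimensional for $d$ odd), $C_i\in\mathcal{C}^*$ is evaluation at $s_i$. $\mathbf{H}$ (generic rational Cherednik algebra at $t=0$) is the quotient of $\mathbb{C}[\mathcal{C}]\otimes(T(V\oplus V^* )\rtimes W)$ by $[u,u']=[U,U']=0$, $[u,U]=-2\sum_iC_i\frac{\langle u,\alpha_i\rangle\langle\alpha_i^\vee,U\rangle}{\langle\alpha_i^\vee,\alpha_i\rangle}s_i$ ($u,u'\in V$, $U,U'\in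 V^*$). Its centre $Z$ is a finitely generated $\mathbb{C}$-algebra and the generic Calogero-Moser space $\mathcal{Z}$ is the affine variety with algebra of regular functions $Z$. $\mathbb{C}^\times$ acts on $\mathbf{H}$ by algebra automorphisms: $\xi\in\mathbb{C}^\times$ acts by $\xi^{-1}$ on $V$, by $\xi$ on $V^*$, and trivially on $W$ and $\mathcal{C}^*$. This induces an action on $Z$ and hence on $\mathcal{Z}$.
   Formalization: The case d = 1 is excluded (d odd and d > 1, so d ≥ 3): for d = 1 the factor e^{d-2} = e^{-1} is not defined on all of C^4, and the left-hand side, fixed by the trivial group, has dimension 5 rather than 3. *)

(* Defs.v *)
From HB Require Import structures.
From mathcomp Require Import all_boot all_order all_algebra.
From mathcomp Require Import boolp classical_sets.
From mathcomp Require mpoly.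
From mathcomp Require Import monalg.

Set Implicit Arguments.
Unset Strict Implicit.
Unset Printing Implicit Defensive.

Import GRing.Theory.
Local Open Scope ring_scope.
Local Open Scope quotient_scope.

(* The free associative [K]-algebra on an alphabet [L] is the monoid algebra
   [{malg K[{fmonom L}]}] of the free monoid on [L]; [presented S] below is its
   quotient by the two-sided ideal generated by [S]. *)

Section FreeAlgebra.
Variables (K : fieldType) (L : choiceType).
Local Notation F := {malg K[{fmonom L}]}.

Definition letter (l : L) : F := << fmu l >>.

Lemma free_monE (c : K) (k : {fmonom L}) : << c *g k >> = c *: << k >> :> F.
Proof. by rewrite -mul_malgC [RHS]fgmulUU mulr1 mul1m. Qed.

Lemma free_scalerAr (c : K) (x y : F) : c *: (x * y) = x * (c *: y).
Proof.
have cC (k : {fmonom L}) : c%:MP * << k >> = << k >> * c%:MP :> F.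
  by rewrite [LHS]fgmulUU [RHS]fgmulUU mulr1 mul1r mul1m mulm1.
suff cx : c%:MP * x = x * c%:MP.
  rewrite -(mul_malgC c (x * y)) -(mul_malgC c y).
  rewrite (mulrA c%:MP x y).
  rewrite (mulrA x c%:MP y).
  exact: (congr1 (fun t => t * y) cx).
rewrite [x]monalgE mulr_sumr mulr_suml; apply: eq_bigr => k _.
rewrite [<< x@_k *g k >>]free_monE.
rewrite -(scalerAl x@_k) -cC.
rewrite !mul_malgC !scalerA.
by rewrite [c * _]mulrC.
Qed.

Lemma free_ind (P : F -> Prop) :
  P 0 -> (forall x y, P x -> P y -> P (x + y)) ->
  (forall c x, P x -> P (c *: x)) ->
  P 1 -> (forall l x, P x -> P (letter l * x)) -> forall x, P x.
Proof.
move=> P0 PD PZ P1 PM x; rewrite [x]monalgE.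
elim/big_ind: _ => // k _; rewrite free_monE; apply: PZ.
case: k => s; elim: s => [|l s IHs].
  suff -> : << FMonom [::] >> = 1 :> F by [].
  by rewrite -fmoneE.
suff -> : << FMonom (l :: s) >> = letter l * << FMonom s >> :> F by exact: PM.
rewrite [RHS]fgmulUU mulr1; congr << _ >>.
by apply/val_inj; rewrite /= fmM fmU.
Qed.

Section Lift.
Variables (B : algType K) (g : L -> B).

Definition word_lift (w : {fmonom L}) : B := \prod_(l <- (w : seq L)) g l.

Lemma word_lift_mmorphism : mmorphism word_lift.
Proof.
split=> [u v|]; first by rewrite /word_lift fmM big_cat.
by rewrite /word_lift fm1 big_nil.
Qed.

HB.instance Definition _ :=
  isMultiplicative.Build {fmonom L} B word_lift word_lift_mmorphism.

Definition free_lift : F -> B := mmap (in_alg B) word_lift.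

Fact free_lift_is_zmod_morphism : zmod_morphism free_lift.
Proof. by move=> x y; rewrite /free_lift raddfB. Qed.

Fact free_lift_is_monoid_morphism : monoid_morphism free_lift.
Proof.
have [hM h1] : multiplicative free_lift.
  apply: commr_mmap_is_multiplicative => x u v.
  by rewrite /GRing.comm mulr_algl mulr_algr.
by split.
Qed.

Fact free_lift_is_scalable : scalable free_lift.
Proof. by move=> c x; rewrite /free_lift mmapZ /= mulr_algl. Qed.

HB.instance Definition _ :=
  GRing.isZmodMorphism.Build F B free_lift free_lift_is_zmod_morphism.
HB.instance Definition _ :=
  GRing.isMonoidMorphism.Build F B free_lift free_lift_is_monoid_morphism.
HB.instance Definition _ :=
  GRing.isScalable.Build K F B *:%R free_lift free_lift_is_scalable.

Lemma free_lift_letter l : free_lift (letter l) = g l.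
Proof. by rewrite /free_lift mmapU /= scale1r mul1r /word_lift fmU big_seq1. Qed.

(* The next lemmas evaluate [free_lift] on an expression by following its
   syntax: matching by [rewrite] would unfold the operations of [malg]. *)
Lemma free_liftB x y a b :
  free_lift x = a -> free_lift y = b -> free_lift (x - y) = a - b.
Proof. by move=> <- <-; exact: free_lift_is_zmod_morphism. Qed.
Lemma free_liftD x y a b :
  free_lift x = a -> free_lift y = b -> free_lift (x + y) = a + b.
Proof. by move=> <- <-; rewrite raddfD. Qed.
Lemma free_liftM x y a b :
  free_lift x = a -> free_lift y = b -> free_lift (x * y) = a * b.
Proof. by move=> <- <-; have [_ ->] := free_lift_is_monoid_morphism. Qed.
Lemma free_lift1 : free_lift 1 = 1.
Proof. by have [-> _] := free_lift_is_monoid_morphism. Qed.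
Lemma free_liftZ c x a : free_lift x = a -> free_lift (c *: x) = c *: a.
Proof. by move=> <-; exact: free_lift_is_scalable. Qed.
Lemma free_lift_sum J r (P : pred J) (f : J -> F) (a : J -> B) :
  (forall j, free_lift (f j) = a j) ->
  free_lift (\sum_(j <- r | P j) f j) = \sum_(j <- r | P j) a j.
Proof. by move=> fa; rewrite raddf_sum; apply: eq_bigr => j _; exact: fa. Qed.

End Lift.

Definition two_sided_ideal : set (set F) :=
  [set I | [/\ I 0, (forall x y, I x -> I y -> I (x - y))
             & forall a x b, I x -> I (a * x * b)]].

Definition ideal_gen (S : set F) : {pred F} :=
  [pred x | `[< smallest two_sided_ideal S x >]].

Section Quotient.
Variable S : set F.
Local Notation I := (ideal_gen S).

Lemma ideal_genP x : reflect (smallest two_sided_ideal S x) (x \in I).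
Proof. exact: asboolP. Qed.

Lemma ideal_gen_sub x : S x -> x \in I.
Proof. by move=> Sx; apply/ideal_genP => J [_]; exact. Qed.

Lemma ideal_gen_ind (J : set F) :
  two_sided_ideal J -> (forall x, S x -> J x) -> forall x, x \in I -> J x.
Proof. by move=> Jideal SJ x /ideal_genP; apply; split. Qed.

Fact ideal_gen_zmod_closed : zmod_closed I.
Proof.
split; first by apply/ideal_genP => J [[]].
move=> x y /ideal_genP Ix /ideal_genP Iy; apply/ideal_genP => J JP.
by have [[_ JB _] _] := JP; apply: JB; [exact: Ix | exact: Iy].
Qed.

HB.instance Definition _ := GRing.isZmodClosed.Build F I ideal_gen_zmod_closed.

Lemma ideal_genM a x b : x \in I -> a * x * b \in I.
Proof.
move=> /ideal_genP Ix; apply/ideal_genP => J JP.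
by have [[_ _ JM] _] := JP; apply: JM; exact: Ix.
Qed.

Definition presented := Quotient.quot I.

HB.instance Definition _ := Choice.copy presented (Quotient.quot I).
HB.instance Definition _ := GRing.Zmodule.copy presented (Quotient.quot I).
HB.instance Definition _ : EqQuotient F (Quotient.equiv I) presented :=
  EqQuotient.on (Quotient.quot I).
HB.instance Definition _ :=
  @isZmodQuotient.Build F (Quotient.equiv I) 0 -%R +%R presented
    (lock _) (@Quotient.pi_opp F I) (@Quotient.pi_add F I).

Lemma presented_eq (x y : F) :
  (\pi_presented x == \pi_presented y) = (x - y \in I).
Proof. by rewrite piE /= Quotient.equivE. Qed.

Definition pone : presented := lift_cst presented 1.
Definition pmul := lift_op2 presented *%R.
Definition pscale (c : K) := lift_op1 presented ( *:%R c).

Canonical pi_pone_morph := PiConst pone.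

Lemma pi_pmul : {morph \pi : x y / x * y >-> pmul x y}.
Proof.
move=> x y; unlock pmul; apply/eqP; rewrite presented_eq.
set x' := repr _; set y' := repr _.
have xx' : x - x' \in I by rewrite -presented_eq reprK.
have yy' : y - y' \in I by rewrite -presented_eq reprK.
have -> : x * y - x' * y' = 1 * (x - x') * y + x' * (y - y') * 1.
  by rewrite mul1r mulr1 mulrBl mulrBr addrA subrK.
by rewrite rpredD // ideal_genM.
Qed.
Canonical pi_pmul_morph := PiMorph2 pi_pmul.

Lemma pi_pscale c : {morph \pi : x / c *: x >-> pscale c x}.
Proof.
move=> x; unlock pscale; apply/eqP; rewrite presented_eq -scalerBr.
set x' := repr _.
have xx' : x - x' \in I by rewrite -presented_eq reprK.
by rewrite -[x - x']mul1r scalerAl -[_ * _]mulr1 ideal_genM.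
Qed.
Canonical pi_pscale_morph c := PiMorph1 (pi_pscale c).

Fact pmulA : associative pmul.
Proof. by elim/quotW=> x; elim/quotW=> y; elim/quotW=> z; rewrite !piE mulrA. Qed.
Fact pmul1 : left_id pone pmul.
Proof. by elim/quotW=> x; rewrite !piE mul1r. Qed.
Fact pmulr1 : right_id pone pmul.
Proof. by elim/quotW=> x; rewrite !piE mulr1. Qed.
Fact pmulDl : left_distributive pmul +%R.
Proof.
elim/quotW=> x; elim/quotW=> y; elim/quotW=> z.
by rewrite -!raddfD -!pi_pmul -raddfD mulrDl.
Qed.
Fact pmulDr : right_distributive pmul +%R.
Proof.
elim/quotW=> x; elim/quotW=> y; elim/quotW=> z.
by rewrite -!raddfD -!pi_pmul -raddfD mulrDr.
Qed.

HB.instance Definition _ := GRing.Zmodule_isPzRing.Build presented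
  pmulA pmul1 pmulr1 pmulDl pmulDr.

Fact pscaleA c e x : pscale c (pscale e x) = pscale (c * e) x.
Proof. by elim/quotW: x => x; rewrite !piE scalerA. Qed.
Fact pscale1 : left_id 1 pscale.
Proof. by elim/quotW=> x; rewrite !piE scale1r. Qed.
Fact pscaleDr : right_distributive pscale +%R.
Proof.
by move=> c; elim/quotW=> x; elim/quotW=> y;
   rewrite -raddfD -!pi_pscale -raddfD scalerDr.
Qed.
Fact pscaleDl x : {morph pscale^~ x : c e / c + e}.
Proof.
by elim/quotW: x => x c e; rewrite -!pi_pscale -raddfD scalerDl.
Qed.

HB.instance Definition _ := GRing.Zmodule_isLmodule.Build K presented
  pscaleA pscale1 pscaleDr pscaleDl.

Lemma presented_piM (x y : F) :
  \pi_presented (x * y) = \pi_presented x * \pi_presented y.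
Proof. exact: pi_pmul. Qed.

Lemma presented_pi1 : \pi_presented 1 = 1.
Proof. by rewrite -[RHS]/pone !piE. Qed.

Lemma presented_piZ c (x : F) : \pi_presented (c *: x) = c *: \pi_presented x.
Proof. exact: pi_pscale. Qed.

Lemma presented_scalerAl c (x y : presented) : c *: (x * y) = c *: x * y.
Proof.
elim/quotW: x => x; elim/quotW: y => y.
by rewrite -presented_piZ -!presented_piM -presented_piZ scalerAl.
Qed.

Lemma presented_scalerAr c (x y : presented) : c *: (x * y) = x * (c *: y).
Proof.
elim/quotW: x => x; elim/quotW: y => y.
by rewrite -presented_piZ -!presented_piM -presented_piZ free_scalerAr.
Qed.

Section PresentedLift.
Variables (B : algType K) (g : L -> B).
Hypothesis gS : forall x, S x -> free_lift g x = 0.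

Lemma free_lift_ideal x : x \in I -> free_lift g x = 0.
Proof.
apply: (@ideal_gen_ind [set y | free_lift g y = 0]) => //; split.
- exact: raddf0.
- by move=> u v /= gu gv; rewrite raddfB /= gu gv subrr.
- by move=> a u b /= gu; rewrite !rmorphM /= gu mulr0 mul0r.
Qed.

Lemma presented_nontrivial : 1 != 0 :> presented.
Proof.
apply/eqP => e10; have : (1 : F) \in I.
  rewrite -[1]subr0 -presented_eq presented_pi1 e10.
  by rewrite raddf0.
by move/free_lift_ideal/eqP; rewrite rmorph1 oner_eq0.
Qed.

Definition presented_lift (x : presented) : B := free_lift g (repr x).

Lemma presented_lift_pi (x : F) :
  presented_lift (\pi_presented x) = free_lift g x.
Proof.
apply/eqP; rewrite -subr_eq0 -raddfB /=; apply/eqP/free_lift_ideal.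
by rewrite -presented_eq reprK.
Qed.

Fact presented_lift_is_zmod_morphism : zmod_morphism presented_lift.
Proof.
elim/quotW=> x; elim/quotW=> y; rewrite -raddfB !presented_lift_pi.
exact: free_lift_is_zmod_morphism.
Qed.

Fact presented_lift_is_monoid_morphism : monoid_morphism presented_lift.
Proof.
split; first by rewrite -presented_pi1 presented_lift_pi free_lift1.
elim/quotW=> x; elim/quotW=> y; rewrite -presented_piM !presented_lift_pi.
exact: free_liftM.
Qed.

Fact presented_lift_is_scalable : scalable presented_lift.
Proof.
move=> c; elim/quotW=> x; rewrite -presented_piZ !presented_lift_pi.
exact: free_liftZ.
Qed.

End PresentedLift.

Lemma presented_ind (P : presented -> Prop) :
  P 0 -> (forall x y, P x -> P y -> P (x + y)) ->
  (forall c x, P x -> P (c *: x)) ->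
  P 1 -> (forall l x, P x -> P (\pi_presented (letter l) * x)) -> forall x, P x.
Proof.
move=> P0 PD PZ P1 PM; elim/quotW; apply: free_ind.
- by rewrite raddf0.
- by move=> x y Px Py; rewrite raddfD; exact: PD.
- by move=> c x Px; rewrite presented_piZ; exact: PZ.
- by rewrite presented_pi1.
- by move=> l x Px; rewrite presented_piM; exact: PM.
Qed.

Lemma presented_rel x y : S (x - y) -> \pi_presented x = \pi_presented y.
Proof. by move=> Sxy; apply/eqP; rewrite presented_eq; exact: ideal_gen_sub. Qed.

Lemma presented_piD (x y : F) :
  \pi_presented (x + y) = \pi_presented x + \pi_presented y.
Proof. by rewrite raddfD. Qed.

Lemma presented_piB (x y : F) :
  \pi_presented (x - y) = \pi_presented x - \pi_presented y.
Proof. by rewrite raddfB. Qed.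

Lemma presented_pi_sum J r (P : pred J) (f : J -> F) :
  \pi_presented (\sum_(j <- r | P j) f j) =
  \sum_(j <- r | P j) \pi_presented (f j).
Proof. by rewrite raddf_sum. Qed.

End Quotient.
End FreeAlgebra.

Section Centre.
Variables (K : fieldType) (A : algType K).

Definition centre : {pred A} := [pred z | `[< forall a, z * a = a * z >]].

Lemma centreP z : reflect (forall a, z * a = a * z) (z \in centre).
Proof. exact: asboolP. Qed.

Fact centre_subalg_closed : subalg_closed centre.
Proof.
split; first by apply/centreP => a; rewrite mul1r mulr1.
  move=> c u v /centreP Zu /centreP Zv; apply/centreP => a.
  by rewrite mulrDl mulrDr Zv -scalerAl -scalerAr Zu.
move=> u v /centreP Zu /centreP Zv; apply/centreP => a.
by rewrite -mulrA Zv mulrA Zu mulrA.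
Qed.

HB.instance Definition _ := GRing.isSubalgClosed.Build K A centre
  centre_subalg_closed.

End Centre.
Arguments centre {K} A.

Section CentreAlgebra.
Variables (K : fieldType) (A : algType K).

Record centre_alg := CentreAlg { centre_val : A; _ : centre_val \in centre A }.

HB.instance Definition _ := [isSub for centre_val].
HB.instance Definition _ := [Choice of centre_alg by <:].
HB.instance Definition _ := [SubChoice_isSubAlgebra of centre_alg by <:].

End CentreAlgebra.

Section Varieties.
Variable K : fieldType.

Record variety := Variety {
  point :> Type;
  regular : set (point -> K)
}.

Definition morphism (X Y : variety) (f : X -> Y) : Prop :=
  forall phi, @regular Y phi -> @regular X (phi \o f).

Definition isomorphic (X Y : variety) : Prop :=
  exists f : X -> Y, exists g : Y -> X,
    [/\ cancel f g, cancel g f, morphism f & morphism g].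

(* The affine variety with algebra of regular functions [A]: its points are
   the characters of [A]. *)
Definition spectrum (A : algType K) : variety :=
  {| point := {lrmorphism A -> K^o};
     regular := [set phi | exists a : A,
                   phi = fun chi : {lrmorphism A -> K^o} => chi a] |}.

Lemma spectrum_eq (A : algType K) (f g : {lrmorphism A -> K^o}) :
  f =1 g -> f = g.
Proof.
move=> fg; have {fg} : (f : A -> K^o) = g by exact/funext.
case: f => f [[f1] [f2] [f3]]; case: g => g [[g1] [g2] [g3]] /= fg.
rewrite -{}fg in g1 g2 g3 *.
by rewrite (Prop_irrelevance f1 g1) (Prop_irrelevance f2 g2)
  (Prop_irrelevance f3 g3).
Qed.

Definition affine_space (n : nat) : variety :=
  {| point := 'rV[K]_n;
     regular := [set phi | exists p : mpoly.mpoly n K,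
                   phi = fun x : 'rV[K]_n => mpoly.meval (x 0) p] |}.

(* The reduced subvariety with underlying set [S]; only meaningful for
   [S] closed in the affine variety [X], where every regular function on [S]
   is the restriction of one on [X]. *)
Definition subvariety (X : variety) (S : set X) : variety :=
  {| point := S;
     regular := [set phi | exists2 psi, @regular X psi &
                   phi = fun x : S => psi (val x)] |}.

End Varieties.

Section Cherednik.
Variables (K : fieldType) (d : nat) (zeta : K).
Hypothesis zeta_prim : d.-primitive_root zeta.

(* [V] is the space of columns and [V^*] the space of rows, so that a matrix
   [w] acts on [V] by [u |-> w *m u] and on [V^*] by [U |-> U *m invmx w]. *)
Local Notation V := 'cV[K]_2.
Local Notation Vdual := 'rV[K]_2.

Definition pairing (u : V) (U : Vdual) : K := (U *m u) 0 0.

Definition refl (i : nat) : 'M[K]_2 :=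
  \matrix_(a, b) if a == b then 0 else if a == 0 then zeta ^+ i else zeta ^- i.

Definition coroot (i : nat) : V := \col_a if a == 0 then zeta ^+ i else -1.

Definition root (i : nat) : Vdual := \row_b if b == 0 then 1 else - zeta ^+ i.

Definition mx_group : set (set 'M[K]_2) :=
  [set G | [/\ G 1%:M, (forall v w, G v -> G w -> G (v *m w))
             & forall w, G w -> G (invmx w)]].

Definition dihedral : set 'M[K]_2 :=
  smallest mx_group [set refl 0; refl 1].

Fact dihedral_group : mx_group dihedral.
Proof.
split=> [G [[]] //|v w Wv Ww G GP|w Ww G GP]; have [[_ GM GV] _] := GP.
- by apply: GM; [exact: Wv | exact: Ww].
- by apply: GV; exact: Ww.
Qed.

Fact dihedral_refl i : dihedral (refl i).
Proof.
have [_ WM _] := dihedral_group.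
have W0 : dihedral (refl 0) by move=> G [_]; apply; left.
have W1 : dihedral (refl 1) by move=> G [_]; apply; right.
have z0 : zeta != 0.
  apply/eqP => z0; have := prim_expr_order zeta_prim.
  by rewrite z0 expr0n gtn_eqF ?(prim_order_gt0 zeta_prim) // => /eqP;
    rewrite eq_sym oner_eq0.
elim: i => // i Wi; suff -> : refl i.+1 = refl 1 *m refl 0 *m refl i.
  exact: (WM _ _ (WM _ _ W1 W0) Wi).
apply/matrixP => a b; rewrite !mxE !big_ord_recl big_ord0 !mxE.
rewrite !big_ord_recl !big_ord0 !mxE /=.
by case: a => [[|[|a]] //= a2]; case: b => [[|[|b]] //= b2];
  rewrite !(mul0r, mulr0, addr0, add0r, expr0, invr1, mulr1, mul1r) //
     ?expr1 ?exprS ?invfM.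
Qed.

Fact dihedral1 : dihedral 1%:M.
Proof. by have [] := dihedral_group. Qed.

Fact dihedralM v w : dihedral v -> dihedral w -> dihedral (v *m w).
Proof. by have [_ WM _] := dihedral_group; exact: WM. Qed.

Definition wone : dihedral := exist _ 1%:M (mem_set dihedral1).
Definition wmul (v w : dihedral) : dihedral :=
  exist _ (val v *m val w) (mem_set (dihedralM (set_valP v) (set_valP w))).
Definition wrefl (i : nat) : dihedral :=
  exist _ (refl i) (mem_set (dihedral_refl i)).

(* The functions on [Ref(W) = {s_i | i in Z/d}] that are constant on
   conjugacy classes; [c i] stands for the value at [s_i]. *)
Definition class_functions : set ('I_d -> K) :=
  [set c | forall i j : 'I_d,
     (exists2 w, dihedral w & w *m refl i *m invmx w = refl j) -> c i = c j].

Inductive generator : Type :=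
| GV of V
| GVdual of Vdual
| GW of dihedral
| GC of 'I_d.

HB.instance Definition _ := gen_eqMixin generator.
HB.instance Definition _ := gen_choiceMixin generator.

Local Notation F := {malg K[{fmonom generator}]}.
Local Notation vec u := (letter K (GV u)).
Local Notation cov U := (letter K (GVdual U)).
Local Notation grp s := (letter K (GW s)).
Local Notation par i := (letter K (GC i)).

(* Each constructor lists the difference of two elements of the free algebra
   that become equal in H. The first two build T(V + V^* ) and the next four
   its crossed product with W. The next two add C[CC] = Sym(CC^* ), where CC^*
   is spanned by the evaluations C_i with the linear relations that hold
   between them on class functions. *)
Inductive relator : F -> Prop :=
| rel_V_linear a u u' :
    relator (vec (a *: u + u') - (a *: vec u + vec u'))
| rel_Vdual_linear a U U' :
    relator (cov (a *: U + U') - (a *: cov U + cov U'))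
| rel_W_one : relator (grp wone - 1)
| rel_W_mul s t : relator (grp (wmul s t) - grp s * grp t)
| rel_W_V s u : relator (grp s * vec u - vec (val s *m u) * grp s)
| rel_W_Vdual s U :
    relator (grp s * cov U - cov (U *m invmx (val s)) * grp s)
| rel_C_linear (a : 'I_d -> K) :
    (forall c, class_functions c -> \sum_i a i * c i = 0) ->
    relator (\sum_i a i *: par i)
| rel_C_central i g : relator (par i * letter K g - letter K g * par i)
| rel_VV u u' : relator (vec u * vec u' - vec u' * vec u)
| rel_VdualVdual U U' : relator (cov U * cov U' - cov U' * cov U)
| rel_VVdual u U :
    relator (vec u * cov U - cov U * vec u - (- 2%:R) *:
      \sum_(i < d) (pairing u (root i) * pairing (coroot i) U
                    / pairing (coroot i) (root i)) *: (par i * grp (wrefl i))).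

Definition cherednik : Type := presented (relator : set F).

HB.instance Definition _ := GRing.PzRing.on cherednik.
HB.instance Definition _ := GRing.Lmodule.on cherednik.

Definition trivial_char (g : generator) : K^o := if g is GW _ then 1 else 0.

Fact trivial_char_relator x : relator x -> free_lift trivial_char x = 0.
Proof.
have fl g := free_lift_letter trivial_char g.
case=> [a u u'|a U U'||s t|s u|s U|a _|i g|u u'|U U'|u U].
- apply: etrans (free_liftB (fl _) (free_liftD (free_liftZ _ (fl _)) (fl _))) _.
  by rewrite /= scaler0 addr0 subr0.
- apply: etrans (free_liftB (fl _) (free_liftD (free_liftZ _ (fl _)) (fl _))) _.
  by rewrite /= scaler0 addr0 subr0.
- by apply: etrans (free_liftB (fl _) (free_lift1 _)) _; rewrite /= subrr.
- apply: etrans (free_liftB (fl _) (free_liftM (fl _) (fl _))) _.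
  by rewrite /= mulr1 subrr.
- apply: etrans (free_liftB (free_liftM (fl _) (fl _))
                            (free_liftM (fl _) (fl _))) _.
  by rewrite /= mulr0 mul0r subrr.
- apply: etrans (free_liftB (free_liftM (fl _) (fl _))
                            (free_liftM (fl _) (fl _))) _.
  by rewrite /= mulr0 mul0r subrr.
- apply: etrans (free_lift_sum _ _ (fun i => free_liftZ _ (fl _))) _.
  by rewrite big1 // => i _; rewrite /= scaler0.
- apply: etrans (free_liftB (free_liftM (fl _) (fl _))
                            (free_liftM (fl _) (fl _))) _.
  by rewrite /= mulr0 mul0r subrr.
- apply: etrans (free_liftB (free_liftM (fl _) (fl _))
                            (free_liftM (fl _) (fl _))) _.
  by rewrite /= mulr0 subrr.
- apply: etrans (free_liftB (free_liftM (fl _) (fl _))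
                            (free_liftM (fl _) (fl _))) _.
  by rewrite /= mulr0 subrr.
- apply: etrans (free_liftB (free_liftB (free_liftM (fl _) (fl _))
                                        (free_liftM (fl _) (fl _)))
    (free_liftZ _ (free_lift_sum _ _
       (fun i => free_liftZ _ (free_liftM (fl _) (fl _)))))) _.
  rewrite /= mulr0 subrr sub0r big1 ?scaler0 ?oppr0 // => i _.
  by rewrite mul0r scaler0.
Qed.

HB.instance Definition _ :=
  GRing.PzSemiRing_isNonZero.Build cherednik
    (presented_nontrivial trivial_char_relator).
HB.instance Definition _ :=
  GRing.LSemiModule_isLSemiAlgebra.Build K cherednik
    (@presented_scalerAl K generator (relator : set F)).
HB.instance Definition _ :=
  GRing.LSemiAlgebra_isSemiAlgebra.Build K cherednik
    (@presented_scalerAr K generator (relator : set F)).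

Definition gen (g : generator) : cherednik := \pi_cherednik (letter K g).

Local Notation pirel r := (@presented_rel _ _ (relator : set F) _ _ r).
Local Notation piM := (@presented_piM _ _ (relator : set F) _ _).
Local Notation piZ := (@presented_piZ _ _ (relator : set F) _ _).
Local Notation piD := (@presented_piD _ _ (relator : set F) _ _).
Local Notation piB := (@presented_piB _ _ (relator : set F) _ _).

Lemma gen_V_linear a u u' : gen (GV (a *: u + u')) = a *: gen (GV u) + gen (GV u').
Proof. by rewrite /gen -piZ -piD; exact: (pirel (rel_V_linear _ _ _)). Qed.

Lemma gen_Vdual_linear a U U' :
  gen (GVdual (a *: U + U')) = a *: gen (GVdual U) + gen (GVdual U').
Proof. by rewrite /gen -piZ -piD; exact: (pirel (rel_Vdual_linear _ _ _)). Qed.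

Lemma gen_W_one : gen (GW wone) = 1.
Proof.
rewrite /gen; apply: etrans (pirel rel_W_one) _.
exact: (presented_pi1 (relator : set F)).
Qed.

Lemma gen_W_mul s t : gen (GW (wmul s t)) = gen (GW s) * gen (GW t).
Proof. by rewrite /gen -piM; exact: (pirel (rel_W_mul _ _)). Qed.

Lemma gen_W_V s u :
  gen (GW s) * gen (GV u) = gen (GV (val s *m u)) * gen (GW s).
Proof. by rewrite /gen -!piM; exact: (pirel (rel_W_V _ _)). Qed.

Lemma gen_W_Vdual s U :
  gen (GW s) * gen (GVdual U) = gen (GVdual (U *m invmx (val s))) * gen (GW s).
Proof. by rewrite /gen -!piM; exact: (pirel (rel_W_Vdual _ _)). Qed.

Lemma gen_C_linear (a : 'I_d -> K) :
  (forall c, class_functions c -> \sum_i a i * c i = 0) ->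
  \sum_i a i *: gen (GC i) = 0.
Proof.
move=> a0; have := @rel_C_linear a a0; rewrite -[X in relator X]subr0.
move=> /(@presented_rel _ _ (relator : set F)).
rewrite presented_pi_sum raddf0; apply: etrans.
by apply: eq_bigr => i _; rewrite presented_piZ.
Qed.

Lemma gen_C_central i g : gen (GC i) * gen g = gen g * gen (GC i).
Proof. by rewrite /gen -!piM; exact: (pirel (rel_C_central _ _)). Qed.

Lemma gen_VV u u' : gen (GV u) * gen (GV u') = gen (GV u') * gen (GV u).
Proof. by rewrite /gen -!piM; exact: (pirel (rel_VV _ _)). Qed.

Lemma gen_VdualVdual U U' :
  gen (GVdual U) * gen (GVdual U') = gen (GVdual U') * gen (GVdual U).
Proof. by rewrite /gen -!piM; exact: (pirel (rel_VdualVdual _ _)). Qed.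

Lemma gen_VVdual u U :
  gen (GV u) * gen (GVdual U) - gen (GVdual U) * gen (GV u) = - 2%:R *:
    \sum_(i < d) (pairing u (root i) * pairing (coroot i) U
                  / pairing (coroot i) (root i)) *:
       (gen (GC i) * gen (GW (wrefl i))).
Proof.
rewrite /gen -!piM -piB; apply: etrans (pirel (rel_VVdual _ _)) _.
rewrite presented_piZ presented_pi_sum; congr (_ *: _).
by apply: eq_bigr => i _; rewrite presented_piZ presented_piM.
Qed.

Definition nonzero := {xi : K | xi != 0}.

Definition nonzero_inv (xi : nonzero) : nonzero :=
  exist _ (val xi)^-1 (invr_neq0 (valP xi)).

Definition act_gen (xi : nonzero) (g : generator) : cherednik :=
  match g with
  | GV u => gen (GV ((val xi)^-1 *: u))
  | GVdual U => gen (GVdual (val xi *: U))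
  | GW _ | GC _ => gen g
  end.

Lemma gen_VZ a u : gen (GV (a *: u)) = a *: gen (GV u).
Proof.
have g0 : gen (GV 0) = 0.
  by have := gen_V_linear (-1) 0 0; rewrite scaler0 addr0 scaleN1r addNr.
by rewrite -[a *: u]addr0 gen_V_linear g0 addr0.
Qed.

Lemma gen_VdualZ a U : gen (GVdual (a *: U)) = a *: gen (GVdual U).
Proof.
have g0 : gen (GVdual 0) = 0.
  by have := gen_Vdual_linear (-1) 0 0; rewrite scaler0 addr0 scaleN1r addNr.
by rewrite -[a *: U]addr0 gen_Vdual_linear g0 addr0.
Qed.

Fact act_gen_relator xi x : relator x -> free_lift (act_gen xi) x = 0.
Proof.
have fl g := free_lift_letter (act_gen xi) g.
case=> [a u u'|a U U'||s t|s u|s U|a a0|i g|u u'|U U'|u U].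
- apply: etrans (free_liftB (fl _) (free_liftD (free_liftZ _ (fl _)) (fl _))) _.
  by rewrite /= !gen_VZ gen_V_linear scalerDr !scalerA [_ * a]mulrC subrr.
- apply: etrans (free_liftB (fl _) (free_liftD (free_liftZ _ (fl _)) (fl _))) _.
  by rewrite /= !gen_VdualZ gen_Vdual_linear scalerDr !scalerA [_ * a]mulrC subrr.
- apply: etrans (free_liftB (fl _) (free_lift1 _)) _.
  by rewrite /= gen_W_one subrr.
- apply: etrans (free_liftB (fl _) (free_liftM (fl _) (fl _))) _.
  by rewrite /= gen_W_mul subrr.
- apply: etrans (free_liftB (free_liftM (fl _) (fl _))
                            (free_liftM (fl _) (fl _))) _.
  by rewrite /= gen_W_V -scalemxAr subrr.
- apply: etrans (free_liftB (free_liftM (fl _) (fl _))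
                            (free_liftM (fl _) (fl _))) _.
  by rewrite /= gen_W_Vdual -scalemxAl subrr.
- apply: etrans (free_lift_sum _ _ (fun i => free_liftZ _ (fl _))) _.
  exact: gen_C_linear.
- apply: etrans (free_liftB (free_liftM (fl _) (fl _))
                            (free_liftM (fl _) (fl _))) _.
  by case: g => [u|U|s|j] /=; rewrite gen_C_central subrr.
- apply: etrans (free_liftB (free_liftM (fl _) (fl _))
                            (free_liftM (fl _) (fl _))) _.
  by rewrite /= gen_VV subrr.
- apply: etrans (free_liftB (free_liftM (fl _) (fl _))
                            (free_liftM (fl _) (fl _))) _.
  by rewrite /= gen_VdualVdual subrr.
- apply: etrans (free_liftB (free_liftB (free_liftM (fl _) (fl _))
                                        (free_liftM (fl _) (fl _)))
    (free_liftZ _ (free_lift_sum _ _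
       (fun i => free_liftZ _ (free_liftM (fl _) (fl _)))))) _.
  rewrite /= gen_VZ gen_VdualZ -!scalerAl -!scalerAr !scalerA.
  by rewrite mulfV ?mulVf ?(valP xi) // !scale1r gen_VVdual subrr.
Qed.

Definition act (xi : nonzero) : cherednik -> cherednik :=
  presented_lift (act_gen xi).

HB.instance Definition _ xi :=
  GRing.isZmodMorphism.Build cherednik cherednik (act xi)
    (presented_lift_is_zmod_morphism (@act_gen_relator xi)).
HB.instance Definition _ xi :=
  GRing.isMonoidMorphism.Build cherednik cherednik (act xi)
    (presented_lift_is_monoid_morphism (@act_gen_relator xi)).
HB.instance Definition _ xi :=
  GRing.isScalable.Build K cherednik cherednik *:%R (act xi)
    (presented_lift_is_scalable (@act_gen_relator xi)).

Lemma act_genE xi g : act xi (gen g) = act_gen xi g.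
Proof.
by rewrite /act /gen (presented_lift_pi (@act_gen_relator xi)) free_lift_letter.
Qed.

Lemma actVK xi x : act xi (act (nonzero_inv xi) x) = x.
Proof.
elim/(@presented_ind _ _ (relator : set F)): x
  => [|x y ex ey|c x ex||g x ex].
- by rewrite !raddf0.
- apply: etrans (congr1 (act xi) (raddfD (act (nonzero_inv xi)) x y)) _.
  by apply: etrans (raddfD (act xi) _ _) _; exact: (congr2 +%R ex ey).
- by rewrite !linearZ /= ex.
- by rewrite !rmorph1.
- apply: etrans (congr1 (act xi) (rmorphM (act (nonzero_inv xi)) _ x)) _.
  apply: etrans (rmorphM (act xi) _ _) _.
  apply: (congr2 *%R _ ex).
  apply: etrans (congr1 (act xi) (act_genE (nonzero_inv xi) g)) _.
  case: g => [u|U|s|i] /=; rewrite act_genE //=.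
  + by rewrite scalerA invrK mulVf ?scale1r ?(valP xi).
  + by rewrite scalerA mulfV ?scale1r ?(valP xi).
Qed.

Local Notation Z := (centre_alg cherednik).

Fact act_centre_subproof xi (z : Z) : act xi (centre_val z) \in centre cherednik.
Proof.
apply/centreP => a; rewrite -[a](actVK xi) -!rmorphM.
by have /centreP -> := valP z.
Qed.

Definition act_centre xi (z : Z) : Z := CentreAlg (act_centre_subproof xi z).

Fact act_centre_is_zmod_morphism xi : zmod_morphism (act_centre xi).
Proof. by move=> x y; apply/val_inj; rewrite /= raddfB. Qed.
Fact act_centre_is_monoid_morphism xi : monoid_morphism (act_centre xi).
Proof.
by split=> [|x y]; apply/val_inj; rewrite /= ?rmorph1 ?rmorphM.
Qed.
Fact act_centre_is_scalable xi : scalable (act_centre xi).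
Proof. by move=> c x; apply/val_inj; rewrite /= linearZ. Qed.

HB.instance Definition _ xi :=
  GRing.isZmodMorphism.Build Z Z (act_centre xi) (act_centre_is_zmod_morphism xi).
HB.instance Definition _ xi :=
  GRing.isMonoidMorphism.Build Z Z (act_centre xi)
    (act_centre_is_monoid_morphism xi).
HB.instance Definition _ xi :=
  GRing.isScalable.Build K Z Z *:%R (act_centre xi) (act_centre_is_scalable xi).

Definition calogero_moser : variety K := spectrum Z.

(* [xi] acts on points by [chi |-> (z |-> chi (xi^-1 . z))]. *)
Definition act_point (xi : nonzero) (chi : calogero_moser) : calogero_moser :=
  (chi : {lrmorphism Z -> K^o}) \o act_centre (nonzero_inv xi).

(* The fixed points of the group of [n]-th roots of unity. *)
Definition mu_fixed (n : nat) : set calogero_moser :=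
  [set chi | forall xi : nonzero,
     n.-unity_root (val xi) -> act_point xi chi = chi].

End Cherednik.

Arguments mu_fixed {K d zeta} zeta_prim n.

(* Main.v *)
(* The fixed points are the characters of the centre Z that kill the
   homogeneous elements of degree not divisible by d. Let c be the parameter,
   r = x^d + y^d, R = X^d + Y^d and eu = xX + Yy. The substitution
   x -> x + bY, y -> y + bX preserves the relations of H, so the coefficients
   in b of (x + bY)(y + bX) and of (x + bY)^d + (y + bX)^d are central. With E
   the trivial idempotent of W, induction on degree shows that E H E = Z' E for
   the subalgebra Z' generated by c and these coefficients, and the PBW theorem
   (through Dunkl operators) shows that z |-> z E is injective on Z. Hence
   Z = Z', and a fixed character is determined by its values at c, r, R and eu,
   the other generators having degree nonzero modulo d. A computation in H E
   gives r R = (eu - dc)(eu + dc) eu^(d-2) modulo those other generators.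
   Conversely a point of the surface with v <> 0 comes from a Dunkl module, and
   the points with v = 0 follow by density. *)
Require Import Defs.
From HB Require Import structures.
From mathcomp Require Import all_boot all_order all_algebra.
From mathcomp Require mpoly.
From mathcomp Require Import boolp classical_sets functions reals complex.
From mathcomp Require Import zify ring.

Set Implicit Arguments.
Unset Strict Implicit.
Unset Printing Implicit Defensive.

Import Order.TTheory GRing.Theory Num.Theory.
Local Open Scope ring_scope.

(** The substitution is harmless because X and Y commute: x + bY and y + bX have the same brackets
    with X and Y as x and y have, reflections permute them with the same scalars, and they commute
    with each other since [x, X] = [y, Y]. So it is enough to prove the two invariants xy and x^d +
    y^d central by hand, with the parameter b kept formal. Generation is obtained without a
    structure theory of Z: a central z satisfies z E = E z E = z' E, and injectivity of z |-> z E
    gives z = z'. Since the fixed locus is reduced, no presentation of Z is needed either. Only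
    values of characters count, so Z' may be replaced by the elements whose values at all fixed
    characters are one polynomial in the four coordinates, and relations have to hold only modulo
    elements that vanish there. Oddness of d enters twice. It makes all reflections conjugate, which
    leaves a single parameter c, and it makes 2 invertible modulo d, so that the coefficient of b^i
    in the sum of d-th powers, of degree 2i - d, has degree nonzero modulo d for 0 < i < d. *)

Lemma commutator_exp (T : pzRingType) (a b : T) n :
  a ^+ n * b - b * a ^+ n =
  \sum_(j < n) a ^+ (n.-1 - j) * (a * b - b * a) * a ^+ j.
Proof.
elim: n => [|n IHn]; first by rewrite big_ord0 !expr0 mul1r mulr1 subrr.
rewrite big_ord_recl /= subn0 expr0 mulr1 exprSr.
have -> : a ^+ n * a * b - b * (a ^+ n * a) =
          a ^+ n * (a * b - b * a) + (a ^+ n * b - b * a ^+ n) * a.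
  rewrite mulrBr mulrBl !mulrA addrA.
  by rewrite addrNK.
rewrite IHn mulr_suml; congr (_ + _); apply: eq_bigr => j _.
by rewrite -!mulrA -exprSr -subn1 subnAC -subnDA addn1.
Qed.

(** * Invariants of x and y that commute with X *)

Section CentralInvariants.
Variables (T : pzRingType) (d : nat) (x y X c : T) (s w : nat -> T).
Hypotheses (c_central : forall t, c * t = t * c)
  (w_central : forall i t, w i * t = t * w i)
  (w_exp : forall i, w i ^+ d = 1)
  (xyC : x * y = y * x)
  (s_x : forall i, s i * x = w i ^+ d.-1 * y * s i)
  (s_y : forall i, s i * y = w i * x * s i)
  (xX : x * X - X * x = - (c * \sum_(i < d) s i))
  (yX : y * X - X * y = c * \sum_(i < d) w i * s i).

(** By the Leibniz rule the commutator is c times the sum of the x w_i s_i - s_i y, and s_i y = w_i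
    x s_i. *)
Lemma commute_prod : x * y * X = X * (x * y).
Proof.
apply/eqP; rewrite -subr_eq0; apply/eqP.
have -> : x * y * X - X * (x * y) =
    x * (y * X - X * y) + (x * X - X * x) * y.
  by rewrite mulrBr mulrBl !mulrA addrA addrNK.
rewrite xX yX mulNr mulrA -c_central -!mulrA -mulrBr.
rewrite mulr_sumr mulr_suml -sumrB big1 ?mulr0 // => i _.
by rewrite s_y mulrA -w_central -!mulrA subrr.
Qed.

(** In the expansions of the two commutators, the j-th term for x cancels the (d-1-j)-th term for y:
    with s_i moved to the right, both become x^(d-1-j) y^j s_i with coefficient w_i^(-j), up to
    sign. The inverse of w_i is written as a power because w_i^d = 1. *)
Lemma commute_sum_exp : (x ^+ d + y ^+ d) * X = X * (x ^+ d + y ^+ d).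
Proof.
have wn i n u : u * w i ^+ n = w i ^+ n * u.
  by elim: n => [|n IHn]; rewrite ?expr0 ?mulr1 ?mul1r // exprSr mulrA IHn
    -mulrA -w_central mulrA.
have wn' i m n u : u * (w i ^+ m) ^+ n = (w i ^+ m) ^+ n * u.
  by rewrite -exprM wn.
have s_xn i n : s i * x ^+ n = (w i ^+ d.-1) ^+ n * y ^+ n * s i.
  elim: n => [|n IHn]; first by rewrite !expr0 !mulr1 mul1r.
  rewrite exprSr mulrA IHn -mulrA s_x !mulrA -(mulrA _ (y ^+ n)) wn.
  by rewrite !mulrA -(exprSr _ n) -!(mulrA _ (y ^+ n)) -exprSr.
have s_yn i n : s i * y ^+ n = w i ^+ n * x ^+ n * s i.
  elim: n => [|n IHn]; first by rewrite !expr0 !mulr1 mul1r.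
  rewrite exprSr mulrA IHn -mulrA s_y !mulrA -(mulrA _ (x ^+ n)) -w_central.
  by rewrite !mulrA -(exprSr _ n) -!(mulrA _ (x ^+ n)) -exprSr.
apply/eqP; rewrite -subr_eq0; apply/eqP.
rewrite mulrDl mulrDr opprD addrACA !commutator_exp xX yX.
rewrite [X in _ + X](reindex_inj rev_ord_inj) /= -big_split /= big1 // => j _.
rewrite mulrN mulNr.
have cA u v t : u * (c * v) * t = c * (u * v * t) by rewrite mulrA -c_central -!mulrA.
rewrite !cA addrC -mulrBr; case: d w_exp j s_xn => [w1 []//|e w1 j s_xn].
have -> : (e.+1.-1 - (e.+1 - j.+1))%N = j.
  by rewrite subSS subKn // -ltnS.
rewrite !mulr_sumr !mulr_suml -sumrB big1 ?mulr0 // => i _.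
apply/eqP; rewrite subr_eq0; apply/eqP.
rewrite -[RHS]mulrA s_xn mulrA -(mulrA (y ^+ j)) -mulrA -mulrA s_yn.
rewrite !mulrA; congr (_ * _).
rewrite [LHS](_ : _ = w i ^+ (e.+1 - j) * (y ^+ j * x ^+ (e.+1 - j.+1))).
    rewrite /= wn' -mulrA; congr (_ * _); last first.
    have : GRing.comm (x ^+ (e - j)) (y ^+ j) by apply/commrX/commr_sym/commrX/esym.
    by rewrite subSS => ->.
  have -> : (w i ^+ e) ^+ j = (w i ^+ e) ^+ j * (w i ^+ j * w i ^+ (e.+1 - j)).
    by rewrite -exprD subnKC ?w1 ?mulr1 // ltnW.
  rewrite mulrA -exprM -exprD -[X in (_ + X)%N]mul1n -mulnDl addn1 exprM w1.
  by rewrite expr1n mul1r.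
rewrite -(mulrA (y ^+ j)) -mulrA -exprS subSS (subSn (ltnSE (ltn_ord j))).
by rewrite !mulrA wn.
Qed.

End CentralInvariants.

(** * Central elements *)

(* The letters [(false, false)], [(false, true)], [(true, false)] and
   [(true, true)] stand for x, y, X and Y; [s i] multiplies the letter [l] by
   [zeta ^+ (i * weight d l)] and flips its second component. *)
Definition weight (d : nat) (l : bool * bool) : nat :=
  if l.1 == l.2 then d.-1 else 1.

(** On basis vectors this is the coefficient of C_i s_i in [u, U]: the denominator 2 zeta^i absorbs
    the factor 2. The exponent [d.-1] stands for -1. *)
Definition bracket_coef (K : fieldType) (d : nat) (zeta : K) (e e' : bool)
    (i : nat) : K :=
  if e == e' then -1 else zeta ^+ (i * (if e then 1 else d.-1)).

(* [shuffle p q n i] is the sum of the words with [n - i] letters [p] and [i]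
   letters [q]. *)
Section Invariants.
Variables (T : nzRingType) (d : nat) (g : bool * bool -> T).

Definition shuffle (p q : T) (n i : nat) : T := ((p%:P + q%:P * 'X) ^+ n)`_i.

Lemma shuffleS0 p q n : shuffle p q n.+1 0 = p * shuffle p q n 0.
Proof.
rewrite /shuffle exprS mulrDl coefD coefCM -mulrA coefCM -commr_polyX coefMX.
by rewrite mulr0 addr0.
Qed.

Lemma shuffleSS p q n i :
  shuffle p q n.+1 i.+1 = p * shuffle p q n i.+1 + q * shuffle p q n i.
Proof.
by rewrite /shuffle exprS mulrDl coefD coefCM -mulrA coefCM -commr_polyX coefMX.
Qed.

Definition invV : T := g (false, false) * g (false, true).
Definition invVdual : T := g (true, false) * g (true, true).
(** This is the coefficient of b in (x + bY)(y + bX), which explains the order Yy in the second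
    summand; with yY instead, a sum of reflections would have to be added. *)
Definition euler : T :=
  g (false, false) * g (true, false) + g (true, true) * g (false, true).
(** The coefficient of b^i in (x + bY)^d + (y + bX)^d. It is x^d + y^d for i = 0 and X^d + Y^d for i
    = d. *)
Definition inv_mixed (i : nat) : T :=
  shuffle (g (false, false)) (g (true, true)) d i +
  shuffle (g (false, true)) (g (true, false)) d i.

End Invariants.

(** The relations of H on a basis, with reflections indexed by natural numbers modulo d. A product
    of three reflections is again one, s_i s_j s_k = s_(i-j+k), so that rotations need no generators
    of their own. *)
Record cherednik_rel (K : numFieldType) (d : nat) (zeta : K) (A : algType K)
    (c : A) (g : bool * bool -> A) (s : nat -> A) : Prop := CherednikRel {
  c_central : forall t, c * t = t * c;
  s_periodic : forall i, s (i + d)%N = s i;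
  s_mul3 : forall i j k, s i * s j * s k = s (i + d.-1 * j + k)%N;
  s_square : forall i, s i * s i = 1;
  s_letter : forall i l,
    s i * g l = zeta ^+ (i * weight d l) *: (g (l.1, ~~ l.2) * s i);
  letter_comm : forall b e e', g (b, e) * g (b, e') = g (b, e') * g (b, e);
  letter_bracket : forall e e', g (false, e) * g (true, e')
    - g (true, e') * g (false, e) =
      c * \sum_(i < d) bracket_coef d zeta e e' i *: s i }.

Section Calculus.
Variables (K : numFieldType) (d : nat) (zeta : K) (A : algType K).
Variables (c : A) (g : bool * bool -> A) (s : nat -> A).
Hypotheses (d_gt1 : (1 < d)%N) (zeta_prim : d.-primitive_root zeta).
Hypothesis rel : cherednik_rel d zeta c g s.

Local Notation x := (g (false, false)).
Local Notation y := (g (false, true)).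
Local Notation X := (g (true, false)).
Local Notation Y := (g (true, true)).

Let d_gt0 : (0 < d)%N. Proof. exact: ltnW. Qed.

(** The first clause states that c is central; applied to z, it gives the commutation of z with
    c. *)
Definition centralizes (z : A) : Prop :=
  [/\ forall t, c * t = t * c, forall l, z * g l = g l * z
    & forall i, z * s i = s i * z].

(** The polynomial variable plays b, so an identity for [xb] and [yb] yields one identity in A for
    each power of b. *)
Let xb : {poly A} := x%:P + Y%:P * 'X.
Let yb : {poly A} := y%:P + X%:P * 'X.

Let zetaP (n : nat) : {poly A} := ((zeta ^+ n)%:A)%:P.

Let zetaP_central n t : zetaP n * t = t * zetaP n.
Proof.
apply/polyP => i; rewrite coefCM coefMC.
by rewrite mulr_algl mulr_algr.
Qed.

Let zetaP_exp n m : zetaP n ^+ m = zetaP (n * m).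
Proof. by rewrite /zetaP -polyC_exp exprZn expr1n -exprM. Qed.

Let polyCZ n (t : A) : (zeta ^+ n *: t)%:P = zetaP n * t%:P.
Proof. by rewrite /zetaP -polyCM mulr_algl. Qed.

Let cP_central t : c%:P * t = t * c%:P.
Proof. by apply/polyP => i; rewrite coefCM coefMC (c_central rel). Qed.

Let XC (p : A) : 'X * p%:P = p%:P * 'X. Proof. exact/esym/commr_polyX. Qed.

Let zeta_mod n m : n = m %[mod d] -> zeta ^+ n = zeta ^+ m.
Proof.
by move=> nm; rewrite -(prim_expr_mod zeta_prim) nm (prim_expr_mod zeta_prim).
Qed.

(** The coefficient of b in the commutator is [x, X] - [y, Y], and both brackets equal -c times the
    sum of the reflections. *)
Lemma shuffle_poly_comm : xb * yb = yb * xb.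
Proof.
have [cc _ _ _ _ gC gB] := rel.
have yY := gB true true; have xX := gB false false.
rewrite /xb /yb !mulrDl !mulrDr -!mulrA !(mulrA 'X) !XC -!mulrA !(mulrA _%:P) -!polyCM.
rewrite (gC false false true) (gC true true false) -!addrA; congr (_ + _).
rewrite !addrA; congr (_ + _); rewrite -!mulrDl -!polyCD; congr ((_)%:P * _).
have : x * X - X * x = y * Y - Y * y by rewrite xX yY.
move/eqP; rewrite subr_eq addrAC eq_sym subr_eq => /eqP.
by rewrite addrC => <-; rewrite addrC.
Qed.

Let s_xb i : (s i)%:P * xb = zetaP (i * d.-1) * yb * (s i)%:P.
Proof.
have sg := s_letter rel.
rewrite /xb /yb !mulrDr mulrDl -!mulrA XC !mulrA -!(polyCM (s i)) !sg /= !polyCZ.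
by rewrite !polyCM !mulrA.
Qed.

Let s_yb i : (s i)%:P * yb = zetaP i * xb * (s i)%:P.
Proof.
have sg := s_letter rel.
rewrite /xb /yb !mulrDr mulrDl -!mulrA XC !mulrA -!(polyCM (s i)) !sg /= !polyCZ.
by rewrite !polyCM !mulrA muln1.
Qed.

Let bracket_b (e e' : bool) :
  let b := if e then yb else xb in
  b * (g (true, e'))%:P - (g (true, e'))%:P * b =
  c%:P * (\sum_(i < d) bracket_coef d zeta e e' i *: s i)%:P.
Proof.
have [cc _ _ _ _ gC gB] := rel.
rewrite -polyCM -gB; case: e; rewrite /= /xb /yb mulrDl mulrDr opprD addrACA;
  rewrite -mulrA XC !mulrA -!polyCM (gC true _ e') subrr addr0;
  by rewrite -polyCB.
Qed.

Let sum_zetaP m : (\sum_(i < d) zeta ^+ (i * m) *: s i)%:P =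
  \sum_(i < d) zetaP (i * m) * (s i)%:P.
Proof. by rewrite raddf_sum; apply: eq_bigr => i _ /=; rewrite polyCZ. Qed.

Let sum_one : (\sum_(i < d) (-1) *: s i)%:P = - \sum_(i < d) (s i)%:P.
Proof. by rewrite raddf_sum -sumrN; apply: eq_bigr => i _ /=;
  rewrite scaleN1r polyCN. Qed.

Let commutes (F : {poly A} -> {poly A} -> {poly A}) : Prop :=
  forall e, F xb yb * (g (true, e))%:P = (g (true, e))%:P * F xb yb.

Let prod_commutes : commutes (fun u v => u * v).
Proof.
have w1 i : zetaP i ^+ d = 1.
  by rewrite zetaP_exp /zetaP mulnC exprM (prim_expr_order zeta_prim) expr1n scale1r.
case.
(* For Y the roles of x and y are exchanged, and w_i becomes zeta^(-i). *)
- rewrite shuffle_poly_comm.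
  apply: (@commute_prod _ d yb xb Y%:P c%:P (fun i => (s i)%:P)
    (fun i => zetaP (i * d.-1))) => //.
  + by have /= -> := bracket_b true true; rewrite sum_one mulrN.
  + by have /= -> := bracket_b false true; rewrite sum_zetaP.
- apply: (@commute_prod _ d xb yb X%:P c%:P (fun i => (s i)%:P)
    (fun i => zetaP (i * 1))) => //.
  + by move=> i; rewrite s_yb muln1.
  + by have /= -> := bracket_b false false; rewrite sum_one mulrN.
  + by have /= -> := bracket_b true false; rewrite sum_zetaP.
Qed.

Let exp_commutes : commutes (fun u v => u ^+ d + v ^+ d).
Proof.
have w1 i : zetaP i ^+ d = 1.
  by rewrite zetaP_exp /zetaP mulnC exprM (prim_expr_order zeta_prim) expr1n scale1r.
case.
- rewrite addrC.
  apply: (@commute_sum_exp _ d yb xb Y%:P c%:P (fun i => (s i)%:P)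
    (fun i => zetaP (i * d.-1))) => //.
  + by rewrite shuffle_poly_comm.
  + move=> i; rewrite s_yb zetaP_exp; congr (_ * _ * _).
    rewrite /zetaP; congr (_%:A%:P); apply: zeta_mod.
    case: d d_gt1 => [|[|n]] //= _.
    have -> : (i * n.+1 * n.+1 = i * n * n.+2 + i)%N by lia.
    by rewrite modnMDl.
  + by have /= -> := bracket_b true true; rewrite sum_one mulrN.
  + by have /= -> := bracket_b false true; rewrite sum_zetaP.
- apply: (@commute_sum_exp _ d xb yb X%:P c%:P (fun i => (s i)%:P)
    (fun i => zetaP (i * 1))) => //.
  + by rewrite shuffle_poly_comm.
  + by move=> i; rewrite s_xb zetaP_exp muln1.
  + by move=> i; rewrite s_yb muln1.
  + by have /= -> := bracket_b false false; rewrite sum_one mulrN.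
  + by have /= -> := bracket_b true false; rewrite sum_zetaP.
Qed.

Lemma inv_mixed_coef i : (xb ^+ d + yb ^+ d)`_i = inv_mixed d g i.
Proof. by rewrite coefD. Qed.

(** Commutation with x and y follows from x = xb - bY and y = yb - bX; then coefficients of b are
    compared. *)
Let coefs_centralize (p : {poly A}) :
  p * xb = xb * p -> p * yb = yb * p ->
  (forall e, p * (g (true, e))%:P = (g (true, e))%:P * p) ->
  (forall i, p * (s i)%:P = (s i)%:P * p) ->
  forall i, centralizes p`_i.
Proof.
move=> px py pV ps i.
have coefP t : p * t%:P = t%:P * p -> forall j, p`_j * t = t * p`_j.
  by move=> pt j; rewrite -coefMC pt coefCM.
split=> [|[[] e]|j]; try exact: coefP.
  exact: c_central rel.
apply: coefP; case: e.
- have -> : y%:P = yb - X%:P * 'X by rewrite addrK.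
  by rewrite mulrBr mulrBl py mulrA pV -!mulrA commr_polyX.
- have -> : x%:P = xb - Y%:P * 'X by rewrite addrK.
  by rewrite mulrBr mulrBl px mulrA pV -!mulrA commr_polyX.
Qed.

Let zetaP_unit i : zetaP (i * d.-1) * zetaP i = 1.
Proof.
rewrite /zetaP -polyCM mulr_algl scalerA -exprD -mulnSr prednK //.
by rewrite mulnC exprM (prim_expr_order zeta_prim) expr1n scale1r.
Qed.

Lemma prod_centralizes i : centralizes (xb * yb)`_i.
Proof.
have C := shuffle_poly_comm.
apply: coefs_centralize; [by rewrite -mulrA -C | by rewrite mulrA C |
  exact: prod_commutes | move=> j].
rewrite mulrA s_xb -!mulrA s_yb -(mulrA (zetaP j)) (mulrA yb) -zetaP_central.
by rewrite !mulrA zetaP_unit mul1r C.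
Qed.

Lemma exp_centralizes i : centralizes (xb ^+ d + yb ^+ d)`_i.
Proof.
have C := shuffle_poly_comm.
have zetaPd j m : zetaP (j * m) ^+ d = 1.
  rewrite zetaP_exp /zetaP mulnC exprM (prim_expr_order zeta_prim) expr1n.
  by rewrite scale1r.
apply: coefs_centralize; last 1 first.
- have sb (u v : {poly A}) j m n : (s j)%:P * u = zetaP m * v * (s j)%:P ->
      (s j)%:P * u ^+ n = zetaP m ^+ n * v ^+ n * (s j)%:P.
    move=> su; elim: n => [|n IHn]; first by rewrite !expr0 !mulr1 mul1r.
    rewrite exprSr mulrA IHn -mulrA su !mulrA -(mulrA _ (v ^+ n)) -zetaP_central.
    by rewrite !mulrA -(exprSr _ n) -!(mulrA _ (v ^+ n)) -exprSr.
  move=> j; rewrite mulrDl mulrDr (sb _ _ _ _ _ (s_xb j)) (sb _ _ _ _ _ (s_yb j)).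
  by rewrite zetaPd -[j in zetaP j]muln1 zetaPd !mul1r addrC.
- by apply/esym/commrD; apply: commrX; [exact: commr_refl | exact: C].
- by apply/esym/commrD; apply: commrX; [exact/commr_sym/C | exact: commr_refl].
- exact: exp_commutes.
Qed.

Lemma inv_mixed_centralizes i : centralizes (inv_mixed d g i).
Proof. by rewrite -inv_mixed_coef; exact: exp_centralizes. Qed.

Lemma prod_polyE : xb * yb = (invV g)%:P + (euler g)%:P * 'X + (invVdual g)%:P * 'X^2.
Proof.
rewrite /xb /yb mulrDl !mulrDr -!mulrA !(mulrA 'X) !XC -!mulrA !(mulrA _%:P) -!polyCM.
rewrite -expr2 -!addrA; congr (_ + _); rewrite !addrA -mulrDl -polyCD.
by rewrite (letter_comm rel true true) expr2 mulrA.
Qed.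

Lemma invV_centralizes : centralizes (invV g).
Proof.
suff -> : invV g = (xb * yb)`_0 by exact: prod_centralizes.
by rewrite prod_polyE !coefD coefC !coefMX coefMXn /= !addr0.
Qed.

Lemma euler_centralizes : centralizes (euler g).
Proof.
suff -> : euler g = (xb * yb)`_1 by exact: prod_centralizes.
by rewrite prod_polyE !coefD coefC coefMX coefC coefMXn /= addr0 add0r.
Qed.

Lemma invVdual_centralizes : centralizes (invVdual g).
Proof.
suff -> : invVdual g = (xb * yb)`_2 by exact: prod_centralizes.
by rewrite prod_polyE !coefD coefC coefMX coefC coefMXn coefC /= !add0r.
Qed.
End Calculus.

(** * The spherical subalgebra *)

Section Spherical.
Variables (K : numFieldType) (d : nat) (zeta : K) (A : algType K).
Variables (c : A) (g : bool * bool -> A) (s : nat -> A).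
Hypotheses (d_gt1 : (1 < d)%N) (zeta_prim : d.-primitive_root zeta).
Hypothesis rel : cherednik_rel d zeta c g s.
Variables (E : A) (Zs : A -> Prop).
Hypotheses (sE : forall i, s i * E = E) (Es : forall i, E * s i = E)
  (EE : E * E = E).
Hypotheses (Zs_central : forall z t, Zs z -> z * t = t * z)
  (Zs1 : Zs 1) (ZsD : forall z z', Zs z -> Zs z' -> Zs (z + z'))
  (ZsM : forall z z', Zs z -> Zs z' -> Zs (z * z'))
  (ZsZ : forall k z, Zs z -> Zs (k *: z))
  (Zs_c : Zs c) (Zs_invV : Zs (invV g)) (Zs_invVdual : Zs (invVdual g))
  (Zs_euler : Zs (euler g)) (Zs_mixed : forall i, Zs (inv_mixed d g i)).

Local Notation x := (g (false, false)).
Local Notation y := (g (false, true)).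
Local Notation X := (g (true, false)).
Local Notation Y := (g (true, true)).

(** [Zs] is any algebra of central elements containing c and the coefficients in b. It is left
    abstract so that it can later consist of the elements with polynomial values at fixed
    characters. *)
Definition spherical (h : A) : Prop := exists2 z, Zs z & E * h * E = z * E.

Lemma sphericalD h h' : spherical h -> spherical h' -> spherical (h + h').
Proof.
move=> [z Zz e] [z' Zz' e']; exists (z + z'); first exact: ZsD.
by rewrite mulrDr !mulrDl e e'.
Qed.

Lemma sphericalZ k h : spherical h -> spherical (k *: h).
Proof.
move=> [z Zz e]; exists (k *: z); first exact: ZsZ.
by rewrite -scalerAr -!scalerAl e.
Qed.

Lemma sphericalB h h' : spherical h -> spherical h' -> spherical (h - h').
Proof. by move=> sh sh'; rewrite -scaleN1r; exact/sphericalD/sphericalZ. Qed.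

Lemma spherical0 : spherical 0.
Proof. by rewrite -(scale0r 1); apply: sphericalZ; exists 1; rewrite ?mulr1 ?mul1r. Qed.

Lemma sphericalM z h : Zs z -> spherical h -> spherical (z * h).
Proof.
move=> Zz [z' Zz' e]; exists (z * z'); first exact: ZsM.
by rewrite mulrA -(Zs_central E Zz) -!mulrA (mulrA E) e.
Qed.

Lemma spherical_sum (I : Type) (r : seq I) (F : I -> A) :
  (forall i, spherical (F i)) -> spherical (\sum_(i <- r) F i).
Proof. by move=> sF; elim/big_ind: _ => //; [exact: spherical0 | exact: sphericalD].
  Qed.

Lemma spherical_sl i h : spherical h -> spherical (s i * h).
Proof. by move=> [z Zz e]; exists z => //; rewrite mulrA Es. Qed.

Lemma spherical_sr i h : spherical h -> spherical (h * s i).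
Proof. by move=> [z Zz e]; exists z => //; rewrite -!mulrA sE mulrA. Qed.

Lemma spherical_eq h h' : spherical (h - h') -> spherical h' -> spherical h.
Proof. by move=> sB sh'; rewrite -(subrK h' h); exact: sphericalD. Qed.

Local Notation word := (seq (bool * bool)).
Definition word_val (u : word) : A := \prod_(l <- u) g l.
Definition flip (u : word) : word := [seq (l.1, ~~ l.2) | l <- u].
Definition word_weight (u : word) : nat := \sum_(l <- u) weight d l.

Lemma word_val_cat u v : word_val (u ++ v) = word_val u * word_val v.
Proof. by rewrite /word_val big_cat. Qed.

Lemma s_word i u : s i * word_val u =
  zeta ^+ (i * word_weight u) *: (word_val (flip u) * s i).
Proof.
elim: u => [|l u IHu].
  by rewrite /word_val /word_weight !big_nil mulr1 mul1r muln0 scale1r.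
rewrite /word_val /word_weight !big_cons mulrA (s_letter rel) /=.
rewrite -/(word_val u) -/(word_val (flip u)) -/(word_weight u).
by rewrite -scalerAl -(mulrA _ (s i)) IHu -scalerAr scalerA mulrA -exprD -mulnDr.
Qed.

(* Conjugation by reflections: [E] absorbs them on both sides. *)
Lemma spherical_flip i u : E * word_val u * E =
  zeta ^+ (i * word_weight u) *: (E * word_val (flip u) * E).
Proof.
by rewrite -{1}(Es i) -!mulrA (mulrA (s i)) s_word -!scalerAl -scalerAr -!mulrA sE.
Qed.

(** Absorbing s_0 or s_1 turns the word into the same flipped word, but with scalars 1 and
    zeta^weight; these differ, so the element is zero. *)
Lemma spherical_weight u : ~~ (d %| word_weight u)%N -> E * word_val u * E = 0.
Proof.
move=> wt; have := spherical_flip 1 u; rewrite [X in X = _](spherical_flip 0).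
rewrite mul0n mul1n scale1r => /eqP; rewrite -subr_eq0 -{1}[_ * E]scale1r -scalerBl.
rewrite scaler_eq0 subr_eq0 eq_sym -(prim_order_dvd zeta_prim) (negPf wt) /= => /eqP e.
by rewrite (spherical_flip 0) e scaler0.
Qed.

Lemma letter_commutator l l' : exists k : nat -> K,
  g l * g l' - g l' * g l = c * \sum_(i < d) k i *: s i.
Proof.
case: l l' => [[] e] [[] e'].
- exists (fun=> 0); rewrite (letter_comm rel) subrr big1 ?mulr0 // => i _.
  by rewrite scale0r.
- exists (fun i => - bracket_coef d zeta e' e i).
  rewrite -opprB (letter_bracket rel) -mulrN -sumrN; congr (_ * _).
  by apply: eq_bigr => i _; rewrite scaleNr.
- by exists (bracket_coef d zeta e e'); rewrite (letter_bracket rel).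
- exists (fun=> 0); rewrite (letter_comm rel) subrr big1 ?mulr0 // => i _.
  by rewrite scale0r.
Qed.

Section Step.
Variable n : nat.
Hypothesis IHn : forall u, (size u < n)%N -> spherical (word_val u).

(** The bracket of two letters is c times a sum of reflections. A reflection can be moved to the
    right end, where E absorbs it, and the word that remains is shorter by two letters. *)
Lemma spherical_swap u l l' v : (size u + size v < n)%N ->
  spherical (word_val (u ++ l :: l' :: v) - word_val (u ++ l' :: l :: v)).
Proof.
move=> un; rewrite !word_val_cat /word_val !big_cons -mulrBr !mulrA -mulrBl.
have [k ->] := letter_commutator l l'.
rewrite -/(word_val u) -/(word_val v) (c_central rel) -(mulrA _ c) !mulrA.
rewrite -(Zs_central _ Zs_c) -mulrA; apply: sphericalM => //.
rewrite mulr_sumr mulr_suml; apply: spherical_sum => i.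
rewrite -scalerAr -scalerAl -mulrA; apply: sphericalZ; rewrite s_word -scalerAr.
apply: sphericalZ; rewrite mulrA; apply: spherical_sr.
by rewrite -word_val_cat; apply: IHn; rewrite size_cat size_map.
Qed.

Lemma spherical_move p l v w : (size p + size v + size w < n)%N ->
  spherical (word_val (p ++ l :: v ++ w) - word_val (p ++ v ++ l :: w)).
Proof.
elim: v p => [|l' v IHv] p pn; first by rewrite subrr; exact: spherical0.
rewrite /= in pn *; rewrite -(subrK (word_val (p ++ l' :: l :: v ++ w)) (word_val _)).
rewrite -addrA; apply: sphericalD.
  by apply: spherical_swap; rewrite size_cat; lia.
rewrite -!(cat_rcons l'); apply: IHv; rewrite size_rcons; lia.
Qed.

Lemma spherical_perm p u v : perm_eq u v -> (size p + size u <= n)%N ->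
  spherical (word_val (p ++ u) - word_val (p ++ v)).
Proof.
elim: u p v => [|l u IHu] p v uv un.
  have /nilP -> : nilp v by rewrite /nilp -(perm_size uv).
  by rewrite subrr; exact: spherical0.
have lv : l \in v by rewrite -(perm_mem uv) mem_head.
case/splitPr: lv uv => v1 v2 uv.
have uv' : perm_eq u (v1 ++ v2).
  by rewrite -(perm_cons l); apply: perm_trans uv _; rewrite -[l :: v2]cat1s perm_catCA.
rewrite -(subrK (word_val (p ++ l :: v1 ++ v2)) (word_val (p ++ l :: u))).
rewrite -addrA; apply: sphericalD.
  by rewrite -!(cat_rcons l); apply: IHu => //; rewrite size_rcons addSnnS.
have := perm_size uv'; rewrite size_cat /= in un * => suv.
apply: spherical_move; lia.
Qed.

(** Letters commute up to spherical elements, so the 'C(m, i) words summed in the shuffle all agree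
    with the sorted one. *)
Lemma spherical_shuffle p m v l l' i : (size p + m + size v <= n)%N ->
  spherical (word_val p * shuffle (g l) (g l') m i * word_val v -
    'C(m, i)%:R *: word_val (p ++ nseq (m - i) l ++ nseq i l' ++ v)).
Proof.
elim: m p i => [|m IHm] p i pn.
  rewrite /shuffle expr0 coef1; case: i => [|i].
    by rewrite bin0 scale1r mulr1 -word_val_cat subrr; exact: spherical0.
  by rewrite /= bin0n /= mulr0 mul0r scale0r subrr; exact: spherical0.
have val_rcons q k : word_val (rcons q k) = word_val q * g k.
  by rewrite -cats1 word_val_cat /word_val big_seq1.
case: i => [|i].
  rewrite shuffleS0 bin0 scale1r subn0 mulrA -val_rcons.
  have := IHm (rcons p l) 0%N; rewrite bin0 scale1r subn0 /= cat_rcons; apply.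
  by rewrite size_rcons; lia.
rewrite shuffleSS mulrDr mulrDl !mulrA -!val_rcons binS natrD scalerDl opprD addrACA.
have IH1 := IHm (rcons p l) i.+1; have IH2 := IHm (rcons p l') i.
apply: sphericalD.
  have [im|mi] := ltnP i m; last first.
    by move: IH1; rewrite bin_small // !scale0r; apply; rewrite size_rcons; lia.
  move: IH1; rewrite size_rcons subSS (cat_rcons l) -(subnSK im); apply; lia.
apply: (@spherical_eq _ (word_val (rcons p l') * shuffle (g l) (g l') m i
    * word_val v
  - 'C(m, i)%:R *: word_val (rcons p l' ++ nseq (m - i) l ++ nseq i l' ++ v)));
  last by apply: IH2; rewrite size_rcons; lia.
rewrite opprB [_ + (_ - _)]addrC subrKA -scalerBr subSS.
have [im|mi] := leqP i m; last first.
  by rewrite bin_small // scale0r; exact: spherical0.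
apply: sphericalZ; rewrite (cat_rcons l').
by apply: spherical_move; rewrite size_cat !size_nseq; lia.
Qed.

Lemma word_val_nseq m l : word_val (nseq m l) = g l ^+ m.
Proof.
elim: m => [|m IHm]; first by rewrite /word_val big_nil expr0.
by rewrite /word_val big_cons -/(word_val _) IHm exprS.
Qed.

Definition sorted_word (a b e f : nat) : word :=
  nseq a (false, false) ++ nseq b (false, true) ++
  nseq e (true, false) ++ nseq f (true, true).

Lemma word_val_mono a b e f :
  word_val (sorted_word a b e f) = x ^+ a * y ^+ b * X ^+ e * Y ^+ f.
Proof. by rewrite /sorted_word !word_val_cat !word_val_nseq !mulrA. Qed.

Lemma size_mono a b e f : size (sorted_word a b e f) = (a + b + e + f)%N.
Proof. by rewrite /sorted_word !size_cat !size_nseq !addnA. Qed.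

Lemma perm_mono u : perm_eq u (sorted_word (count_mem (false, false) u)
  (count_mem (false, true) u) (count_mem (true, false) u)
  (count_mem (true, true) u)).
Proof.
apply/allP => l _; rewrite /sorted_word /= !count_cat !count_nseq /=.
by case: l => [[] []] /=; apply/eqP; lia.
Qed.

Lemma spherical_mono_of u a b e f : (size u <= n)%N ->
  count_mem (false, false) u = a -> count_mem (false, true) u = b ->
  count_mem (true, false) u = e -> count_mem (true, true) u = f ->
  spherical (x ^+ a * y ^+ b * X ^+ e * Y ^+ f) -> spherical (word_val u).
Proof.
move=> un <- <- <- <-; rewrite -word_val_mono; apply: spherical_eq.
exact: (@spherical_perm [::] _ _ (perm_mono u)).
Qed.

Lemma spherical_of_mono u a b e f : (size u <= n)%N ->
  count_mem (false, false) u = a -> count_mem (false, true) u = b ->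
  count_mem (true, false) u = e -> count_mem (true, true) u = f ->
  spherical (word_val u) -> spherical (x ^+ a * y ^+ b * X ^+ e * Y ^+ f).
Proof.
move=> un <- <- <- <-; rewrite -word_val_mono; apply: spherical_eq.
rewrite -opprB -scaleN1r; apply: sphericalZ.
exact: (@spherical_perm [::] _ _ (perm_mono u)).
Qed.

Let IHmono a b e f : (a + b + e + f < n)%N ->
  spherical (x ^+ a * y ^+ b * X ^+ e * Y ^+ f).
Proof. by rewrite -word_val_mono -size_mono; exact: IHn. Qed.

Let pair_exp b m k : g (b, false) ^+ m.+1 * g (b, true) ^+ k.+1 =
  g (b, false) * g (b, true) * (g (b, false) ^+ m * g (b, true) ^+ k).
Proof.
rewrite exprS exprS -!mulrA; congr (_ * _); rewrite !mulrA; congr (_ * _).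
by apply/esym; apply: commrX; exact: (letter_comm rel).
Qed.

(** The central factor xy splits off and leaves a shorter monomial; the next lemma does the same
    with XY. *)
Lemma spherical_xy a b e f : (a.+1 + b.+1 + e + f <= n)%N ->
  spherical (x ^+ a.+1 * y ^+ b.+1 * X ^+ e * Y ^+ f).
Proof.
move=> le_n; rewrite pair_exp -!mulrA mulrA; apply: sphericalM => //.
by rewrite !mulrA; apply: IHmono; lia.
Qed.

Lemma spherical_XY a b e f : (a + b + e.+1 + f.+1 <= n)%N ->
  spherical (x ^+ a * y ^+ b * X ^+ e.+1 * Y ^+ f.+1).
Proof.
move=> le_n; rewrite -mulrA pair_exp mulrA -(Zs_central _ Zs_invVdual) -mulrA.
by apply: sphericalM; rewrite // !mulrA; apply: IHmono; lia.
Qed.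

Lemma spherical_of_flip u : spherical (word_val (flip u)) -> spherical (word_val u).
Proof. by move=> [z Zz e]; exists z; rewrite // (spherical_flip 0) scale1r. Qed.

Lemma spherical_mono_flip a b e f : (a + b + e + f <= n)%N ->
  spherical (x ^+ b * y ^+ a * X ^+ f * Y ^+ e) ->
  spherical (x ^+ a * y ^+ b * X ^+ e * Y ^+ f).
Proof.
move=> le_n s_ba; rewrite -word_val_mono; apply: spherical_of_flip.
by apply: spherical_mono_of s_ba; rewrite ?size_map ?size_mono //;
  rewrite /sorted_word /flip !map_cat !map_nseq !count_cat !count_nseq /=; lia.
Qed.

Lemma eulerE : euler g = x * X + y * Y + c * \sum_(i < d) s i.
Proof.
have -> : c * \sum_(i < d) s i = Y * y - y * Y.
  rewrite -opprB (letter_bracket rel true true) -mulrN -sumrN; congr (_ * _).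
  by apply: eq_bigr => i _; rewrite scaleN1r opprK.
by rewrite -addrA [y * Y + _]addrC subrK.
Qed.

(** With m = x^a X^e, the element (xX + yY) m is spherical, since xX + yY is [euler] up to
    reflections that E absorbs. If m = 1, flipping shows that xX and yY contribute equally, so each
    is half of the sum. Otherwise yYm contains xy or XY and is already known to be spherical, hence
    so is xXm. *)
Lemma spherical_xX a e : (a.+1 + e.+1 <= n)%N ->
  spherical (x ^+ a.+1 * y ^+ 0 * X ^+ e.+1 * Y ^+ 0).
Proof.
move=> le_n; set m := x ^+ a * y ^+ 0 * X ^+ e * Y ^+ 0.
have s_m : spherical m by apply: IHmono; lia.
have s_sum : spherical (x * X * m + y * Y * m).
  rewrite -mulrDl; have -> : x * X + y * Y = euler g - c * \sum_(i < d) s i.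
    by rewrite eulerE addrK.
  rewrite mulrBl -mulrA; apply: sphericalB; first exact: sphericalM.
  apply: sphericalM => //; rewrite mulr_suml; apply: spherical_sum => i.
  exact: spherical_sl.
have val2 l l' u : word_val (l :: l' :: u) = g l * g l' * word_val u.
  by rewrite /word_val !big_cons mulrA.
apply: (@spherical_of_mono ((false, false) :: (true, false) :: sorted_word a 0 e 0));
  try by rewrite /sorted_word /= ?size_cat ?count_cat ?size_nseq ?count_nseq /=; lia.
rewrite val2 word_val_mono -/m.
have [ae0|ae_gt0] := posnP (a + e).
  have m1 : m = 1.
    by rewrite /m; case: (a) (e) ae0 => [|?] [|?] //; rewrite !expr0 !mulr1.
  have E_flip : E * (x * X) * E = E * (y * Y) * E.
    have := spherical_flip 0 [:: (false, false); (true, false)].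
    by rewrite mul0n scale1r /word_val /= !big_cons big_nil !mulr1.
  case: s_sum => z Zz; rewrite m1 !mulr1 mulrDr mulrDl -E_flip -mulr2n -scaler_nat.
  move=> e2; exists (2%:R^-1 *: z); first exact: ZsZ.
  by rewrite -scalerAl -e2 scalerA mulVf ?scale1r // pnatr_eq0.
apply: (@spherical_eq _ (- (y * Y * m))); first by rewrite opprK.
rewrite -scaleN1r; apply: sphericalZ; rewrite /m -word_val_mono -val2.
case: a ae_gt0 le_n {m s_m s_sum} => [|a] ae_gt0 le_n.
  case: e ae_gt0 le_n => // e _ le_n.
  by apply: (spherical_mono_of _ _ _ _ _ (@spherical_XY 0 1 e 0 _));
    rewrite /sorted_word /= ?size_cat ?count_cat ?size_nseq ?count_nseq /=; lia.
by apply: (spherical_mono_of _ _ _ _ _ (@spherical_xy a 0 e 1 _));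
    rewrite /sorted_word /= ?size_cat ?count_cat ?size_nseq ?count_nseq /=; lia.
Qed.

(** The weight kills the monomial unless d divides a + k. Then d of its letters are traded by means
    of a coefficient of (x + bY)^d + (y + bX)^d: up to spherical elements, x^a' Y^k' v becomes -
    y^a' X^k' v. *)
Lemma spherical_xY a k : (0 < a + k <= n)%N ->
  spherical (x ^+ a * y ^+ 0 * X ^+ 0 * Y ^+ k).
Proof.
case/andP=> ak_gt0 le_n.
have [d_ak|d_ak] := boolP (d %| a + k)%N; last first.
  exists 0; first by rewrite -(scale0r 1); exact: ZsZ.
  rewrite mul0r -word_val_mono; apply: spherical_weight.
  have -> : word_weight (sorted_word a 0 0 k) = ((a + k) * d.-1)%N.
    rewrite /word_weight /sorted_word !big_cat !big_nseq /= !iter_addn_0 /weight /=.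
    by rewrite !add0n mulnDl mulnC (mulnC k).
  rewrite Gauss_dvdl //.
  by rewrite coprime_sym -{2}(prednK (ltnW d_gt1)) coprimenS.
have le_d := dvdn_leq ak_gt0 d_ak.
(* As many letters x as possible are taken, so that either v contains no x or no Y is traded. *)
have [a' [k' [a'k' a'a k'k a'd]]] : exists a' k', [/\ (a' + k' = d)%N,
    (a' <= a)%N, (k' <= k)%N & (a' = a \/ a' = d)].
  exists (minn a d), (d - minn a d)%N; split; lia.
pose v := sorted_word (a - a') 0 0 (k - k').
pose w l l' := nseq a' l ++ nseq k' l' ++ v.
have bin0 : 'C(d, k')%:R != 0 :> K by rewrite pnatr_eq0 -lt0n bin_gt0; lia.
have shuf l l' : spherical (shuffle (g l) (g l') d k' * word_val v -
    'C(d, k')%:R *: word_val (w l l')).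
  have := @spherical_shuffle [::] d v l l' k'; rewrite {1}/word_val big_nil mul1r.
  have -> : (d - k' = a')%N by lia.
  by apply; rewrite /v size_mono /=; lia.
have s_sum : spherical (word_val (w (false, false) (true, true)) +
    word_val (w (false, true) (true, false))).
  rewrite -[X in spherical X](scalerK bin0); apply: sphericalZ.
  rewrite scalerDr; apply: (@spherical_eq _ (inv_mixed d g k' * word_val v)).
    rewrite -opprB -scaleN1r /inv_mixed mulrDl opprD addrACA.
    by apply: sphericalZ; exact: sphericalD.
  apply: sphericalM => //; apply: IHn; rewrite size_mono; lia.
apply: (spherical_of_mono _ _ _ _ _ (_ : spherical (word_val
    (w (false, false) (true, true))))); try by rewrite /w /v /sorted_word /=
    ?size_cat ?count_cat ?size_nseq ?count_nseq /=; lia.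
(* Without further letters the two words are flips of each other and contribute equally. Otherwise
   the traded word meets v in xy or XY, except for y^d Y^k, whose flip x^d X^k has been treated. *)
have [v0|v_gt0] := posnP (a + k - d).
  have E_flip : E * word_val (w (false, false) (true, true)) * E =
      E * word_val (w (false, true) (true, false)) * E.
    rewrite (spherical_flip 0) scale1r /w /v; congr (E * word_val _ * E).
    rewrite /flip /sorted_word !map_cat !map_nseq /=.
    by have [-> ->] : (a - a' = 0 /\ k - k' = 0)%N by lia.
  case: s_sum => z Zz; rewrite mulrDr mulrDl -E_flip -mulr2n -scaler_nat.
  move=> e2; exists (2%:R^-1 *: z); first exact: ZsZ.
  by rewrite -scalerAl -e2 scalerA mulVf ?scale1r // pnatr_eq0.
apply: (spherical_eq (h' := - word_val (w (false, true) (true, false))));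
  first by rewrite opprK.
rewrite -scaleN1r; apply: sphericalZ.
apply: (@spherical_mono_of _ (a - a') a' k' (k - k'));
  try by rewrite /w /v /sorted_word /=
    ?size_cat ?count_cat ?size_nseq ?count_nseq /=; lia.
have [a'0|a'_gt0] := posnP a'.
  have [k1 k1E] : exists k1, k' = k1.+1 by exists k'.-1; lia.
  have [k2 k2E] : exists k2, (k - k')%N = k2.+1 by exists (k - k').-1; lia.
  by rewrite k2E k1E; apply: spherical_XY; lia.
have [a1 a1E] : exists a1, a' = a1.+1 by exists a'.-1; lia.
have [aa'|a'_lt] := posnP (a - a'); last first.
  have [a2 a2E] : exists a2, (a - a')%N = a2.+1 by exists (a - a').-1; lia.
  by rewrite a2E a1E; apply: spherical_xy; lia.
have [k2 k2E] : exists k2, (k - k')%N = k2.+1 by exists (k - k').-1; lia.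
have [k'0|k'_gt0] := posnP k'; last first.
  have [k1 k1E] : exists k1, k' = k1.+1 by exists k'.-1; lia.
  by rewrite k2E k1E; apply: spherical_XY; lia.
apply: spherical_mono_flip; first lia.
by rewrite aa' k2E k'0 a1E; apply: spherical_xX; lia.
Qed.

(** A nonconstant monomial containing neither xy nor XY involves, up to a flip, only x and X or only
    x and Y. *)
Lemma spherical_step a b e f : (a + b + e + f <= n)%N ->
  spherical (x ^+ a * y ^+ b * X ^+ e * Y ^+ f).
Proof.
case: a b e f => [|a] [|b] [|e] [|f] le_n; try by apply: spherical_xy; lia.
all: try by apply: spherical_XY; lia.
all: try by apply: spherical_xY; lia.
all: try by apply: spherical_xX; lia.
- by exists 1; rewrite ?expr0 ?mulr1 ?mul1r.
- by apply: spherical_mono_flip; [lia | apply: spherical_xY; lia].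
- by apply: spherical_mono_flip; [lia | apply: spherical_xY; lia].
- by apply: spherical_mono_flip; [lia | apply: spherical_xX; lia].
- by apply: spherical_mono_flip; [lia | apply: spherical_xY; lia].
Qed.

End Step.

Theorem spherical_word u : spherical (word_val u).
Proof.
have [n] := ubnP (size u); elim: n u => // n IHn u; rewrite ltnS => le_n.
apply: (spherical_mono_of IHn le_n erefl erefl erefl erefl).
by apply: spherical_step IHn _ _ _ _ _; rewrite -size_mono -(perm_size (perm_mono u)).
Qed.

End Spherical.

Lemma sum_unity_root (K : fieldType) (d : nat) (zeta : K) (m : nat) :
  d.-primitive_root zeta -> ~~ (d %| m)%N -> \sum_(i < d) zeta ^+ (i * m) = 0.
Proof.
move=> zeta_prim dm; apply: (@mulfI _ (zeta ^+ m - 1)).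
  by rewrite subr_eq0 -(prim_order_dvd zeta_prim).
rewrite mulr0 (eq_bigr (fun i : 'I_d => (zeta ^+ m) ^+ i)); last first.
  by move=> i _; rewrite -exprM mulnC.
by rewrite -subrX1 -exprM mulnC exprM (prim_expr_order zeta_prim) expr1n subrr.
Qed.

Lemma shuffle0 (T : nzRingType) (p q : T) n : shuffle p q n 0 = p ^+ n.
Proof.
elim: n => [|n IHn]; first by rewrite /shuffle !expr0 coef1.
by rewrite shuffleS0 IHn exprS.
Qed.

Lemma shuffle_gt (T : nzRingType) (p q : T) n i :
  (n < i)%N -> shuffle p q n i = 0.
Proof.
elim: n i => [|n IHn] [|i] //; first by rewrite /shuffle expr0 coef1.
by rewrite ltnS => ni; rewrite shuffleSS !IHn ?mulr0 ?addr0 // ltnW.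
Qed.

Lemma shufflenn (T : nzRingType) (p q : T) n : shuffle p q n n = q ^+ n.
Proof.
elim: n => [|n IHn]; first by rewrite shuffle0 expr0.
by rewrite shuffleSS IHn shuffle_gt // mulr0 add0r exprS.
Qed.

(** * The equation of the surface *)

Section Relation.
Variables (K : numFieldType) (d : nat) (zeta : K) (A : algType K).
Variables (c : A) (g : bool * bool -> A) (s : nat -> A).
Hypotheses (d_gt1 : (1 < d)%N) (zeta_prim : d.-primitive_root zeta).
Hypothesis rel : cherednik_rel d zeta c g s.
Variable (E : A).
Hypothesis (sE : forall i, s i * E = E).
Hypotheses (invV_central : forall t, invV g * t = t * invV g)
  (invVdual_central : forall t, invVdual g * t = t * invVdual g)
  (euler_central : forall t, euler g * t = t * euler g)
  (mixed_central : forall i t, inv_mixed d g i * t = t * inv_mixed d g i).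

Local Notation x := (g (false, false)).
Local Notation y := (g (false, true)).
Local Notation X := (g (true, false)).
Local Notation Y := (g (true, true)).
Local Notation eu := (euler g).

(* The three generators of nonzero degree modulo d that occur when r R is
   rewritten. *)
Definition mod_ideal (h : A) : Prop := exists h1 h2 h3,
  h = invV g * h1 + invVdual g * h2 + inv_mixed d g 1 * h3.

Let smallD h h' : mod_ideal h -> mod_ideal h' -> mod_ideal (h + h').
Proof.
move=> [h1 [h2 [h3 ->]]] [k1 [k2 [k3 ->]]]; exists (h1 + k1), (h2 + k2), (h3 + k3).
by rewrite !mulrDr [LHS]addrACA; congr (_ + _); exact: addrACA.
Qed.

Let smallMl t h : mod_ideal h -> mod_ideal (t * h).
Proof.
move=> [h1 [h2 [h3 ->]]]; exists (t * h1), (t * h2), (t * h3).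
rewrite !mulrDr (mulrA t (invV g)) (mulrA t (invVdual g)).
rewrite (mulrA t (inv_mixed d g 1)) -invV_central -invVdual_central.
by rewrite -mixed_central -(mulrA (invV g)) -(mulrA (invVdual g)) -(mulrA (inv_mixed
  d g 1)).
Qed.

Let smallMr t h : mod_ideal h -> mod_ideal (h * t).
Proof.
by move=> [h1 [h2 [h3 ->]]]; exists (h1 * t), (h2 * t), (h3 * t);
  rewrite 2!mulrDl -(mulrA (invV g)) -(mulrA (invVdual g)) -(mulrA (inv_mixed d g 1)).
Qed.

Let smallZ k h : mod_ideal h -> mod_ideal (k *: h).
Proof. by move=> sh; rewrite -mulr_algl; exact: smallMl. Qed.

Let small_eq h h' : mod_ideal (h - h') -> mod_ideal h' -> mod_ideal h.
Proof. by move=> sB sh'; rewrite -(subrK h' h); exact: smallD. Qed.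

Let small_invV h : mod_ideal (invV g * h).
Proof. by exists h, 0, 0; rewrite !mulr0 !addr0. Qed.
Let small_invVdual h : mod_ideal (invVdual g * h).
Proof. by exists 0, h, 0; rewrite !mulr0 addr0 add0r. Qed.
Let small_mixed h : mod_ideal (inv_mixed d g 1 * h).
Proof. by exists 0, 0, h; rewrite !mulr0 !add0r. Qed.

Local Notation e := d.-1.
Local Notation T := (x * X).
Local Notation U := (y * Y).
Local Notation N := (\sum_(i < d) s i).

Let eE : e.+1 = d. Proof. by rewrite prednK // ltnW. Qed.

Let s_exp i l n h : s i * (g l ^+ n * h) =
  zeta ^+ (i * (n * weight d l)) *: (g (l.1, ~~ l.2) ^+ n * (s i * h)).
Proof.
elim: n => [|n IHn]; first by rewrite !expr0 !mul1r mul0n muln0 scale1r.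
rewrite exprS -!mulrA mulrA (s_letter rel) -scalerAl -mulrA IHn.
by rewrite -scalerAr scalerA -exprD exprS mulSn mulnDr -!mulrA.
Qed.

Let s_T i n h : s i * (T ^+ n * h) = U ^+ n * (s i * h).
Proof.
elim: n => [|n IHn]; first by rewrite !expr0 !mul1r.
rewrite !exprS -!mulrA -[x]expr1 s_exp expr1 -[X]expr1 s_exp IHn -scalerAr scalerA.
rewrite -exprD -mulnDr !mul1n /weight /= addn1 eE mulnC exprM.
by rewrite (prim_expr_order zeta_prim) expr1n scale1r !expr1.
Qed.

(** A sum of reflections moved through a word until E absorbs it leaves a sum of powers of a root of
    unity. This removes the correction terms of all brackets below, except those of weight divisible
    by d. *)
Let N_zero m (F : 'I_d -> A) h : ~~ (d %| m)%N ->
  (forall i, F i = zeta ^+ (i * m) *: h) -> \sum_(i < d) F i = 0.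
Proof.
move=> dm FE; rewrite (eq_bigr (fun i : 'I_d => zeta ^+ (i * m) *: h)) //.
by rewrite -scaler_suml (sum_unity_root zeta_prim dm) scale0r.
Qed.

Let xX : x * X = X * x - c * N.
Proof.
apply/eqP; rewrite eq_sym subr_eq addrC -subr_eq; apply/eqP.
rewrite -opprB (letter_bracket rel) /= -mulrN -sumrN; congr (_ * _).
by apply: eq_bigr => i _; rewrite scaleN1r opprK.
Qed.

(** Moving x past one X costs cN, and N annihilates the rest because the number of letters X still
    to its right lies strictly between 0 and d. *)
Let x_XT j m : (j < d)%N ->
  x * (X ^+ j.+1 * (T ^+ m * E)) = X ^+ j * (T ^+ m.+1 * E).
Proof.
elim: j => [|j IHj] jd; first by rewrite expr0 mul1r expr1 exprS -!mulrA.
rewrite exprS -mulrA [LHS]mulrA {1}xX mulrBl -(mulrA X) IHj 1?ltnW // -(mulrA c).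
have -> : N * (X ^+ j.+1 * (T ^+ m * E)) = 0.
  rewrite mulr_suml; apply: (@N_zero j.+1 _ (Y ^+ j.+1 * (U ^+ m * E))).
    by rewrite gtnNdvd.
  by move=> i; rewrite s_exp s_T sE muln1.
by rewrite mulr0 subr0 mulrA -exprS.
Qed.

Let x_X k n : (k <= n <= d)%N -> x ^+ k * (X ^+ n * E) = X ^+ (n - k) * (T ^+ k * E).
Proof.
elim: k => [|k IHk] /andP[kn nd]; first by rewrite !expr0 !mul1r subn0.
rewrite exprS -mulrA IHk ?(ltnW kn) // -(subnSK kn) x_XT //; lia.
Qed.

Let s0_flip k n b b' h : s 0 * (g (b, false) ^+ k * (g (b', false) ^+ n * h)) =
  g (b, true) ^+ k * (g (b', true) ^+ n * (s 0 * h)).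
Proof. by rewrite !s_exp !mul0n !scale1r. Qed.

Let s0_flip' k n b b' h : s 0 * (g (b, true) ^+ k * (g (b', false) ^+ n * h)) =
  g (b, false) ^+ k * (g (b', true) ^+ n * (s 0 * h)).
Proof. by rewrite !s_exp !mul0n !scale1r. Qed.

Let y_Y n : (n <= d)%N -> y ^+ n * (Y ^+ n * E) = U ^+ n * E.
Proof.
move=> nd; have := congr1 (fun t => s 0 * t) (@x_X n n _).
by rewrite s0_flip sE subnn expr0 mul1r s_T sE; apply; rewrite leqnn.
Qed.

(** T and Yy are the two summands of [euler], and their product is (xy)(XY) because XY is central.
    Hence T^2 agrees with eu T modulo the ideal. *)
Let T_sq : T * T = eu * T - invV g * invVdual g.
Proof.
have -> : invV g * invVdual g = x * X * (Y * y).
  by rewrite /invV -mulrA -invVdual_central /invVdual !mulrA.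
by rewrite euler_central -mulrBr /euler addrK.
Qed.

Let T_exp k : mod_ideal (T ^+ k.+1 - eu ^+ k * T).
Proof.
elim: k => [|k IHk]; first by rewrite expr1 mul1r subrr; exists 0, 0, 0;
  rewrite !mulr0 !addr0.
apply: (@small_eq _ (T * (T ^+ k.+1 - eu ^+ k * T))); last exact: smallMl.
have euk t : eu ^+ k * t = t * eu ^+ k by apply/esym; apply: commrX;
  exact/esym/euler_central.
rewrite mulrBr -exprS opprB [_ + (_ - _)]addrC subrKA.
rewrite mulrA -euk -[_ * T * T]mulrA T_sq exprSr -mulrA -mulrBr.
rewrite addrAC subrr add0r mulrN -mulNr; apply: smallMl; exact: small_invV.
Qed.

Let s0_euler h : s 0 * (eu * h) = eu * (s 0 * h).
Proof. by rewrite mulrA -euler_central -mulrA. Qed.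

(** [euler] contains Yy and not U = yY, so the argument for T does not apply to U; the result is
    carried over by s_0, which exchanges T and U and is absorbed by E. *)
Let U_exp k : mod_ideal (U ^+ k.+1 * E - eu ^+ k * (U * E)).
Proof.
have s0_euk h : s 0 * (eu ^+ k * h) = eu ^+ k * (s 0 * h).
  elim: k h => [|j IHj] h; first by rewrite !expr0 !mul1r.
  by rewrite exprS -!mulrA s0_euler IHj.
have := smallMl (s 0) (smallMr E (T_exp k)).
have -> : (T ^+ k.+1 - eu ^+ k * T) * E =
    T ^+ k.+1 * E - eu ^+ k * (T ^+ 1 * E) by rewrite mulrBl -mulrA expr1.
by rewrite mulrBr s_T sE s0_euk s_T sE expr1.
Qed.

Local Notation N1 := (\sum_(i < d) zeta ^+ (i * 1) *: s i).
Local Notation Ne := (\sum_(i < d) zeta ^+ (i * e) *: s i).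

Let yX : y * X = X * y + c * N1.
Proof. by rewrite addrC -(letter_bracket rel true false) subrK. Qed.

Let xY : x * Y = Y * x + c * Ne.
Proof. by rewrite addrC -(letter_bracket rel false true) subrK. Qed.

Let y_X n : (n < d)%N -> y * (X ^+ n * E) = X ^+ n * (y * E).
Proof.
elim: n => [|n IHn] nd; first by rewrite !expr0 !mul1r.
rewrite exprS -!mulrA [LHS]mulrA {1}yX mulrDl -(mulrA X) IHn 1?ltnW // -(mulrA c).
have -> : N1 * (X ^+ n * E) = 0.
  rewrite mulr_suml; apply: (@N_zero n.+1 _ (Y ^+ n * E)); first by rewrite gtnNdvd.
  by move=> i; rewrite -scalerAl s_exp sE scalerA -exprD -mulnDr /weight /= muln1.
by rewrite mulr0 addr0.
Qed.

(** At the first of the d crossings the weight of the rest is d, so the sum of reflections yields d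
    equal terms instead of 0. This is the origin of the term dc in the equation. *)
Let y_Xd : y * (X ^+ d * E) = X ^+ d * (y * E) + d%:R *: (c * (Y ^+ e * E)).
Proof.
rewrite -[in X ^+ d]eE exprS -!mulrA [LHS]mulrA {1}yX mulrDl -(mulrA X) y_X;
  last by rewrite eE.
rewrite -(mulrA c); congr (_ + _).
rewrite scalerAr; congr (c * _); rewrite mulr_suml.
rewrite (eq_bigr (fun=> Y ^+ e * E)) ?sumr_const ?card_ord ?scaler_nat // => i _.
rewrite -scalerAl s_exp sE scalerA -exprD -mulnDr /weight /= muln1 add1n eE.
by rewrite mulnC exprM (prim_expr_order zeta_prim) expr1n scale1r.
Qed.

Local Notation h' := (X ^+ e * (y * E)).

Let s_h' i : s i * h' = zeta ^+ (i * d) *: (Y ^+ e * (x * E)).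
Proof.
rewrite s_exp -[y]expr1 s_exp sE !expr1 -scalerAr scalerA -exprD -mulnDr.
by rewrite /weight /= !muln1 addn1 eE.
Qed.

Let X_y l : (l < d)%N -> X * (y ^+ l * h') = y ^+ l * (X * h').
Proof.
elim: l => [|l IHl] ld; first by rewrite !expr0 !mul1r.
have -> : X * (y ^+ l.+1 * h') = y * (X * (y ^+ l * h')) - c * N1 * (y ^+ l * h').
  by rewrite [X in X - _]mulrA yX mulrDl addrK exprS -!mulrA.
rewrite IHl 1?ltnW // -mulrA.
have -> : N1 * (y ^+ l * h') = 0.
  rewrite mulr_suml; apply: (@N_zero (l.+1 + d) _ (x ^+ l * (Y ^+ e * (x * E)))).
    by rewrite dvdn_addl // gtnNdvd.
  move=> i; rewrite -scalerAl s_exp s_h' -scalerAr !scalerA -!exprD -!mulnDr.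
  by rewrite /weight /= muln1 add1n.
by rewrite mulr0 subr0 mulrA -exprS.
Qed.

Let Y_x l : (l < d)%N -> Y * (x ^+ l * h') = x ^+ l * (Y * h').
Proof.
elim: l => [|l IHl] ld; first by rewrite !expr0 !mul1r.
have -> : Y * (x ^+ l.+1 * h') = x * (Y * (x ^+ l * h')) - c * Ne * (x ^+ l * h').
  by rewrite [X in X - _]mulrA xY mulrDl addrK exprS -!mulrA.
rewrite IHl 1?ltnW // -mulrA.
have -> : Ne * (x ^+ l * h') = 0.
  rewrite mulr_suml; apply: (@N_zero (l.+1 * e + d) _ (y ^+ l * (Y ^+ e * (x * E)))).
    rewrite dvdn_addl // Gauss_dvdl ?gtnNdvd //.
    by rewrite coprime_sym -{2}eE coprimenS.
  move=> i; rewrite -scalerAl s_exp s_h' -scalerAr !scalerA -!exprD -!mulnDr.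
  by rewrite /weight /= mulSn.
by rewrite mulr0 subr0 mulrA -exprS.
Qed.

(** The n positions of q give the same result on h', as moving q through powers of p there costs
    nothing. *)
Let shuffle1 p q n : (n <= d)%N ->
  (forall l, (l < d)%N -> q * (p ^+ l * h') = p ^+ l * (q * h')) ->
  shuffle p q n 1 * h' = n%:R *: (p ^+ n.-1 * (q * h')).
Proof.
move=> nd qp; elim: n nd => [|n IHn] nd; first by rewrite shuffle_gt // mul0r scale0r.
rewrite shuffleSS shuffle0 mulrDl -!mulrA IHn 1?ltnW // qp // -scalerAr.
case: n {IHn nd} => [|n]; first by rewrite !scale0r add0r scale1r.
rewrite /= (mulrA p) -exprS.
by rewrite -[n.+2]addn1 natrD scalerDl scale1r.
Qed.

(** The first mixed invariant acts on h' as d (x^(d-1) Y + y^(d-1) X). Since Y h' contains the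
    factor XY, the first summand lies in the ideal, hence so does the second. *)
Let small_yX : mod_ideal (y ^+ e * (X * h')).
Proof.
have d0 : d%:R != 0 :> K by rewrite pnatr_eq0 -lt0n ltnW.
apply: (@small_eq _ (- (x ^+ e * (Y * h')))).
  rewrite opprK addrC -[X in mod_ideal X](scalerK d0); apply: smallZ.
  rewrite scalerDr -(shuffle1 (leqnn d) Y_x) -(shuffle1 (leqnn d) X_y) -mulrDl.
  exact: small_mixed.
rewrite -scaleN1r; apply/smallZ/smallMl.
have -> : Y * h' = invVdual g * (X ^+ e.-1 * (y * E)).
  have {1}-> : e = e.-1.+1 by rewrite prednK // -subn1 subn_gt0.
  by rewrite exprS -[in LHS]mulrA [LHS]mulrA (letter_comm rel true true false).
exact: small_invVdual.
Qed.

Let small_y_Xd : mod_ideal (y ^+ d * (X ^+ d * E) -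
   d%:R *: (c * (eu ^+ e.-1 * (U * E)))).
Proof.
have cyC n h : y ^+ n * (c * h) = c * (y ^+ n * h).
  by rewrite mulrA -(c_central rel) mulrA.
rewrite -{1}eE exprSr -!mulrA y_Xd mulrDr -addrA; apply: smallD.
  by rewrite -[in X ^+ d]eE exprS -!mulrA; exact: small_yX.
rewrite -scalerAr cyC -scalerBr -mulrBr; apply/smallZ/smallMl.
rewrite y_Y ?leq_pred //.
have e1 : e.-1.+1 = e by rewrite prednK // -subn1 subn_gt0.
by have := U_exp e.-1; rewrite e1 !mulrA.
Qed.

Let euk k t : eu ^+ k * t = t * eu ^+ k.
Proof. by apply/esym; apply: commrX; exact/esym/euler_central. Qed.

(** Of the four terms of the product, x^d X^d and y^d Y^d give eu^(d-1) T and eu^(d-1) U, and the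
    mixed ones give dc eu^(d-2) U and dc eu^(d-2) T. The sum is eu^(d-2) (eu + dc) (T + U), and (T +
    U) E = (eu - dc) E because N E = d E. *)
Theorem mod_ideal_relation : mod_ideal (((x ^+ d + y ^+ d) * (X ^+ d + Y ^+ d) -
  eu ^+ d.-2 * (eu + d%:R *: c) * (eu - d%:R *: c)) * E).
Proof.
have s0_c h : s 0 * (c * h) = c * (s 0 * h).
  by rewrite mulrA -(c_central rel) mulrA.
have s0_euk k h : s 0 * (eu ^+ k * h) = eu ^+ k * (s 0 * h).
  by rewrite mulrA -euk -mulrA.
have xY_d : mod_ideal (x ^+ d * (Y ^+ d * E) - d%:R *: (c * (eu ^+ e.-1 * (T ^+ 1 *
  E)))).
  have := smallMl (s 0) small_y_Xd.
  rewrite -[y * Y]expr1 mulrBr -scalerAr s0_c s0_euk s0_flip' sE.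
  rewrite (_ : s 0 * (U ^+ 1 * E) = T ^+ 1 * E) //.
  by rewrite expr1 -mulrA -[y]expr1 -[Y]expr1 !s_exp !mul0n !scale1r sE !expr1 mulrA.
have x_Xd : mod_ideal (x ^+ d * (X ^+ d * E) - eu ^+ e * (T * E)).
  have := smallMr E (T_exp e); rewrite mulrBl -mulrA eE x_X ?leqnn //.
  by rewrite subnn expr0 mul1r !mulrA.
have y_Yd : mod_ideal (y ^+ d * (Y ^+ d * E) - eu ^+ e * (U * E)).
  by rewrite y_Y // -{1}eE; exact: U_exp.
have := smallD (smallD x_Xd y_Yd) (smallD small_y_Xd xY_d).
congr mod_ideal; rewrite expr1.
have TUE : T * E + U * E = eu * E - d%:R *: (c * E).
  rewrite (eulerE rel) !mulrDl -(mulrA c).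
  have -> : N * E = d%:R *: E.
    rewrite mulr_suml (eq_bigr (fun=> E)) => [|i _]; last by rewrite sE.
    by rewrite sumr_const card_ord scaler_nat.
  by rewrite -scalerAr addrK.
have e1 : e.-1.+1 = e by rewrite prednK // -subn1 subn_gt0.
rewrite mulrBl.
have -> : eu ^+ e.-1 * (eu + d%:R *: c) * (eu - d%:R *: c) * E =
    eu ^+ e * (T * E) + eu ^+ e * (U * E) + (d%:R *: (c * (eu ^+ e.-1 * (U * E)))
    + d%:R *: (c * (eu ^+ e.-1 * (T * E)))).
  rewrite -scalerDr -!mulrDr [U * E + _]addrC TUE.
  have WE : (eu - d%:R *: c) * E = eu * E - d%:R *: (c * E).
    by rewrite mulrBl scalerAl.
  rewrite -mulrA WE; set W := _ - _; rewrite -mulrA mulrDl mulrDr mulrA -exprSr e1.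
  congr (_ + _); rewrite -scalerAl -scalerAr; congr (_ *: _).
  by rewrite [LHS]mulrA -(c_central rel) -mulrA.
have -> : (x ^+ d + y ^+ d) * (X ^+ d + Y ^+ d) * E =
    x ^+ d * (X ^+ d * E) + y ^+ d * (Y ^+ d * E) +
    (y ^+ d * (X ^+ d * E) + x ^+ d * (Y ^+ d * E)).
  rewrite -mulrA [(X ^+ d + _) * E]mulrDl mulrDl !mulrDr.
  by rewrite [X in _ + X = _]addrC addrACA; congr (_ + _); exact: addrC.
rewrite [X in X + _ = _]addrACA [X in _ + X = _]addrACA -!opprD.
by rewrite [LHS]addrACA -opprD.
Qed.

End Relation.

(** * Spanning by PBW monomials *)

Section PBW.
Variables (K : numFieldType) (d : nat) (zeta : K) (A : algType K).
Variables (c : A) (g : bool * bool -> A) (s : nat -> A).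
Hypotheses (d_gt0 : (0 < d)%N).
Hypothesis rel : cherednik_rel d zeta c g s.

Local Notation x := (g (false, false)).
Local Notation y := (g (false, true)).
Local Notation X := (g (true, false)).
Local Notation Y := (g (true, true)).

Definition group_elt (w : nat * bool) : A := if w.2 then s w.1 * s 0 else s w.1.

Definition pbw_nat (k i j l m : nat) (w : nat * bool) : A :=
  c ^+ k * (X ^+ i * (Y ^+ j * (x ^+ l * (y ^+ m * group_elt w)))).

Definition pbw_index : Type := ((nat * nat * nat * nat * nat) * ('I_d * bool))%type.

Definition pbw (b : pbw_index) : A :=
  let: (k, i, j, l, m, (t, e)) := b in pbw_nat k i j l m (t : nat, e).

Definition pbw_span (h : A) : Prop :=
  exists r : seq (K * pbw_index), h = \sum_(p <- r) p.1 *: pbw p.2.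

Lemma pbw_span0 : pbw_span 0.
Proof. by exists [::]; rewrite big_nil. Qed.

Lemma pbw_spanD h h' : pbw_span h -> pbw_span h' -> pbw_span (h + h').
Proof. by move=> [r ->] [r' ->]; exists (r ++ r'); rewrite big_cat. Qed.

Lemma pbw_spanZ k h : pbw_span h -> pbw_span (k *: h).
Proof.
move=> [r ->]; exists [seq (k * p.1, p.2) | p <- r].
by rewrite big_map scaler_sumr; apply: eq_bigr => p _; rewrite scalerA.
Qed.

Lemma pbw_span_sum (I : Type) (r : seq I) (F : I -> A) :
  (forall i, pbw_span (F i)) -> pbw_span (\sum_(i <- r) F i).
Proof. by move=> sF; elim/big_ind: _ => //; [exact: pbw_span0 | exact: pbw_spanD]. Qed.

Lemma pbw_span_nat k i j l m w : pbw_span (pbw_nat k i j l m w).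
Proof.
have s_mod t : s (t %% d)%N = s t.
  rewrite [in RHS](divn_eq t d) addnC; elim: (t %/ d)%N => [|n IHn].
    by rewrite mul0n addn0.
  by rewrite mulSn [(d + _)%N]addnC addnA (s_periodic rel).
exists [:: (1, (k, i, j, l, m, (Ordinal (ltn_pmod w.1 d_gt0), w.2)))].
by rewrite big_seq1 scale1r /pbw /pbw_nat /group_elt /= s_mod.
Qed.

Lemma pbw_spanM t : (forall k i j l m w, pbw_span (t * pbw_nat k i j l m w)) ->
  forall h, pbw_span h -> pbw_span (t * h).
Proof.
move=> tP h [r ->]; rewrite mulr_sumr; apply: pbw_span_sum => -[a [[[[[k i] j] l] m]
  [w e]]].
by rewrite -scalerAr; apply: pbw_spanZ; exact: tP.
Qed.

Lemma pbw_span_c h : pbw_span h -> pbw_span (c * h).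
Proof.
apply: pbw_spanM => k i j l m w; rewrite /pbw_nat mulrA -exprS.
exact: pbw_span_nat.
Qed.

Lemma pbw_span_V h b : pbw_span h -> pbw_span (g (true, b) * h).
Proof.
apply: pbw_spanM => k i j l m w; rewrite /pbw_nat mulrA.
have cX : g (true, b) * c ^+ k = c ^+ k * g (true, b).
  by apply: commrX; exact/esym/(c_central rel).
rewrite cX -mulrA; case: b {cX}.
- have -> t : Y * (X ^+ i * t) = X ^+ i * (Y * t).
    rewrite !mulrA; congr (_ * _); apply: commrX; exact: (letter_comm rel).
  by rewrite (mulrA Y) -exprS; exact: pbw_span_nat.
- by rewrite (mulrA X) -exprS; exact: pbw_span_nat.
Qed.

Lemma pbw_span_s n h : pbw_span h -> pbw_span (s n * h).
Proof.
apply: pbw_spanM => k i j l m w; rewrite /pbw_nat mulrA.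
have -> : s n * c ^+ k = c ^+ k * s n by apply: commrX; exact/esym/(c_central rel).
have sX t b a u : exists q, s n * (g (b, a) ^+ t * u) = q *: (g (b, ~~ a) ^+ t * (s n
  * u)).
  elim: t u => [|t IHt] u; first by exists 1; rewrite !expr0 !mul1r scale1r.
  have [q e] := IHt u; rewrite exprS -mulrA mulrA (s_letter rel) /= -scalerAl -mulrA e.
  rewrite -scalerAr scalerA (mulrA (g _)) -exprS.
  by exists (zeta ^+ (n * weight d (b, a)) * q).
rewrite -mulrA; have [q1 ->] := sX i true false (Y ^+ j * (x ^+ l * (y ^+ m *
  group_elt w))).
have [q2 ->] := sX j true true (x ^+ l * (y ^+ m * group_elt w)).
have [q3 ->] := sX l false false (y ^+ m * group_elt w).
have [q4 ->] := sX m false true (group_elt w).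
rewrite -!scalerAr; do 4!apply: pbw_spanZ.
have swap b p q t : g (b, true) ^+ p * (g (b, false) ^+ q * t) =
    g (b, false) ^+ q * (g (b, true) ^+ p * t).
  rewrite !mulrA; congr (_ * _); apply: commrX; apply/commr_sym/commrX.
  exact: (letter_comm rel).
rewrite /= swap (swap false).
have ss u v : s u * s v = s (u + d.-1 * v)%N * s 0.
  by have := s_mul3 rel u v 0; rewrite addn0 => <-; rewrite -mulrA (s_square rel) mulr1.
have -> : s n * group_elt w = group_elt (n + d.-1 * w.1, ~~ w.2)%N.
  case: w => w [] /=; rewrite /group_elt /=; last by rewrite ss.
  by rewrite mulrA ss -mulrA (s_square rel) mulr1.
exact: pbw_span_nat.
Qed.

(** Here x or y has to cross X^i Y^j. Each crossing adds c times reflections applied to a shorter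
    product, and the span is already stable under c and reflections. *)
Lemma pbw_span_Vdual h b : pbw_span h -> pbw_span (g (false, b) * h).
Proof.
apply: pbw_spanM => k i j l m w; rewrite /pbw_nat mulrA.
have -> : g (false, b) * c ^+ k = c ^+ k * g (false, b).
  by apply: commrX; exact/esym/(c_central rel).
rewrite -mulrA; set u := x ^+ l * _.
have base : pbw_span (g (false, b) * u).
  rewrite /u; case: b.
  - have -> t : y * (x ^+ l * t) = x ^+ l * (y * t).
      rewrite !mulrA; congr (_ * _); apply: commrX; exact: (letter_comm rel).
    rewrite (mulrA y) -exprS; have := pbw_span_nat 0 0 0 l m.+1 w.
    by rewrite /pbw_nat !expr0 !mul1r.
  - rewrite (mulrA x) -exprS; have := pbw_span_nat 0 0 0 l.+1 m w.
    by rewrite /pbw_nat !expr0 !mul1r.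
have u_span p q : pbw_span (X ^+ p * (Y ^+ q * u)).
  by have := pbw_span_nat 0 p q l m w; rewrite /pbw_nat expr0 mul1r.
have step e t : pbw_span t -> pbw_span (g (false, b) * t) ->
    pbw_span (g (false, b) * (g (true, e) * t)).
  move=> st sbt; have -> : g (false, b) * (g (true, e) * t) =
      g (true, e) * (g (false, b) * t) +
      c * \sum_(i < d) bracket_coef d zeta b e i *: (s i * t).
    have gg : g (false, b) * g (true, e) = g (true, e) * g (false, b) +
        c * \sum_(i < d) bracket_coef d zeta b e i *: s i.
      by rewrite addrC -(letter_bracket rel) subrK.
    rewrite mulrA gg mulrDl -mulrA -[c * _ * t]mulrA mulr_suml; congr (_ + c * _).
    by apply: eq_bigr => i' _; rewrite scalerAl.
  apply: pbw_spanD; first exact: pbw_span_V.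
  apply/pbw_span_c/pbw_span_sum => i'; exact/pbw_spanZ/pbw_span_s.
have sc n t : pbw_span t -> pbw_span (c ^+ n * t).
  move=> st; elim: n => [|n IHn]; first by rewrite expr0 mul1r.
  by rewrite exprS -mulrA; exact: pbw_span_c.
apply: sc; elim: i => [|i IHi].
  rewrite expr0 mul1r; elim: j => [|j IHj]; first by rewrite expr0 mul1r.
  rewrite exprS -mulrA; apply: step => //.
  by have := u_span 0 j; rewrite expr0 mul1r.
by rewrite exprS -mulrA; apply: step.
Qed.

Lemma pbw_span1 : pbw_span 1.
Proof.
have := pbw_span_nat 0 0 0 0 0 (0, true); rewrite /pbw_nat /group_elt !expr0 !mul1r /=.
by rewrite (s_square rel).
Qed.

Lemma pbw_span_uniq h : pbw_span h -> exists (r : seq pbw_index) (f : pbw_index -> K),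
  uniq r /\ h = \sum_(b <- r) f b *: pbw b.
Proof.
move=> [r ->]; exists (undup (unzip2 r)), (fun b => \sum_(p <- r | p.2 == b) p.1).
split; first exact: undup_uniq.
under [RHS]eq_bigr do rewrite scaler_suml.
rewrite (exchange_big_dep predT) //= big_seq [RHS]big_seq; apply: eq_bigr => p pr.
rewrite (eq_bigl (pred1 p.2)) => [|b]; last by rewrite eq_sym.
by rewrite -big_filter filter_pred1_uniq ?undup_uniq ?big_seq1 // mem_undup map_f.
Qed.
End PBW.

Lemma sum_delta (R : nzRingType) (V : lmodType R) (I : finType) (F : I -> V) i :
  \sum_j (j == i)%:R *: F j = F i.
Proof.
rewrite (bigD1 i) //= eqxx scale1r big1 ?addr0 // => j /negPf ->.
by rewrite scale0r.
Qed.

(** * The Cherednik algebra of the dihedral group *)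

Section Dihedral.
Variables (K : fieldType) (d : nat) (zeta : K).
Hypothesis zeta_prim : d.-primitive_root zeta.

Let d_gt0 : (0 < d)%N. Proof. exact: prim_order_gt0 zeta_prim. Qed.

Lemma prim_root_neq0 : zeta != 0.
Proof.
apply/eqP => z0; have := prim_expr_order zeta_prim.
by rewrite z0 expr0n gtn_eqF // => /esym/eqP; rewrite oner_eq0.
Qed.

Lemma prim_exprV i : zeta ^- i = zeta ^+ (i * d.-1).
Proof.
apply: (mulIf (expf_neq0 i prim_root_neq0)); rewrite mulVf ?expf_neq0 ?prim_root_neq0
  //.
by rewrite -exprD addnC -mulnS prednK // mulnC exprM (prim_expr_order zeta_prim) expr1n.
Qed.

Lemma prim_expr_eq n m : n = m %[mod d] -> zeta ^+ n = zeta ^+ m.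
Proof.
by move=> nm; rewrite -(prim_expr_mod zeta_prim) nm (prim_expr_mod zeta_prim).
Qed.

Lemma refl_periodic i : refl zeta (i + d) = refl zeta i.
Proof. by apply/matrixP => a b; rewrite !mxE exprD (prim_expr_order zeta_prim) mulr1.
  Qed.

Lemma refl_square i : refl zeta i *m refl zeta i = 1%:M.
Proof.
have z0 := expf_neq0 i prim_root_neq0.
apply/matrixP => a b; rewrite !mxE !big_ord_recl big_ord0 !mxE.
by case: a => [[|[|a]] //= a2]; case: b => [[|[|b]] //= b2];
  rewrite !(mul0r, mulr0, addr0, add0r) ?divff ?mulVf.
Qed.

Lemma refl_mul3 i j k :
  refl zeta i *m refl zeta j *m refl zeta k = refl zeta (i + d.-1 * j + k).
Proof.
apply/matrixP => a b; rewrite !mxE !big_ord_recl big_ord0 !mxE.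
rewrite !big_ord_recl !big_ord0 !mxE /= !exprD (mulnC d.-1) -prim_exprV.
have z0 := expf_neq0 j prim_root_neq0.
case: a => [[|[|a]] //= a2]; case: b => [[|[|b]] //= b2];
  rewrite !(mul0r, mulr0, addr0, add0r) //.
by rewrite !invfM invrK.
Qed.

Lemma invmx_refl i : invmx (refl zeta i) = refl zeta i.
Proof.
have u : refl zeta i \in unitmx by have [] := mulmx1_unit (refl_square i).
by rewrite -[RHS]mul1mx -(mulVmx u) -mulmxA refl_square mulmx1.
Qed.

Definition dihedral_elt (w : nat * bool) : 'M[K]_2 :=
  if w.2 then refl zeta w.1 *m refl zeta 0 else refl zeta w.1.

Lemma refl_mul i j : refl zeta i *m refl zeta j = dihedral_elt (i + d.-1 * j, true)%N.
Proof.
by rewrite /dihedral_elt /= -[(_ + _)%N]addn0 -refl_mul3 -[RHS]mulmxA refl_square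
  mulmx1.
Qed.

Lemma dihedralE w : dihedral zeta w -> exists v, w = dihedral_elt v.
Proof.
move=> /(_ [set w | exists v, w = dihedral_elt v]%classic); apply.
split; last by move=> v [] ->; [exists (0, false)%N | exists (1, false)%N].
split=> [|_ _ [u ->] [v ->]|_ [v ->]].
- by exists (0, true)%N; rewrite /dihedral_elt refl_square.
- case: u v => i [] [j []]; rewrite /dihedral_elt /=.
  + exists (i + d.-1 * 0 + j, true)%N.
    by rewrite mulmxA refl_mul3.
  + by exists (i + d.-1 * 0 + j, false)%N; rewrite refl_mul3.
  + rewrite mulmxA refl_mul /dihedral_elt /= -mulmxA refl_square mulmx1.
    by exists (i + d.-1 * j, false)%N.
  + by rewrite refl_mul; eexists.
- case: v => i []; last by exists (i, false); rewrite /dihedral_elt invmx_refl.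
  rewrite /dihedral_elt /= (_ : invmx _ = refl zeta 0 *m refl zeta i).
    by rewrite refl_mul; eexists.
  have e : refl zeta i *m refl zeta 0 *m (refl zeta 0 *m refl zeta i) = 1%:M.
    by rewrite mulmxA -(mulmxA (refl zeta i)) refl_square mulmx1 refl_square.
  have [u _] := mulmx1_unit e.
  by rewrite -[LHS]mulmx1 -e (mulmxA (invmx _)) mulVmx // mul1mx.
Qed.

Lemma dihedral_unit w : dihedral zeta w -> w \in unitmx.
Proof.
have ru i : refl zeta i \in unitmx by have [] := mulmx1_unit (refl_square i).
by move=> /dihedralE [[i []] ->]; rewrite /dihedral_elt /= ?unitmx_mul ?ru.
Qed.

Lemma wrefl_periodic i : wrefl zeta_prim (i + d) = wrefl zeta_prim i.
Proof. by apply/val_inj/refl_periodic. Qed.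

Lemma wrefl_square i :
  wmul (wrefl zeta_prim i) (wrefl zeta_prim i) = wone zeta.
Proof. by apply/val_inj/refl_square. Qed.

Lemma wrefl_mul3 i j k :
  wmul (wmul (wrefl zeta_prim i) (wrefl zeta_prim j)) (wrefl zeta_prim k) =
  wrefl zeta_prim (i + d.-1 * j + k).
Proof. by apply/val_inj/refl_mul3. Qed.

Lemma wreflP (w : dihedral zeta) : exists i, w = wrefl zeta_prim i \/
  w = wmul (wrefl zeta_prim i) (wrefl zeta_prim 0).
Proof.
have [[i []] e] := dihedralE (set_valP w); exists i; [right | left];
  exact/val_inj.
Qed.

Definition vec_letter (b : bool) : 'I_2 := if b then 1 else 0.

Local Notation H := (cherednik zeta_prim).
Local Notation gen := (gen zeta_prim).

Definition cgen (l : bool * bool) : H :=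
  if l.1 then gen (@GVdual K d zeta (delta_mx 0 (vec_letter l.2)))
  else gen (@GV K d zeta (delta_mx (vec_letter l.2) 0)).

Definition cpar : H := gen (@GC K d zeta (Ordinal d_gt0)).
Definition csym (i : nat) : H := gen (@GW K d zeta (wrefl zeta_prim i)).

Lemma refl_conj i k : refl zeta k *m refl zeta i *m invmx (refl zeta k) =
  refl zeta (k + d.-1 * i + k).
Proof. by rewrite invmx_refl refl_mul3. Qed.

Lemma cherednik_ind (P : H -> Prop) :
  P 0 -> (forall u v, P u -> P v -> P (u + v)) ->
  (forall k u, P u -> P (k *: u)) -> P 1 ->
  (forall l u, P u -> P (gen l * u)) -> forall u, P u.
Proof. exact: presented_ind. Qed.

(** For odd d all reflections are conjugate, so evaluation at s_i and at s_0 agree on class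
    functions and the linear relations of H identify them. *)
Lemma gen_GC_const (d_odd : odd d) (i : 'I_d) : gen (@GC K d zeta i) = cpar.
Proof.
have e : \sum_j ((j == i)%:R - (j == Ordinal d_gt0)%:R) *: gen (@GC K d zeta j) = 0.
  apply: gen_C_linear => f fP.
  have fc : f i = f (Ordinal d_gt0).
    (* Conjugation by s_k sends s_i to s_(2k-i), and [d./2.+1] is the inverse of 2 modulo d. *)
    apply: fP; exists (refl zeta (i * d./2.+1)); first exact: (dihedral_refl zeta_prim).
    rewrite refl_conj; apply/matrixP => a b; rewrite !mxE.
    suff -> : zeta ^+ (i * d./2.+1 + d.-1 * i + i * d./2.+1) = zeta ^+ 0 by [].
    apply: prim_expr_eq; rewrite mod0n.
    have -> : (i * d./2.+1 + d.-1 * i + i * d./2.+1 = (i * 2) * d)%N.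
      move: (nat_of_ord i) => k; have := odd_double_half d; rewrite d_odd -muln2.
      by move: (d./2) => h e; rewrite -{}e /=; nia.
    by rewrite modnMl.
  under eq_bigr do rewrite mulrBl.
  by rewrite sumrB !(sum_delta (V := K^o)) fc subrr.
have {e} : \sum_j ((j == i)%:R *: gen (@GC K d zeta j)) -
   \sum_j ((j == Ordinal d_gt0)%:R *: gen (@GC K d zeta j)) = 0.
  by rewrite -sumrB -[RHS]e; apply: eq_bigr => j _; rewrite scalerBl.
rewrite !sum_delta.
by move/eqP; rewrite subr_eq0 => /eqP.
Qed.
End Dihedral.

Section CherednikRel.
Variables (K : numFieldType) (d : nat) (zeta : K).
Hypothesis zeta_prim : d.-primitive_root zeta.
Local Notation H := (cherednik zeta_prim).
Local Notation gen := (gen zeta_prim).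
Local Notation cgen := (cgen zeta_prim).
Local Notation cpar := (cpar zeta_prim).
Local Notation csym := (csym zeta_prim).
Let z0 i : zeta ^+ i != 0. Proof. exact/expf_neq0/prim_root_neq0/zeta_prim. Qed.

Lemma refl_delta i b : refl zeta i *m delta_mx (vec_letter b) 0 =
  zeta ^+ (i * weight d (false, b)) *: delta_mx (vec_letter (~~ b)) 0 :> 'cV_2.
Proof.
apply/matrixP => a j; rewrite !mxE !big_ord_recl big_ord0 !mxE ord1 /=.
case: b; rewrite /weight /vec_letter /= -?(prim_exprV zeta_prim) ?muln1;
by case: a => [[|[|a]] //= a2]; rewrite !(mul0r, mulr0, addr0, add0r, mulr1).
Qed.

Lemma delta_refl i b : delta_mx 0 (vec_letter b) *m invmx (refl zeta i) =
  zeta ^+ (i * weight d (true, b)) *: delta_mx 0 (vec_letter (~~ b)) :> 'rV_2.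
Proof.
rewrite (invmx_refl zeta_prim).
apply/matrixP => j a; rewrite !mxE !big_ord_recl big_ord0 !mxE ord1 /=.
case: b; rewrite /weight /vec_letter /= -?(prim_exprV zeta_prim) ?muln1;
by case: a => [[|[|a]] //= a2]; rewrite !(mul0r, mulr0, addr0, add0r, mulr1, mul1r).
Qed.

Lemma bracket_coefE b b' i :
  - 2%:R * (pairing (delta_mx (vec_letter b) 0) (Defs.root zeta i)
  * pairing (coroot zeta i) (delta_mx 0 (vec_letter b'))
  / pairing (coroot zeta i) (Defs.root zeta i)) = bracket_coef d zeta b b' i.
Proof.
have n2 : 2%:R != 0 :> K by rewrite pnatr_eq0.
rewrite /pairing !mxE !big_ord_recl !big_ord0 !mxE /bracket_coef.
have z0i := z0 i.
rewrite /vec_letter; case: b; case: b' => /=; rewrite ?muln1 -?(prim_exprV zeta_prim).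
all: move: (zeta ^+ i) z0i => t t0.
all: have -> : 1 * t + (- t * -1 + 0) = 2%:R * t by ring.
all: by field; rewrite ?t0 ?n2.
Qed.

Lemma cherednik_relP (d_odd : odd d) : cherednik_rel d zeta cpar cgen csym.
Proof.
split.
- move=> t; elim/(@cherednik_ind _ _ _ zeta_prim): t => [|u v cu cv|k u cu||l u cu].
  + by rewrite mulr0 mul0r.
  + by rewrite mulrDr mulrDl cu cv.
  + by rewrite -scalerAr -scalerAl cu.
  + by rewrite mulr1 mul1r.
  + by rewrite mulrA gen_C_central -!mulrA cu.
- by move=> i; rewrite /csym wrefl_periodic.
- by move=> i j k; rewrite /csym -!gen_W_mul wrefl_mul3.
- by move=> i; rewrite /csym -gen_W_mul wrefl_square gen_W_one.
- move=> i [[] b]; rewrite /csym /cgen /=.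
  + by rewrite gen_W_Vdual /= delta_refl gen_VdualZ scalerAl.
  + by rewrite gen_W_V /= refl_delta gen_VZ scalerAl.
- by move=> [] e e'; [exact: gen_VdualVdual | exact: gen_VV].
- move=> e e'; rewrite /cgen /= gen_VVdual mulr_sumr scaler_sumr.
  apply: eq_bigr => i _; rewrite scalerA bracket_coefE.
  by rewrite (gen_GC_const zeta_prim d_odd) scalerAr.
Qed.
End CherednikRel.

(** * Dunkl operators *)

Section Endomorphisms.
Variables (K : fieldType) (M : lmodType K) (m0 : M).
Hypothesis m0_neq0 : m0 != 0.

Record endo := Endo { endo_fun :> M -> M; endo_linear : linear endo_fun }.

Lemma endo_eq (f g : endo) : (forall m, f m = g m) -> f = g.
Proof.
case: f g => [f fl] [g gl] /= /funext fg; case: _ / fg in gl *.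
by rewrite (Prop_irrelevance fl gl).
Qed.

HB.instance Definition _ := gen_eqMixin endo.
HB.instance Definition _ := gen_choiceMixin endo.

Lemma endoD (f : endo) m n : f (m + n) = f m + f n.
Proof. by have := endo_linear f 1 m n; rewrite !scale1r. Qed.
Lemma endo0 (f : endo) : f 0 = 0.
Proof. by apply: (addrI (f 0)); rewrite -endoD !addr0. Qed.
Lemma endoZ (f : endo) k m : f (k *: m) = k *: f m.
Proof. by have := endo_linear f k m 0; rewrite endo0 !addr0. Qed.

Let zero_linear : linear (fun _ : M => 0 : M).
Proof. by move=> k m n; rewrite scaler0 addr0. Qed.
Let opp_linear (f : endo) : linear (fun m => - f m).
Proof. by move=> k m n; rewrite endoD endoZ opprD scalerN. Qed.
Let add_linear (f g : endo) : linear (fun m => f m + g m).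
Proof. by move=> k m n; rewrite !endoD !endoZ scalerDr addrACA. Qed.
Let scale_linear (a : K) (f : endo) : linear (fun m => a *: f m).
Proof. by move=> k m n; rewrite endoD endoZ scalerDr !scalerA mulrC. Qed.
Let id_linear : linear (fun m : M => m).
Proof. by []. Qed.
Let comp_linear (f g : endo) : linear (fun m => f (g m)).
Proof. by move=> k m n; rewrite !endoD !endoZ. Qed.

Definition endo_zero := Endo zero_linear.
Definition endo_opp f := Endo (opp_linear f).
Definition endo_add f g := Endo (add_linear f g).
Definition endo_scale a f := Endo (scale_linear a f).
Definition endo_one := Endo id_linear.
Definition endo_mul f g := Endo (comp_linear f g).

Fact endo_addA : associative endo_add.
Proof. by move=> f g h; apply: endo_eq => m /=; rewrite addrA. Qed.
Fact endo_addC : commutative endo_add.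
Proof. by move=> f g; apply: endo_eq => m /=; rewrite addrC. Qed.
Fact endo_add0 : left_id endo_zero endo_add.
Proof. by move=> f; apply: endo_eq => m /=; rewrite add0r. Qed.
Fact endo_addN : left_inverse endo_zero endo_opp endo_add.
Proof. by move=> f; apply: endo_eq => m /=; rewrite addNr. Qed.
HB.instance Definition _ := GRing.isZmodule.Build endo
  endo_addA endo_addC endo_add0 endo_addN.

Fact endo_mulA : associative endo_mul.
Proof. by move=> f g h; apply: endo_eq. Qed.
Fact endo_mul1 : left_id endo_one endo_mul.
Proof. by move=> f; apply: endo_eq. Qed.
Fact endo_mulr1 : right_id endo_one endo_mul.
Proof. by move=> f; apply: endo_eq. Qed.
Fact endo_mulDl : left_distributive endo_mul +%R.
Proof. by move=> f g h; apply: endo_eq. Qed.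
Fact endo_mulDr : right_distributive endo_mul +%R.
Proof. by move=> f g h; apply: endo_eq => m /=; rewrite endoD. Qed.
Fact endo_one_neq0 : endo_one != 0.
Proof.
by apply: contraNneq m0_neq0 => /(congr1 (fun f : endo => f m0)) /= ->.
Qed.

(** The proof is an argument of the type so that the ring structure can use it to show 1 != 0. *)
Definition endo_alg_of (_ : m0 != 0) := endo.
Local Notation endo_alg := (endo_alg_of m0_neq0).
HB.instance Definition _ := GRing.Zmodule.on endo_alg.
HB.instance Definition _ := GRing.Zmodule_isNzRing.Build endo_alg
  endo_mulA endo_mul1 endo_mulr1 endo_mulDl endo_mulDr endo_one_neq0.

Fact endo_scaleA a b f : endo_scale a (endo_scale b f) = endo_scale (a * b) f.
Proof. by apply: endo_eq => m /=; rewrite scalerA. Qed.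
Fact endo_scale1 : left_id 1 endo_scale.
Proof. by move=> f; apply: endo_eq => m /=; rewrite scale1r. Qed.
Fact endo_scaleDr : right_distributive endo_scale +%R.
Proof. by move=> a f g; apply: endo_eq => m /=; rewrite scalerDr. Qed.
Fact endo_scaleDl f : {morph endo_scale^~ f : a b / a + b}.
Proof. by move=> a b; apply: endo_eq => m /=; rewrite scalerDl. Qed.
HB.instance Definition _ := GRing.Zmodule_isLmodule.Build K endo_alg
  endo_scaleA endo_scale1 endo_scaleDr endo_scaleDl.

Fact endo_scaleAl a (f g : endo_alg) : a *: (f * g) = a *: f * g.
Proof. by apply: endo_eq. Qed.
HB.instance Definition _ := GRing.Lmodule_isLalgebra.Build K endo_alg endo_scaleAl.
Fact endo_scaleAr a (f g : endo_alg) : a *: (f * g) = f * (a *: g).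
Proof. by apply: endo_eq => m /=; rewrite endoZ. Qed.
HB.instance Definition _ := GRing.Lalgebra_isAlgebra.Build K endo_alg endo_scaleAr.
End Endomorphisms.

(** * Sums over residues modulo d *)

Section PeriodicSum.
Variables (V : zmodType) (d : nat) (F : nat -> V).
Hypothesis F_periodic : forall n, F (n + d)%N = F n.

Lemma sum_periodic_shift k : \sum_(i < d) F (i + k)%N = \sum_(i < d) F i.
Proof.
elim: k => [|k IHk]; first by apply: eq_bigr => i _; rewrite addn0.
rewrite -IHk; case: d F_periodic => [|e] Fp; first by rewrite !big_ord0.
rewrite big_ord_recr [RHS]big_ord_recl /= add0n addrC; congr (_ + _).
  by rewrite -addSnnS addSn addnC -addnS Fp.
by apply: eq_bigr => i _; rewrite /bump /= add1n addSnnS.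
Qed.

Lemma periodicM n m : F (n + m * d)%N = F n.
Proof. by elim: m => [|m IHm]; rewrite ?addn0 // mulSn addnCA addnC F_periodic. Qed.

Lemma sum_periodic_rev k : \sum_(i < d) F (k + d.-1 * i)%N = \sum_(i < d) F i.
Proof.
rewrite -(sum_periodic_shift k.+1) (reindex_inj rev_ord_inj) /=.
apply: eq_bigr => i _; rewrite -(periodicM (i + k.+1) (d - i.+1)) -[LHS]F_periodic.
congr F; have := ltn_ord i; move: (nat_of_ord i) => j jd.
have -> : d = (j + (d - j.+1)).+1 by lia.
by move: (d - j.+1)%N => e; rewrite /= subSS addKn; nia.
Qed.
End PeriodicSum.

(** * The points on which Dunkl operators act *)

Section DunklPoints.
Variables (K : numFieldType) (d : nat) (zeta : K).
Hypothesis zeta_prim : d.-primitive_root zeta.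
Local Notation root := (Defs.root zeta).
Let d_gt0 : (0 < d)%N. Proof. exact: prim_order_gt0 zeta_prim. Qed.

(* A point (c, a, b) consists of a value c of the parameter, a point a of V
   off the reflecting hyperplanes, and a linear form b on V. *)
Definition dunkl_regular (s : K * 'cV[K]_2 * 'rV[K]_2) : bool :=
  [forall i : 'I_d, pairing s.1.2 (root i) != 0].

Definition dunkl_point : Type := {s | dunkl_regular s}.

Definition pt_c (s : dunkl_point) : K := (val s).1.1.
Definition pt_a (s : dunkl_point) : 'cV[K]_2 := (val s).1.2.
Definition pt_b (s : dunkl_point) : 'rV[K]_2 := (val s).2.

Lemma root_periodic i : root (i + d) = root i.
Proof. by apply/matrixP => a b; rewrite !mxE exprD (prim_expr_order zeta_prim) mulr1.
  Qed.

Lemma pairingE (u : 'cV[K]_2) (U : 'rV[K]_2) :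
  pairing u U = U 0 0 * u 0 0 + U 0 1 * u 1 0.
Proof.
rewrite /pairing !mxE !big_ord_recl big_ord0 addr0.
by rewrite (_ : lift ord0 ord0 = 1) //; apply: val_inj.
Qed.

Lemma pairing_root (a : 'cV[K]_2) i : pairing a (root i) = a 0 0 - zeta ^+ i * a 1 0.
Proof. by rewrite pairingE !mxE /= mul1r mulNr. Qed.

Lemma dunkl_regularP s : reflect (forall i, pairing s.1.2 (root i) != 0)
  (dunkl_regular s).
Proof.
apply: (iffP forallP) => [reg i|reg i]; last exact: reg.
have := reg (Ordinal (ltn_pmod i d_gt0)); rewrite !pairing_root /=.
by rewrite (prim_expr_mod zeta_prim).
Qed.

Lemma pt_regular s i : pairing (pt_a s) (root i) != 0.
Proof. exact: (dunkl_regularP _ (valP s)). Qed.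

Lemma root_refl i k :
  root i *m refl zeta k = - zeta ^+ (i + d.-1 * k) *: root (k + d.-1 * i + k).
Proof.
have z0 := prim_root_neq0 zeta_prim.
apply/matrixP => a b; rewrite !mxE !big_ord_recl big_ord0 !mxE !exprD.
rewrite ![(d.-1 * _)%N]mulnC -!(prim_exprV zeta_prim).
have zi := expf_neq0 i z0; have zk := expf_neq0 k z0.
by case: b => [[|[|b]] //= b2]; field; rewrite ?zi ?zk.
Qed.

Lemma pairing_mull (w : 'M[K]_2) u U : pairing (w *m u) U = pairing u (U *m w).
Proof. by rewrite /pairing mulmxA. Qed.

Lemma pairing_scale k (u : 'cV[K]_2) U : pairing u (k *: U) = k * pairing u U.
Proof. by rewrite /pairing -scalemxAl mxE. Qed.

Lemma pairing_linear k (u v : 'cV[K]_2) U :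
  pairing (k *: u + v) U = k * pairing u U + pairing v U.
Proof. by rewrite /pairing mulmxDr -scalemxAr !mxE. Qed.

Lemma pairing_linearr k (u : 'cV[K]_2) U V :
  pairing u (k *: U + V) = k * pairing u U + pairing u V.
Proof. by rewrite /pairing mulmxDl -scalemxAl !mxE. Qed.

Lemma regular_refl (a : 'cV[K]_2) k : (forall i, pairing a (root i) != 0) ->
  forall i, pairing (refl zeta k *m a) (root i) != 0.
Proof.
move=> reg i; rewrite pairing_mull root_refl pairing_scale mulf_neq0 //.
by rewrite oppr_eq0 expf_neq0 // (prim_root_neq0 zeta_prim).
Qed.

Fact dunkl_act_subproof (w : dihedral zeta) (s : dunkl_point) :
  dunkl_regular (pt_c s, invmx (val w) *m pt_a s, pt_b s *m val w).
Proof.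
apply/dunkl_regularP => /=.
have wV : dihedral zeta (invmx (val w)).
  by have [_ _] := dihedral_group zeta; apply; exact: set_valP.
have [[k e] ->] := dihedralE zeta_prim wV.
have reg := pt_regular s.
case: e; rewrite /dihedral_elt /=; last exact: regular_refl.
by rewrite -mulmxA; do 2!apply: regular_refl.
Qed.

(** This is a right action, so that f |-> (s |-> f (w @ s)) is a left action of W on functions. *)
Definition dunkl_act (w : dihedral zeta) (s : dunkl_point) : dunkl_point :=
  exist (fun s => is_true (dunkl_regular s)) _ (dunkl_act_subproof w s).

Lemma dunkl_act1 s : dunkl_act (wone zeta) s = s.
Proof. by apply/val_inj; case: s => -[[c a] b] /= p;
  rewrite /pt_b /pt_a /pt_c /= invmx1 mul1mx mulmx1. Qed.

Lemma dunkl_actM v w s : dunkl_act (wmul v w) s = dunkl_act w (dunkl_act v s).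
Proof.
apply/val_inj; rewrite /= /pt_b /pt_a /pt_c /= -mulmxA; congr (_, _, _).
have vu := dihedral_unit zeta_prim (set_valP v).
have wu := dihedral_unit zeta_prim (set_valP w).
have vwu : val v *m val w \in unitmx by rewrite unitmx_mul vu.
rewrite mulmxA; congr (_ *m _); rewrite -[RHS]mulmx1 -(mulmxV vwu) !mulmxA.
by rewrite -(mulmxA _ (invmx (val v))) mulVmx // mulmx1 mulVmx // mul1mx.
Qed.

Lemma pt_a_refl k s : pt_a (dunkl_act (wrefl zeta_prim k) s) = refl zeta k *m pt_a s.
Proof. by rewrite /pt_a /= (invmx_refl zeta_prim). Qed.

Lemma pt_b_act w s : pt_b (dunkl_act w s) = pt_b s *m val w.
Proof. by []. Qed.

Lemma pt_c_act w s : pt_c (dunkl_act w s) = pt_c s.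
Proof. by []. Qed.

End DunklPoints.

(** * Relations between Dunkl operators *)

Section DunklModule.
Variables (K : numFieldType) (d : nat) (zeta : K).
Hypothesis zeta_prim : d.-primitive_root zeta.
Local Notation root := (Defs.root zeta).
Local Notation S := (dunkl_point d zeta).
Local Notation M := (S -> {poly K}).
Local Notation "w '@' s" := (dunkl_act zeta_prim w s) (at level 20).
Local Notation r := (wrefl zeta_prim).

Fact base_regular : dunkl_regular d zeta (0, delta_mx 0 0, 0).
Proof.
apply/(dunkl_regularP zeta_prim) => i; rewrite pairing_root !mxE /=.
by rewrite mulr0 subr0 oner_eq0.
Qed.

Definition base_point : S := exist (fun s => is_true (dunkl_regular d zeta s)) _
  base_regular.

Definition one_fun : M := fun _ => 1.

Lemma one_fun_neq0 : one_fun != 0.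
Proof.
by apply/eqP => /(congr1 (fun f : M => f base_point))/eqP; rewrite oner_eq0.
Qed.

Definition refl_coef (u : 'cV[K]_2) (s : S) (i : nat) : K :=
  pt_c s * pairing u (root i) / pairing (pt_a s) (root i).

(* The Dunkl operators at t = 0; the formal variable records the degree in
   the coordinates of V. *)
Definition dunkl_fun (g : generator d zeta) (f : M) : M :=
  match g with
  | GV u => fun s => pairing u (pt_b s) *: ('X * f s) +
      \sum_(i < d) refl_coef u s i *: f (r i @ s)
  | GVdual U => fun s => pairing (pt_a s) U *: f s
  | GW w => fun s => f (w @ s)
  | GC _ => fun s => pt_c s *: f s
  end.

Fact dunkl_fun_linear g : linear (dunkl_fun g).
Proof.
move=> k f h; apply/funext => s; rewrite !fctE; case: g => [u|U|w|i] //=.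
- rewrite mulrDr scalerDr scalerDr addrACA; congr (_ + _).
    by rewrite -scalerAr !scalerA mulrC.
  rewrite scaler_sumr -big_split; apply: eq_bigr => i _ /=.
  by rewrite scalerDr !scalerA mulrC.
- by rewrite scalerDr !scalerA mulrC.
- by rewrite scalerDr !scalerA mulrC.
Qed.

Local Notation B := (endo_alg_of one_fun_neq0).

Definition dunkl_gen (g : generator d zeta) : B := Endo (dunkl_fun_linear g).

Lemma refl_act_periodic i s : r (i + d) @ s = r i @ s.
Proof. by rewrite wrefl_periodic. Qed.

Lemma refl_coef_periodic u s i : refl_coef u s (i + d) = refl_coef u s i.
Proof. by rewrite /refl_coef (root_periodic zeta_prim). Qed.

Lemma endoB_eq0 (x y : B) : (forall f s, x f s = y f s) -> x - y = 0.
Proof.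
by move=> xy; apply/eqP; rewrite subr_eq0; apply/eqP/endo_eq => f; apply/funext.
Qed.

Lemma endo_sumE (I : Type) (l : seq I) (F : I -> B) f s :
  (\sum_(i <- l) F i) f s = \sum_(i <- l) F i f s.
Proof.
elim: l => [|i l IHl]; first by rewrite !big_nil.
by rewrite !big_cons -IHl.
Qed.

Lemma dunkl_W_V w u f s :
  dunkl_fun (@GV K d zeta u) f (w @ s) =
  dunkl_fun (@GV K d zeta (val w *m u)) (fun s => f (w @ s)) s.
Proof.
have step k v h s' : dunkl_fun (@GV K d zeta v) h (r k @ s') =
    dunkl_fun (@GV K d zeta (refl zeta k *m v)) (fun s => h (r k @ s)) s'.
  rewrite /=; congr (_ *: _ + _); first by rewrite pt_b_act pairing_mull.
  pose F j := refl_coef (refl zeta k *m v) s' j *: h (r k @ (r j @ s')).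
  have Fp n : F (n + d)%N = F n.
    by rewrite /F refl_coef_periodic refl_act_periodic.
  transitivity (\sum_(i < d) F i) => //.
  (* The sum is reindexed by i |-> 2k - i, which is conjugation of s_i by s_k. The scalar by which
     s_k rescales a root cancels in the quotient of pairings. *)
  rewrite -(sum_periodic_rev Fp (k + k)); apply: eq_bigr => i _; rewrite /F.
  rewrite /refl_coef pt_c_act pt_a_refl !pairing_mull.
  have -> : r k @ (r (k + k + d.-1 * i)%N @ s') = r i @ (r k @ s').
    rewrite -!dunkl_actM; congr (_ @ _).
    rewrite addnAC -(wrefl_mul3 zeta_prim k i k); apply/val_inj.
    by rewrite /= -mulmxA (refl_square zeta_prim) mulmx1.
  congr (_ *: _); rewrite (root_refl zeta_prim) pairing_scale.
  have -> : (k + k + d.-1 * i = k + d.-1 * i + k)%N by rewrite addnAC.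
  rewrite -mulrA -[RHS]mulrA; congr (_ * _).
  set t := - zeta ^+ _; set p := pairing (pt_a s') _.
  have t0 : t != 0 by rewrite oppr_eq0 expf_neq0 // (prim_root_neq0 zeta_prim).
  have p0 : p != 0 by exact: pt_regular.
  have -> : pairing v (root i) = t * pairing v (root (k + d.-1 * i + k) *m refl zeta k).
    rewrite -pairing_scale scalemxAl -(root_refl zeta_prim) -mulmxA.
    by rewrite (refl_square zeta_prim) mulmx1.
  by field; rewrite t0 p0.
have [i [->|->]] := wreflP zeta_prim w; first exact: step.
have -> : (fun s => f (wmul (r i) (r 0) @ s)) = (fun s => f (r 0 @ (r i @ s))).
  by apply/funext => s'; rewrite dunkl_actM.
by rewrite dunkl_actM step step mulmxA.
Qed.

(** The values of U at a and at s_i a differ by a multiple of the pairing of a with the i-th root,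
    which cancels the denominator of the Dunkl operator. *)
Lemma dunkl_bracket u U f s :
  dunkl_fun (@GV K d zeta u) (dunkl_fun (@GVdual K d zeta U) f) s -
  dunkl_fun (@GVdual K d zeta U) (dunkl_fun (@GV K d zeta u) f) s =
  - 2%:R *: \sum_(i < d) (pairing u (root i) * pairing (coroot zeta i) U
                  / pairing (coroot zeta i) (root i)) *:
       (pt_c s *: f (r i @ s)).
Proof.
rewrite /= scalerDr !scalerA [in X in _ - X]scaler_sumr.
rewrite -scalerAr scalerA [_ * pairing (pt_a s) U]mulrC.
rewrite opprD addrACA subrr add0r -sumrB scaler_sumr; apply: eq_bigr => i _.
rewrite !scalerA -scalerBl; congr (_ *: _).
rewrite pt_a_refl /refl_coef.
have := pt_regular zeta_prim s i; rewrite !pairing_root !pairingE !mxE !big_ord_recl.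
rewrite !big_ord0 !mxE /= (_ : lift ord0 ord0 = 1); last exact: val_inj.
have zi := expf_neq0 i (prim_root_neq0 zeta_prim).
have n2 : 2%:R != 0 :> K by rewrite pnatr_eq0.
move: (zeta ^+ i) zi (pt_a s 0 0) (pt_a s 1 0) => z z0 a0 a1 az.
rewrite (_ : z - z * -1 = 2%:R * z); last by ring.
by field; rewrite ?az ?z0 ?n2.
Qed.

(** Each term is h (i + k) - h i divided by a nonzero coordinate of a, for a d-periodic h, so the
    sum vanishes. With p_i the pairing of a with the i-th root, h is 1 / p_i if a 0 0 = 0 and zeta^i
    / p_i otherwise. *)
Lemma root_difference_sum (a : 'cV[K]_2) k : (forall i, pairing a (root i) != 0) ->
  \sum_(i < d) (zeta ^+ (i + k) - zeta ^+ i) /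
    (pairing a (root i) * pairing a (root (i + k))) = 0.
Proof.
move=> reg.
have telescope (h : nat -> K) (q : K) : q != 0 -> (forall n, h (n + d)%N = h n) ->
    (forall i, (zeta ^+ (i + k) - zeta ^+ i) /
      (pairing a (root i) * pairing a (root (i + k))) = q^-1 * (h (i + k)%N - h i)) ->
    \sum_(i < d) (zeta ^+ (i + k) - zeta ^+ i) /
      (pairing a (root i) * pairing a (root (i + k))) = 0.
  move=> q0 hp hE; under eq_bigr do rewrite hE.
  by rewrite -mulr_sumr sumrB (sum_periodic_shift hp) subrr mulr0.
have zp n : zeta ^+ (n + d) = zeta ^+ n.
  by rewrite exprD (prim_expr_order zeta_prim) mulr1.
have [a0|a0] := eqVneq (a 0 0) 0.
  have a1 : a 1 0 != 0.
    by have := reg 0; rewrite pairing_root a0 sub0r oppr_eq0 expr0 mul1r.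
  apply: (telescope (fun i => (pairing a (root i))^-1) _ a1) => [n|i].
    by rewrite (root_periodic zeta_prim).
  have := reg i; have := reg (i + k)%N; rewrite !pairing_root => r1 r2.
  by field; rewrite a1 r1 r2.
apply: (telescope (fun i => zeta ^+ i / pairing a (root i)) _ a0) => [n|i].
  by rewrite (root_periodic zeta_prim) zp.
have := reg i; have := reg (i + k)%N; rewrite !pairing_root => r1 r2.
by field; rewrite a0 r1 r2.
Qed.

(** The difference of the two sides is antisymmetric in u and v, hence a multiple of their
    determinant D. Its terms are collected by the rotation s_i s_j, that is by k = i - j, and the
    coefficient of each rotation vanishes by [root_difference_sum]. *)
Lemma dunkl_commute_quadratic (u v : 'cV[K]_2) (f : M) s :
  \sum_(i < d) refl_coef u s i *: \sum_(j < d) refl_coef v (r i @ s) j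
     *: f (r j @ (r i @ s)) =
  \sum_(i < d) refl_coef v s i *: \sum_(j < d) refl_coef u (r i @ s) j
     *: f (r j @ (r i @ s)).
Proof.
pose D := u 0 0 * v 1 0 - u 1 0 * v 0 0.
pose F i j := (pt_c s ^+ 2 * D * (zeta ^+ i - zeta ^+ j) / (pairing (pt_a s) (root i)
  * pairing (pt_a (r i @ s)) (root j))) *: f (r j @ (r i @ s)).
apply/eqP; rewrite -subr_eq0 -sumrB; apply/eqP.
rewrite (eq_bigr (fun i : 'I_d => \sum_(j < d) F i j)); last first.
  move=> i _; rewrite !scaler_sumr -sumrB; apply: eq_bigr => j _.
  rewrite !scalerA -scalerBl; congr (_ *: _); rewrite /refl_coef pt_c_act.
  have := pt_regular zeta_prim s i; have := pt_regular zeta_prim (r i @ s) j.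
  set p := pairing _ _; set q := pairing (pt_a s) _ => p0 q0.
  rewrite /D !pairing_root; field; by rewrite p0 q0.
pose G k := f (r k @ (r 0 @ s)).
have ract i j : r j @ (r i @ s) = r 0 @ (r (i + d.-1 * j)%N @ s).
  rewrite -!dunkl_actM; congr (_ @ _); apply/val_inj => /=.
  by rewrite (refl_mul zeta_prim).
rewrite (eq_bigr (fun i : 'I_d => \sum_(k < d) (- (pt_c s ^+ 2 * D * ((zeta ^+ (i +
  k) - zeta ^+ i) / (pairing (pt_a s) (root i) * pairing (pt_a s) (root (i + k))))))
    *: f (r 0 @ (r k @ s)))).
  rewrite exchange_big big1 // => k _ /=.
  rewrite -scaler_suml sumrN -mulr_sumr root_difference_sum ?mulr0 ?oppr0 ?scale0r //.
  by move=> i; exact: pt_regular.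
move=> i _.
have Fp n : F i (n + d)%N = F i n.
  rewrite /F (root_periodic zeta_prim) refl_act_periodic exprD.
  by rewrite (prim_expr_order zeta_prim) mulr1.
rewrite -(sum_periodic_rev Fp i); apply: eq_bigr => k _; rewrite /F ract.
have [m dd] : exists m, (i + d.-1 * (i + d.-1 * k) = k + m * d)%N.
  have := ltn_ord k; have := prim_order_gt0 zeta_prim.
  move: (nat_of_ord i) (nat_of_ord k) => i' k'; case: (d) => [|[|e]] // _ kd.
    by exists i'; move: kd; lia.
  by exists (i' + e * k')%N; rewrite /=; nia.
have r_md : r (k + m * d)%N = r k.
  elim: m {dd} => [|m IHm]; first by rewrite addn0.
  by rewrite mulSn addnCA addnC wrefl_periodic.
have root_md : root (k + m * d + i) = root (i + k).
  elim: m {dd r_md} => [|m IHm]; first by rewrite addn0 addnC.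
  by rewrite mulSn addnCA -addnA addnC (root_periodic zeta_prim).
have z0 := prim_root_neq0 zeta_prim.
have -> : zeta ^+ (i + d.-1 * k) = zeta ^+ i * zeta ^- k.
  by rewrite exprD mulnC -(prim_exprV zeta_prim).
rewrite dd r_md pt_a_refl pairing_mull (root_refl zeta_prim) dd root_md pairing_scale.
congr (_ *: _).
have -> : zeta ^+ (i + d.-1 * k + d.-1 * i) = zeta ^- k.
  rewrite addnAC -{1}[nat_of_ord i]mul1n -mulnDl add1n prednK ?prim_order_gt0 //.
    rewrite exprD exprM (prim_expr_order zeta_prim) expr1n mul1r mulnC.
    by rewrite -(prim_exprV zeta_prim).
  exact: (prim_order_gt0 zeta_prim).
rewrite exprD; have := pt_regular zeta_prim s i; have := pt_regular zeta_prim s (i + k).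
move: (pairing _ _) (pairing _ _) => p q p0 q0.
have zi := expf_neq0 i z0; have zk := expf_neq0 k z0.
by field; rewrite ?p0 ?q0 ?zk ?zi ?oppr_eq0 ?oner_eq0.
Qed.

(** The terms are compared by powers of the formal variable. In degree one the symmetry in u and v
    holds because applying s_i to b changes its pairing with a vector by a multiple of the pairing
    with the i-th root. *)
Lemma dunkl_commute u v f s :
  dunkl_fun (@GV K d zeta u) (dunkl_fun (@GV K d zeta v) f) s =
  dunkl_fun (@GV K d zeta v) (dunkl_fun (@GV K d zeta u) f) s.
Proof.
have expand p q : dunkl_fun (@GV K d zeta p) (dunkl_fun (@GV K d zeta q) f) s =
    (pairing p (pt_b s) * pairing q (pt_b s)) *: ('X * ('X * f s)) +
    \sum_(i < d) (pairing p (pt_b s) * refl_coef q s i +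
       refl_coef p s i * pairing q (pt_b (r i @ s))) *: ('X * f (r i @ s)) +
    \sum_(i < d) refl_coef p s i *: \sum_(j < d) refl_coef q (r i @ s) j
     *: f (r j @ (r i @ s)).
  rewrite /= mulrDr scalerDr -scalerAr scalerA -!addrA; congr (_ + _).
  rewrite mulr_sumr scaler_sumr -!big_split /=; apply: eq_bigr => i _.
  by rewrite scalerDr addrA scalerDl -!scalerAr !scalerA.
rewrite !expand dunkl_commute_quadratic mulrC; congr (_ + _ + _).
apply: eq_bigr => i _; congr (_ *: _).
rewrite pt_b_act !pairingE /refl_coef !pairing_root !mxE !big_ord_recl !big_ord0 !mxE
  /=.
rewrite (_ : lift ord0 ord0 = 1); last exact: val_inj.
have := pt_regular zeta_prim s i; rewrite pairing_root.
have := expf_neq0 i (prim_root_neq0 zeta_prim).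
move: (zeta ^+ i) => z z0 p0; by field; rewrite z0 p0.
Qed.
End DunklModule.

(** * The action of the Cherednik algebra on functions *)

Section DunklRep.
Variables (K : numFieldType) (d : nat) (zeta : K).
Hypothesis zeta_prim : d.-primitive_root zeta.
Local Notation S := (dunkl_point d zeta).
Local Notation M := (S -> {poly K}).
Local Notation "w '@' s" := (dunkl_act zeta_prim w s) (at level 20).
Local Notation r := (wrefl zeta_prim).
Local Notation H := (cherednik zeta_prim).
Local Notation gen := (gen zeta_prim).
Local Notation B := (endo_alg_of (one_fun_neq0 zeta_prim)).
Local Notation dgen := (dunkl_gen zeta_prim).

Fact dunkl_gen_relator x : relator zeta_prim x -> free_lift dgen x = 0.
Proof.
have fl g := free_lift_letter dgen g.
case=> [a u u'|a U U'||w t|w u|w U|a a0|i g|u u'|U U'|u U].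
- apply: etrans (free_liftB (fl _) (free_liftD (free_liftZ _ (fl _)) (fl _))) _.
  apply: endoB_eq0 => f s.
  change (dunkl_fun zeta_prim (@GV K d zeta (a *: u + u')) f s =
    a *: dunkl_fun zeta_prim (@GV K d zeta u) f s + dunkl_fun zeta_prim (@GV K d zeta
      u') f s).
  rewrite /= pairing_linear scalerDl -scalerA scalerDr addrACA; congr (_ + _).
  rewrite scaler_sumr -big_split; apply: eq_bigr => i _ /=.
  by rewrite /refl_coef pairing_linear mulrDr mulrDl scalerDl !scalerA;
    congr (_ *: _ + _); rewrite mulrCA !mulrA.
- apply: etrans (free_liftB (fl _) (free_liftD (free_liftZ _ (fl _)) (fl _))) _.
  apply: endoB_eq0 => f s.
  change (pairing (pt_a s) (a *: U + U') *: f s =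
    a *: (pairing (pt_a s) U *: f s) + pairing (pt_a s) U' *: f s).
  by rewrite pairing_linearr scalerDl scalerA.
- apply: etrans (free_liftB (fl _) (free_lift1 _)) _.
  apply: endoB_eq0 => f s; change (f (wone zeta @ s) = f s).
  by rewrite dunkl_act1.
- apply: etrans (free_liftB (fl _) (free_liftM (fl _) (fl _))) _.
  apply: endoB_eq0 => f s; change (f (wmul w t @ s) = f (t @ (w @ s))).
  by rewrite dunkl_actM.
- apply: etrans (free_liftB (free_liftM (fl _) (fl _)) (free_liftM (fl _) (fl _))) _.
  apply: endoB_eq0 => f s; exact: (dunkl_W_V zeta_prim w u f s).
- apply: etrans (free_liftB (free_liftM (fl _) (fl _)) (free_liftM (fl _) (fl _))) _.
  apply: endoB_eq0 => f s.
  change (pairing (pt_a (w @ s)) U *: f (w @ s) =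
    pairing (pt_a s) (U *m invmx (val w)) *: f (w @ s)).
  by rewrite -pairing_mull.
- apply: etrans (free_lift_sum _ _ (fun i => free_liftZ _ (fl _))) _.
  apply: endo_eq => f; apply/funext => s; rewrite endo_sumE.
  transitivity (\sum_i (a i * pt_c s) *: f s).
    by apply: eq_bigr => i _; rewrite -scalerA.
  rewrite -scaler_suml -mulr_suml (_ : \sum_i a i = 0) ?mul0r ?scale0r //.
  by rewrite -[RHS](a0 (fun=> 1)) //; apply: eq_bigr => i _; rewrite mulr1.
- apply: etrans (free_liftB (free_liftM (fl _) (fl _)) (free_liftM (fl _) (fl _))) _.
  apply: endoB_eq0 => f s; change (pt_c s *: dunkl_fun zeta_prim g f s =
    dunkl_fun zeta_prim g (fun s => pt_c s *: f s) s).
  case: g => [u|U|w|j] //=; rewrite ?scalerA 1?[_ * pt_c s]mulrC //.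
  rewrite -scalerAr scalerDr !scalerA mulrC scaler_sumr; congr (_ + _).
  by apply: eq_bigr => j _; rewrite pt_c_act !scalerA mulrC.
- apply: etrans (free_liftB (free_liftM (fl _) (fl _)) (free_liftM (fl _) (fl _))) _.
  apply: endoB_eq0 => f s; exact: (dunkl_commute zeta_prim u u' f s).
- apply: etrans (free_liftB (free_liftM (fl _) (fl _)) (free_liftM (fl _) (fl _))) _.
  apply: endoB_eq0 => f s.
  change (pairing (pt_a s) U *: (pairing (pt_a s) U' *: f s) =
    pairing (pt_a s) U' *: (pairing (pt_a s) U *: f s)).
  by rewrite !scalerA mulrC.
- apply: etrans (free_liftB (free_liftB (free_liftM (fl _) (fl _))
                                        (free_liftM (fl _) (fl _)))
    (free_liftZ _ (free_lift_sum _ _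
       (fun i => free_liftZ _ (free_liftM (fl _) (fl _)))))) _.
  apply: endoB_eq0 => f s; apply: etrans (dunkl_bracket zeta_prim u U f s) _.
  change (- 2%:R *: \sum_(i < d) (pairing u (Defs.root zeta i) * pairing (coroot zeta
    i) U
                  / pairing (coroot zeta i) (Defs.root zeta i)) *:
       (pt_c s *: f (r i @ s)) = - 2%:R *: (\sum_(i < d) (pairing u (Defs.root zeta
         i) * pairing (coroot zeta i) U
                  / pairing (coroot zeta i) (Defs.root zeta i)) *: (dgen (@GC K d
                    zeta i) * dgen (@GW K d zeta (r i)))) f s).
  by rewrite endo_sumE.
Qed.

Definition dunkl (h : H) : B := presented_lift dgen h.

HB.instance Definition _ := GRing.isZmodMorphism.Build H B dunkl
  (presented_lift_is_zmod_morphism dunkl_gen_relator).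
HB.instance Definition _ := GRing.isMonoidMorphism.Build H B dunkl
  (presented_lift_is_monoid_morphism dunkl_gen_relator).
HB.instance Definition _ := GRing.isScalable.Build K H B *:%R dunkl
  (presented_lift_is_scalable dunkl_gen_relator).

Lemma dunkl_genE g : dunkl (gen g) = dgen g.
Proof.
by rewrite /dunkl /gen (presented_lift_pi dunkl_gen_relator) free_lift_letter.
Qed.

Definition dact (h : H) (f : M) : M := (dunkl h : endo _) f.

Lemma dactD h h' f : dact (h + h') f = dact h f + dact h' f.
Proof. by rewrite /dact raddfD. Qed.
Lemma dactZ k h f : dact (k *: h) f = k *: dact h f.
Proof. by rewrite /dact linearZ. Qed.
Lemma dactM h h' f : dact (h * h') f = dact h (dact h' f).
Proof. by rewrite /dact rmorphM. Qed.
Lemma dact0 f : dact 0 f = 0.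
Proof. by rewrite /dact raddf0. Qed.
Lemma dact1 f : dact 1 f = f.
Proof. by rewrite /dact rmorph1. Qed.
Lemma dact_gen g f : dact (gen g) f = dunkl_fun zeta_prim g f.
Proof. by rewrite /dact dunkl_genE. Qed.
Lemma dact_sum (I : Type) (l : seq I) (F : I -> H) f s :
  dact (\sum_(i <- l) F i) f s = \sum_(i <- l) dact (F i) f s.
Proof. by rewrite /dact raddf_sum endo_sumE. Qed.
End DunklRep.

(** * Faithfulness of the Dunkl representation *)

Section Faithful.
Variables (K : numFieldType) (d : nat) (zeta : K).
Hypothesis zeta_prim : d.-primitive_root zeta.
Local Notation S := (dunkl_point d zeta).
Local Notation M := (S -> {poly K}).
Local Notation "w '@' s" := (dunkl_act zeta_prim w s) (at level 20).
Local Notation r := (wrefl zeta_prim).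
Local Notation H := (cherednik zeta_prim).
Local Notation gen := (gen zeta_prim).
Local Notation dact := (dact (zeta_prim := zeta_prim)).
Local Notation cgen := (cgen zeta_prim).
Local Notation cpar := (cpar zeta_prim).
Local Notation csym := (csym zeta_prim).
Local Notation one_fun := (@one_fun K d zeta).
Let d_gt0 : (0 < d)%N. Proof. exact: prim_order_gt0 zeta_prim. Qed.

(** A leading symbol: all values of f have degree at most n, with coefficient F in degree n,
    possibly zero. The reflection terms of a Dunkl operator do not raise the degree, so x and y act
    on symbols as coordinates of b. *)
Definition top_coef (n : nat) (f : M) (F : S -> K) : Prop :=
  forall s m, (n <= m)%N -> (f s)`_m = (m == n)%:R * F s.

Lemma top_coef_ext n f F G : (forall s, F s = G s) -> top_coef n f F -> top_coef n f G.
Proof. by move=> FG tF s m nm; rewrite tF // FG. Qed.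

Lemma top_coef_c n f F : top_coef n f F ->
  top_coef n (dact cpar f) (fun s => pt_c s * F s).
Proof. by move=> tF s m nm; rewrite dact_gen coefZ tF // mulrCA. Qed.

Lemma dact_Vdual b f s : dact (cgen (true, b)) f s = pt_a s (vec_letter b) 0 *: f s.
Proof.
rewrite dact_gen /= pairingE !mxE /= /vec_letter.
by case: b; rewrite /= ?mul0r ?mul1r ?add0r ?addr0.
Qed.

Lemma dact_sym i f s : dact (csym i) f s = f (r i @ s).
Proof. by rewrite dact_gen. Qed.

Lemma pairing_V b (U : 'rV[K]_2) : pairing (delta_mx (vec_letter b) 0) U = U 0
  (vec_letter b).
Proof.
rewrite pairingE !mxE /= /vec_letter.
by case: b; rewrite /= ?mulr0 ?mulr1 ?add0r ?addr0.
Qed.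

Lemma top_coef_Vdual n b f F : top_coef n f F ->
  top_coef n (dact (cgen (true, b)) f) (fun s => pt_a s (vec_letter b) 0 * F s).
Proof. by move=> tF s m nm; rewrite dact_Vdual coefZ tF // mulrCA. Qed.

Lemma top_coef_V n b f F : top_coef n f F ->
  top_coef n.+1 (dact (cgen (false, b)) f) (fun s => pt_b s 0 (vec_letter b) * F s).
Proof.
move=> tF s [//|m]; rewrite ltnS => nm; rewrite dact_gen /= coefD coefZ coefXM /=.
rewrite tF // pairing_V mulrCA coef_sum big1 ?addr0 ?eqSS // => i _.
by rewrite coefZ tF ?gtn_eqF ?mul0r ?mulr0 // leqW.
Qed.

Lemma top_coef_sym n i f F : top_coef n f F ->
  top_coef n (dact (csym i) f) (fun s => F (r i @ s)).
Proof. by move=> tF s m nm; rewrite dact_sym tF. Qed.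

Lemma top_coef_iter (t : H) (k e n : nat) (X : S -> K) f F :
  (forall n f F, top_coef n f F -> top_coef (e + n) (dact t f) (fun s => X s * F s)) ->
  top_coef n f F -> top_coef (k * e + n) (dact (t ^+ k) f) (fun s => X s ^+ k * F s).
Proof.
move=> tX tF; elim: k => [|k IHk].
  by rewrite expr0 dact1; apply: top_coef_ext tF => s; rewrite expr0 mul1r.
rewrite exprS dactM mulSn -addnA; apply: top_coef_ext (tX _ _ _ IHk) => s.
by rewrite exprS mulrA.
Qed.

Definition group_pt (w : nat * bool) (s : S) : S :=
  if w.2 then r 0 @ (r w.1 @ s) else r w.1 @ s.

Lemma top_coef_pbw k i j l m w (F : S -> K) :
  top_coef (l + m) (dact (pbw_nat cpar cgen csym k i j l m w) (fun s => (F s)%:P))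
   (fun s => pt_c s ^+ k * (pt_a s 0 0 ^+ i * (pt_a s 1 0 ^+ j *
      (pt_b s 0 0 ^+ l * (pt_b s 0 1 ^+ m * F (group_pt w s)))))).
Proof.
have t0 : top_coef 0 (fun s => (F s)%:P) F.
  by move=> s [|n] _; rewrite coefC /= ?mul1r ?mul0r.
rewrite /pbw_nat !dactM.
have tw : top_coef 0 (dact (group_elt csym w) (fun s => (F s)%:P)) (fun s => F
  (group_pt w s)).
  case: w => i0 []; rewrite /group_elt /group_pt /=; last exact: top_coef_sym.
  rewrite dactM; apply: (@top_coef_sym 0 i0 _ (fun s => F (r 0 @ s))).
  exact: top_coef_sym.
pose vx b (s : S) := pt_b s 0 (vec_letter b) : K.
pose vX b (s : S) := pt_a s (vec_letter b) 0 : K.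
have tm := @top_coef_iter _ m 1 _ (vx true) _ _ (fun n f F => @top_coef_V n true f F)
  tw.
have tl := @top_coef_iter _ l 1 _ (vx false) _ _ (fun n f F => @top_coef_V n false f
  F) tm.
have tj := @top_coef_iter _ j 0 _ (vX true) _ _ (fun n f F => @top_coef_Vdual n true
  f F) tl.
have ti := @top_coef_iter _ i 0 _ (vX false) _ _ (fun n f F => @top_coef_Vdual n
  false f F) tj.
have tk := @top_coef_iter _ k 0 _ (@pt_c K d zeta) _ _ (fun n f F => @top_coef_c n f
  F) ti.
by move: tk; rewrite !muln0 !muln1 !addn0 !add0n.
Qed.

Lemma refl_col i (a : 'cV[K]_2) : (refl zeta i *m a) 0 0 = zeta ^+ i * a 1 0 /\
  (refl zeta i *m a) 1 0 = zeta ^- i * a 0 0.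
Proof.
have l1 : lift ord0 ord0 = 1 :> 'I_2 by exact: val_inj.
by split; rewrite !mxE big_ord_recl big_ord_recl big_ord0 l1 !mxE /= !(mul0r, add0r,
  addr0).
Qed.

Lemma group_pt_a w s : (pt_a (group_pt w s) 0 0, pt_a (group_pt w s) 1 0) =
  if w.2 then (zeta ^- w.1 * pt_a s 0 0, zeta ^+ w.1 * pt_a s 1 0)
  else (zeta ^+ w.1 * pt_a s 1 0, zeta ^- w.1 * pt_a s 0 0).
Proof.
case: w => i []; rewrite /group_pt /= !pt_a_refl.
  have [-> ->] := refl_col 0 (refl zeta i *m pt_a s).
  by have [-> ->] := refl_col i (pt_a s); rewrite expr0 invr1 !mul1r.
by have [-> ->] := refl_col i (pt_a s).
Qed.

(** W acts freely on regular vectors: a rotated and a reflected image can only coincide on a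
    reflecting hyperplane, and two images of the same kind determine the power of zeta. *)
Lemma group_pt_inj (w w' : 'I_d * bool) s :
  (forall b, pt_a (group_pt (w.1 : nat, w.2) s) (vec_letter b) 0 =
             pt_a (group_pt (w'.1 : nat, w'.2) s) (vec_letter b) 0) -> w = w'.
Proof.
move=> ww'; have z0 := prim_root_neq0 zeta_prim.
have reg := pt_regular zeta_prim s.
have : (pt_a (group_pt (w.1 : nat, w.2) s) 0 0, pt_a (group_pt (w.1 : nat, w.2) s) 1
  0) =
  (pt_a (group_pt (w'.1 : nat, w'.2) s) 0 0, pt_a (group_pt (w'.1 : nat, w'.2) s) 1 0).
  by rewrite (ww' false) (ww' true).
have swap (i j : nat) : zeta ^+ i * pt_a s 1 0 = zeta ^- j * pt_a s 0 0 -> False.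
  move=> e; have := reg (i + j)%N; rewrite pairing_root exprD mulrAC e mulrAC.
  by rewrite mulVf ?expf_neq0 // mul1r subrr eqxx.
have same (i j : 'I_d) : zeta ^+ i * pt_a s 1 0 = zeta ^+ j * pt_a s 1 0 ->
    zeta ^- i * pt_a s 0 0 = zeta ^- j * pt_a s 0 0 -> i = j.
  move=> e1 e0; suff /eqP : zeta ^+ i = zeta ^+ j.
    rewrite (eq_prim_root_expr zeta_prim) !modn_small ?ltn_ord // => /eqP ij.
    exact: val_inj.
  have [a1|a1] := eqVneq (pt_a s 1 0) 0; last exact: (mulIf a1).
  have a0 : pt_a s 0 0 != 0.
    by have := reg 0; rewrite pairing_root a1 mulr0 subr0.
  exact/invr_inj/(mulIf a0).
rewrite !group_pt_a; case: w w' {ww'} => i [] [j []] /= [e1 e2].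
- by rewrite (same i j).
- by case: (swap _ _ e2).
- by case: (swap _ _ e1).
- by rewrite (same i j).
Qed.

(** Test functions have to lie in the orbit of [one_fun] under H; products of factors affine in X or
    Y already separate the points of a W-orbit. *)
Definition separator (L : seq (bool * K)) : H :=
  \prod_(p <- L) (cgen (true, p.1) - p.2 *: 1).

Lemma dact_separator L : dact (separator L) one_fun =
  fun s => (\prod_(p <- L) (pt_a s (vec_letter p.1) 0 - p.2))%:P.
Proof.
elim: L => [|p L IHL].
  by rewrite /separator big_nil dact1; apply/funext => s; rewrite big_nil.
rewrite /separator big_cons dactM -/(separator L) IHL; apply/funext => s.
rewrite big_cons.
have -> : cgen (true, p.1) - p.2 *: 1 = cgen (true, p.1) + (- p.2) *: 1 by rewrite
  scaleNr.
rewrite dactD dactZ dact1 !fctE dact_Vdual -scalerDl.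
by rewrite -mul_polyC -polyCM.
Qed.

Lemma separate (w : 'I_d * bool) s : exists L,
  forall w' : 'I_d * bool,
   (\prod_(p <- L) (pt_a (group_pt (w'.1 : nat, w'.2) s) (vec_letter p.1) 0 - p.2) !=
     0) =
   (w' == w).
Proof.
pose A (w : 'I_d * bool) b := pt_a (group_pt (w.1 : nat, w.2) s) (vec_letter b) 0.
(* The second coordinate is chosen if it distinguishes w' from w; otherwise the first one does, by
   freeness. *)
pose sel w' := A w' true != A w true.
exists [seq (sel w', A w' (sel w')) | w' <- enum (predC1 w)] => w'.
rewrite big_map prodf_seq_neq0; apply/allP/eqP => [all_neq|-> v].
  apply/eqP; apply: contraT => w'w; have := all_neq w'.
  by rewrite mem_enum inE w'w /= -/(A w' (sel w')) subrr eqxx => /(_ isT).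
rewrite mem_enum !inE /= -/(A w (sel v)) => vw; rewrite subr_eq0 eq_sym.
rewrite /sel; have [e1|//] := eqVneq (A v true) (A w true).
rewrite /=; apply: contraNneq vw => e0; apply/eqP.
by apply: (@group_pt_inj _ _ s) => -[].
Qed.

Definition pbw_degree (b : pbw_index d) : nat := (b.1.1.2 + b.1.2)%N.

Definition pbw_monomial (b : pbw_index d) (s : S) : K :=
  let: (k, i, j, l, m, _) := b in
  pt_c s ^+ k * (pt_a s 0 0 ^+ i * (pt_a s 1 0 ^+ j *
      (pt_b s 0 0 ^+ l * pt_b s 0 1 ^+ m))).

Lemma pbw_top_sum n (q : seq (pbw_index d)) (f : pbw_index d -> K) F s :
  (forall b, b \in q -> f b != 0 -> (pbw_degree b <= n)%N) ->
  (dact (\sum_(b <- q) f b *: pbw cpar cgen csym b) (fun s => (F s)%:P) s)`_n =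
  \sum_(b <- q | pbw_degree b == n)
    f b * (pbw_monomial b s * F (group_pt (b.2.1 : nat, b.2.2) s)).
Proof.
move=> deg_le; rewrite dact_sum coef_sum [RHS]big_mkcond big_seq [RHS]big_seq.
apply: eq_bigr => b bq; rewrite dactZ coefZ.
have [-> |fb] := eqVneq (f b) 0; first by rewrite !mul0r if_same.
have := deg_le b bq fb; case: b {bq fb} => [[[[[k i] j] l] m] [w e]] /= le_n.
rewrite /pbw (@top_coef_pbw k i j l m (w : nat, e) F s n le_n) eq_sym /pbw_degree /=.
by case: eqP => _; rewrite ?mul1r ?mul0r ?mulr0 // !mulrA.
Qed.

(* The point (t, (t^N, t^(N^2)), (t^(N^3), t^(N^4))): monomials with exponents
   less than N take on it the values of distinct powers of t. *)
Definition curve_pt (N j : nat) : K * 'cV[K]_2 * 'rV[K]_2 :=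
  (j%:R, \col_(a < 2) (if a == 0 then j%:R ^+ N else j%:R ^+ (N ^ 2)),
   \row_(a < 2) (if a == 0 then j%:R ^+ (N ^ 3) else j%:R ^+ (N ^ 4))).

(** On a reflecting hyperplane the two coordinates have equal d-th powers, which would force N =
    N^2. *)
Lemma curve_regular N j : (1 < N)%N -> (1 < j)%N -> dunkl_regular d zeta (curve_pt N j).
Proof.
move=> N1 j1; apply/(dunkl_regularP zeta_prim) => i.
rewrite pairing_root !mxE /= subr_eq0; apply/eqP => /(congr1 (fun t => t ^+ d)).
rewrite exprMn -(exprM zeta) [(i * d)%N]mulnC (exprM zeta) (prim_expr_order zeta_prim).
rewrite expr1n mul1r -!exprM.
rewrite -!natrX => /eqP; rewrite eqr_nat eqn_exp2l // eqn_pmul2r // -mulnn => /eqP.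
by move: N1; clear; nia.
Qed.

Definition pbw_code (N : nat) (b : pbw_index d) : nat :=
  let: (k, i, j, l, m, _) := b in
  (k + N * (i + N * (j + N * (l + N * m))))%N.

Definition pbw_lt (N : nat) (b : pbw_index d) : bool :=
  let: (k, i, j, l, m, _) := b in [&& k < N, i < N, j < N, l < N & m < N]%N.

Lemma pbw_code_inj N b b' : pbw_lt N b -> pbw_lt N b' ->
  b.2 = b'.2 -> pbw_code N b = pbw_code N b' -> b = b'.
Proof.
have step k k' t t' : (k < N)%N -> (k' < N)%N -> (k + N * t = k' + N * t')%N -> k =
  k' /\ t = t'.
  move=> kN k'N e; have N0 : (0 < N)%N by apply: leq_ltn_trans kN.
  have kk' : k = k'.
    by have /= := congr1 (modn^~ N) e; rewrite !(mulnC N) ![(_ + _ * N)%N]addnC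
      !modnMDl !modn_small.
  split=> //; move: e; rewrite kk' => /addnI/eqP.
  by rewrite eqn_pmul2l // => /eqP.
case: b b' => [[[[[k i] j] l] m] w] [[[[[k' i'] j'] l'] m'] w'] /=.
move=> /and5P[? ? ? ? ?] /and5P[? ? ? ? ?] ->.
by case/step=> // -> /step[]// -> /step[]// -> /step[]// -> ->.
Qed.

Lemma pbw_monomial_curve N j (b : pbw_index d) (N1 : (1 < N)%N) (j1 : (1 < j)%N) :
  pbw_monomial b (exist (fun s => is_true (dunkl_regular d zeta s)) _ (curve_regular
    N1 j1)) =
  j%:R ^+ pbw_code N b.
Proof.
case: b => [[[[[k i] j'] l] m] w] /=.
rewrite /pt_c /pt_a /pt_b /= !mxE /= -!exprM -!exprD; congr (_ ^+ _); nia.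
Qed.

Lemma poly_eq0_nat (p : {poly K}) : (forall j, (1 < j)%N -> p.[j%:R] = 0) -> p = 0.
Proof.
move=> pj; apply: contraTeq isT => p0.
have /(max_poly_roots p0) : all (poly.root p) [seq j.+2%:R | j <- iota 0 (size p)].
  by apply/allP => _ /mapP[j _ ->]; apply/eqP/pj.
rewrite size_map size_iota ltnn; apply.
rewrite map_inj_uniq ?iota_uniq // => i j /eqP; rewrite eqr_nat => /eqP [].
by [].
Qed.

(** Descent on the degree in x and y. The leading coefficient of h applied to a separator isolates
    the monomials with a given group element; their combination vanishes at all regular points, and
    restriction to the curve shows that every coefficient is zero. *)
Theorem pbw_faithful (h : H) : (forall p, dact h (dact p one_fun) = 0) ->
  pbw_span d cpar cgen csym h -> h = 0.
Proof.
move=> h0 /pbw_span_uniq [q [f [q_uniq hE]]].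
suff f0 : forall b, b \in q -> f b = 0.
  by rewrite hE big_seq big1 // => b bq; rewrite f0 // scale0r.
suff : forall n, (forall b, b \in q -> f b != 0 -> (pbw_degree b < n)%N) ->
    forall b, b \in q -> f b = 0.
  move/(_ (\max_(b <- q) pbw_degree b).+1); apply => b bq _.
  by rewrite ltnS; exact: leq_bigmax_seq.
elim=> [|n IHn] deg_lt.
  by move=> b bq; have [//|/(deg_lt b bq)] := eqVneq (f b) 0.
have topE L s : \sum_(b <- q | pbw_degree b == n) f b * (pbw_monomial b s *
    \prod_(p <- L) (pt_a (group_pt (b.2.1 : nat, b.2.2) s) (vec_letter p.1) 0 - p.2))
      = 0.
  have := pbw_top_sum (fun s => \prod_(p <- L) (pt_a s (vec_letter p.1) 0 - p.2)) s
    deg_lt.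
  by rewrite -dact_separator -hE h0 coef0 => <-.
have topw w s : \sum_(b <- q | (pbw_degree b == n) && (b.2 == w)) f b * pbw_monomial
  b s = 0.
  have [L LP] := separate w s.
  have nz : \prod_(p <- L) (pt_a (group_pt (w.1 : nat, w.2) s) (vec_letter p.1) 0 -
    p.2) != 0.
    by rewrite LP.
  apply: (mulIf nz); rewrite mul0r -[RHS](topE L s) mulr_suml.
  rewrite [RHS](bigID (fun b => b.2 == w)) /= [X in _ = _ + X]big1 ?addr0; last first.
    move=> b /andP[_ bw]; move: (LP b.2); rewrite (negPf bw) => /negbFE/eqP ->.
    by rewrite !mulr0.
  by apply: eq_bigr => b /andP[_ /eqP ->]; rewrite mulrA.
apply: IHn => b bq fb; have := deg_lt b bq fb; rewrite ltnS leq_eqVlt.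
case/orP=> // /eqP bn; case/eqP: fb.
(* [pbw_code 2 b] bounds each exponent of b, so N exceeds all exponents that occur, and N > 1. *)
pose N := (\max_(b <- q) pbw_code 2 b).+2.
have lt_N b' : b' \in q -> pbw_lt N b'.
  move=> b'q; have : (pbw_code 2 b' < N)%N by rewrite /N ltnS leqW // leq_bigmax_seq.
  by case: (b') => [[[[[k i] j] l] m] w] /=; lia.
have N1 : (1 < N)%N by [].
pose p : {poly K} := \sum_(b' <- q | (pbw_degree b' == n) && (b'.2 == b.2)) f b' *:
  'X^(pbw_code N b').
have p0 : p = 0.
  apply: poly_eq0_nat => j j1; rewrite -[RHS](topw b.2
    (exist (fun s => is_true (dunkl_regular d zeta s)) _ (curve_regular N1 j1))).
  rewrite /p horner_sum; apply: eq_bigr => b' _.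
  by rewrite hornerZ hornerXn pbw_monomial_curve.
have := congr1 (fun p : {poly K} => p`_(pbw_code N b)) p0.
rewrite coef0 /p coef_sum -big_filter (bigD1_seq b) ?filter_uniq //=; last first.
  by rewrite mem_filter bn !eqxx.
rewrite coefZ coefXn eqxx mulr1 big_seq_cond big1 ?addr0 // => b'.
rewrite mem_filter => /andP[/andP[/andP[_ /eqP b'w] b'q] b'b].
rewrite coefZ coefXn; case: eqP => [e|]; last by rewrite mulr0.
by case/eqP: b'b; apply: (@pbw_code_inj N); rewrite ?lt_N.
Qed.

End Faithful.

(** * The centre *)

Section Idempotent.
Variables (K : numFieldType) (d : nat) (zeta : K) (A : algType K).
Variables (c : A) (g : bool * bool -> A) (s : nat -> A).
Hypotheses (d_gt0 : (0 < d)%N).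
Hypothesis rel : cherednik_rel d zeta c g s.

Definition sym_idem : A := (d * 2)%:R^-1 *: \sum_(i < d) (s i + s i * s 0).

Let ss u v : s u * s v = s (u + d.-1 * v)%N * s 0.
Proof.
have := s_mul3 rel u v 0; rewrite addn0 => <-.
by rewrite -mulrA (s_square rel) mulr1.
Qed.

Let sp := s_periodic rel.
Let sp0 n : s (n + d) * s 0 = s n * s 0. Proof. by rewrite sp. Qed.

Lemma s_sym_idem j : s j * sym_idem = sym_idem.
Proof.
rewrite /sym_idem -scalerAr; congr (_ *: _); rewrite !big_split /= mulrDr !mulr_sumr
  [LHS]addrC.
congr (_ + _).
  rewrite -[RHS](sum_periodic_rev sp j); apply: eq_bigr => i _.
  by rewrite mulrA ss -mulrA (s_square rel) mulr1.
rewrite -[RHS](sum_periodic_rev sp0 j); apply: eq_bigr => i _.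
exact: ss.
Qed.

Lemma sym_idem_s j : sym_idem * s j = sym_idem.
Proof.
rewrite /sym_idem -scalerAl; congr (_ *: _); rewrite !big_split /= mulrDl !mulr_suml
  [LHS]addrC.
congr (_ + _).
  rewrite -[RHS](sum_periodic_shift sp j); apply: eq_bigr => i _.
  by rewrite (s_mul3 rel) muln0 addn0.
rewrite -[RHS](sum_periodic_shift sp0 (d.-1 * j)); apply: eq_bigr => i _.
exact: ss.
Qed.

Lemma sym_idem_idem : sym_idem * sym_idem = sym_idem.
Proof.
rewrite {2}/sym_idem -scalerAr mulr_sumr (eq_bigr (fun=> sym_idem *+ 2)) => [|i _].
  rewrite sumr_const card_ord -mulrnA mulnC -scaler_nat scalerA mulVf ?scale1r //.
  by rewrite pnatr_eq0 muln_eq0 /= -lt0n.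
by rewrite mulrDr mulrA !sym_idem_s mulr2n.
Qed.

End Idempotent.

Section CherednikCentre.
Variables (K : numFieldType) (d : nat) (zeta : K).
Hypotheses (zeta_prim : d.-primitive_root zeta) (d_gt1 : (1 < d)%N) (d_odd : odd d).
Local Notation S := (dunkl_point d zeta).
Local Notation M := (S -> {poly K}).
Local Notation r := (wrefl zeta_prim).
Local Notation H := (cherednik zeta_prim).
Local Notation gen := (gen zeta_prim).
Local Notation dact := (dact (zeta_prim := zeta_prim)).
Local Notation cgen := (cgen zeta_prim).
Local Notation cpar := (cpar zeta_prim).
Local Notation csym := (csym zeta_prim).
Local Notation one_fun := (@one_fun K d zeta).
Local Notation E := (sym_idem d csym).
Let d_gt0 : (0 < d)%N. Proof. exact: ltnW. Qed.
Let rel := cherednik_relP zeta_prim d_odd.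

Lemma gen_V u : gen (@GV K d zeta u) =
  u 0 0 *: cgen (false, false) + u 1 0 *: cgen (false, true).
Proof.
have uE : u = u 0 0 *: delta_mx (vec_letter false) 0 +
    u 1 0 *: delta_mx (vec_letter true) 0.
  apply/colP => a; rewrite !mxE /vec_letter !eqxx !andbT.
  by case: a => [[|[|a]] //= a2]; rewrite ?mulr1 ?mulr0 ?addr0 ?add0r;
    congr (u _ _); apply: val_inj.
by rewrite {1}uE gen_V_linear gen_VZ.
Qed.

Lemma gen_Vdual U : gen (@GVdual K d zeta U) =
  U 0 0 *: cgen (true, false) + U 0 1 *: cgen (true, true).
Proof.
have UE : U = U 0 0 *: delta_mx 0 (vec_letter false) +
    U 0 1 *: delta_mx 0 (vec_letter true).
  apply/rowP => a; rewrite !mxE /vec_letter !eqxx.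
  by case: a => [[|[|a]] //= a2]; rewrite ?mulr1 ?mulr0 ?addr0 ?add0r;
    congr (U _ _); apply: val_inj.
by rewrite {1}UE gen_Vdual_linear gen_VdualZ.
Qed.

Lemma gen_W w : exists i, gen (@GW K d zeta w) = csym i \/
  gen (@GW K d zeta w) = csym i * csym 0.
Proof.
have [i [->|->]] := wreflP zeta_prim w; exists i; [by left | right].
exact: gen_W_mul.
Qed.

Lemma cherednik_gen_ind (P : H -> Prop) :
  P 0 -> (forall u v, P u -> P v -> P (u + v)) ->
  (forall k u, P u -> P (k *: u)) -> P 1 ->
  (forall l u, P u -> P (cgen l * u)) -> (forall i u, P u -> P (csym i * u)) ->
  (forall u, P u -> P (cpar * u)) -> forall u, P u.
Proof.
move=> P0 PD PZ P1 Pg Ps Pc; apply: (cherednik_ind (zeta_prim := zeta_prim)) => //.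
move=> [u|U|w|i] h Ph.
- rewrite gen_V mulrDl -!scalerAl; apply: (PD); apply: (PZ); exact: Pg.
- rewrite gen_Vdual mulrDl -!scalerAl; apply: (PD); apply: (PZ); exact: Pg.
- have [i [->|->]] := gen_W w; first exact: Ps.
  by rewrite -mulrA; apply/Ps/Ps.
- by rewrite gen_GC_const //; exact: Pc.
Qed.

Lemma centralizes_central z : centralizes cpar cgen csym z -> forall t, z * t = t * z.
Proof.
move=> [zc zg zs]; elim/cherednik_gen_ind => [|u v zu zv|k u zu||l u zu|i u zu|u zu].
- by rewrite mulr0 mul0r.
- by rewrite mulrDr mulrDl zu zv.
- by rewrite -scalerAr -scalerAl zu.
- by rewrite mulr1 mul1r.
- by rewrite mulrA zg -!mulrA zu.
- by rewrite mulrA zs -!mulrA zu.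
- by rewrite mulrA -zc -!mulrA zu.
Qed.

Lemma pbw_span_all h : pbw_span d cpar cgen csym h.
Proof.
elim/cherednik_gen_ind: h => [|u v|k u||[[] b] u|i u|u].
- exact: pbw_span0.
- exact: pbw_spanD.
- exact: pbw_spanZ.
- exact: pbw_span1 d_gt0 rel.
- exact: pbw_span_V d_gt0 rel _ _.
- exact: pbw_span_Vdual d_gt0 rel _ _.
- exact: pbw_span_s d_gt0 rel _ _.
- exact: pbw_span_c d_gt0 rel _.
Qed.

Lemma dact_idem : dact E one_fun = one_fun.
Proof.
apply/funext => s; rewrite /sym_idem dactZ fctE dact_sum.
rewrite (eq_bigr (fun=> 1 *+ 2)) => [|i _].
  rewrite sumr_const card_ord -mulrnA -scaler_nat scalerA mulnC mulVf ?scale1r //.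
  by rewrite pnatr_eq0 muln_eq0 /= -lt0n.
by rewrite dactD dactM fctE !dact_sym.
Qed.

(** As E fixes [one_fun], z annihilates it; being central, z then annihilates everything that H
    makes of it. *)
Lemma central_idem_eq0 z : (forall t, z * t = t * z) -> z * E = 0 -> z = 0.
Proof.
move=> zC zE0; apply: (pbw_faithful (zeta_prim := zeta_prim)); last exact: pbw_span_all.
move=> p; rewrite -dactM zC dactM.
have -> : dact z one_fun = 0 by rewrite -dact_idem -dactM zE0 dact0.
exact: endo0.
Qed.

End CherednikCentre.

(** * Characters of the centre from Dunkl operators *)

Section DunklCharacter.
Variables (K : numFieldType) (d : nat) (zeta : K).
Hypotheses (zeta_prim : d.-primitive_root zeta) (d_gt1 : (1 < d)%N) (d_odd : odd d).
Local Notation S := (dunkl_point d zeta).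
Local Notation M := (S -> {poly K}).
Local Notation "w '@' s" := (dunkl_act zeta_prim w s) (at level 20).
Local Notation r := (wrefl zeta_prim).
Local Notation H := (cherednik zeta_prim).
Local Notation Z := (centre_alg H).
Local Notation gen := (gen zeta_prim).
Local Notation dact := (dact (zeta_prim := zeta_prim)).
Local Notation cgen := (cgen zeta_prim).
Local Notation cpar := (cpar zeta_prim).
Local Notation csym := (csym zeta_prim).
Local Notation one_fun := (@one_fun K d zeta).

(** At t = 0 the operators contain no derivatives, so multiplication by a W-invariant function
    commutes with all of them. *)
Lemma dact_invariant h (phi f : M) : (forall w s, phi (w @ s) = phi s) ->
  dact h (phi * f) = phi * dact h f.
Proof.
move=> phiW; elim/(cherednik_ind (zeta_prim := zeta_prim)): h f => [|u v IHu IHv|k u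
  IHu||g u IHu] f.
- by rewrite !dact0 mulr0.
- by rewrite !dactD IHu IHv mulrDr.
- by rewrite !dactZ IHu; apply/funext => s; rewrite !fctE scalerAr.
- by rewrite !dact1.
- rewrite !dactM IHu !dact_gen; move: (dact u f) => {}f.
  apply/funext => s; change (dunkl_fun zeta_prim g (fun s => phi s * f s) s =
    phi s * dunkl_fun zeta_prim g f s).
  case: g => [u'|U|w|i]; rewrite /dunkl_fun ?phiW ?scalerAr //.
  rewrite mulrDr mulr_sumr [in LHS]mulrCA -!scalerAr; congr (_ + _).
  by apply: eq_bigr => i _; rewrite phiW scalerAr.
Qed.

Lemma dact_central_one (z : Z) w s :
  dact (centre_val z) one_fun (w @ s) = dact (centre_val z) one_fun s.
Proof.
have /centreP zC := valP z.
have -> : dact (centre_val z) one_fun (w @ s) = dact (gen (@GW K d zeta w)) (dact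
  (centre_val z) one_fun) s.
  by rewrite dact_gen.
by rewrite -dactM -zC dactM dact_gen.
Qed.

(** The function z [one_fun] is W-invariant, so a product of central elements sends [one_fun] to the
    product of their functions. The formal variable only served to measure degrees and is set to
    1. *)
Definition dunkl_char (s : S) (z : Z) : K^o := (dact (centre_val z) one_fun s).[1].

Fact dunkl_char_zmod s : zmod_morphism (dunkl_char s).
Proof.
move=> x y; rewrite /dunkl_char /= -[- centre_val y]scaleN1r dactD dactZ scaleN1r.
by rewrite !fctE hornerD hornerN.
Qed.

Fact dunkl_char_monoid s : monoid_morphism (dunkl_char s).
Proof.
split=> [|x y]; first by rewrite /dunkl_char /= dact1 hornerC.
have e : dact (centre_val x) (dact (centre_val y) one_fun) =
    dact (centre_val y) one_fun * dact (centre_val x) one_fun.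
  rewrite -dact_invariant; last exact: dact_central_one.
  by congr (dact _ _); rewrite (_ : one_fun = 1) // mulr1.
by rewrite /dunkl_char /= dactM e fctE hornerM mulrC.
Qed.

Fact dunkl_char_scalable s : scalable (dunkl_char s).
Proof. by move=> k x; rewrite /dunkl_char /= dactZ fctE hornerZ. Qed.

HB.instance Definition _ s :=
  GRing.isZmodMorphism.Build Z K^o (dunkl_char s) (dunkl_char_zmod s).
HB.instance Definition _ s :=
  GRing.isMonoidMorphism.Build Z K^o (dunkl_char s) (dunkl_char_monoid s).
HB.instance Definition _ s :=
  GRing.isScalable.Build K Z K^o *:%R (dunkl_char s) (dunkl_char_scalable s).

Fact dunkl_scale_subproof (xi : nonzero K) (s : S) :
  dunkl_regular d zeta (pt_c s, val xi *: pt_a s, (val xi)^-1 *: pt_b s).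
Proof.
apply/(dunkl_regularP zeta_prim) => i /=.
have := pairing_linear (val xi) (pt_a s) 0 (Defs.root zeta i).
rewrite addr0 => ->; rewrite [pairing 0 _]pairingE !mxE !mulr0 !addr0.
by rewrite mulf_neq0 ?(valP xi) ?pt_regular.
Qed.

Definition dunkl_scale xi s : S :=
  exist (fun s => is_true (dunkl_regular d zeta s)) _ (dunkl_scale_subproof xi s).

Lemma dunkl_scale_act xi w s : dunkl_scale xi (w @ s) = w @ (dunkl_scale xi s).
Proof.
by apply/val_inj; rewrite /= /pt_a /pt_b /pt_c /= -scalemxAr -scalemxAl.
Qed.

(** The action of xi on H corresponds to the rescaling (c, xi a, xi^-1 b) of points; here [a] stands
    for any map with the properties of [act xi]. *)
Lemma dact_scale xi (a : H -> H) h (f : M) :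
  a 0 = 0 -> {morph a : u v / u + v} -> scalable a -> monoid_morphism a ->
  (forall g, a (gen g) = act_gen zeta_prim xi g) ->
  dact (a h) (f \o dunkl_scale xi) = dact h f \o dunkl_scale xi.
Proof.
move=> a0 aD aZ [a1 aM] ag.
elim/(cherednik_ind (zeta_prim := zeta_prim)): h f => [|u v IHu IHv|k u IHu||g u IHu] f.
- by rewrite a0 !dact0.
- by rewrite aD !dactD IHu IHv.
- by rewrite aZ !dactZ IHu.
- by rewrite a1 !dact1.
- rewrite aM !dactM IHu; move: (dact u f) => {}f.
  rewrite ag dact_gen; apply/funext => s.
  have xi0 := valP xi; case: g => [u'|U|w|i] /=.
  + rewrite gen_VZ dactZ dact_gen fctE /= scalerDr scalerA.
    congr (_ *: _ + _); first by rewrite [RHS]pairing_scale.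
    rewrite scaler_sumr; apply: eq_bigr => i _; rewrite scalerA dunkl_scale_act.
    congr (_ *: _); rewrite /refl_coef /= {1}/pt_c {2}/pt_a /=.
    have -> : pairing (val xi *: pt_a s) (Defs.root zeta i) =
      val xi * pairing (pt_a s) (Defs.root zeta i).
      by rewrite /pairing -scalemxAr mxE.
    by rewrite invfM mulrCA !mulrA.
  + rewrite gen_VdualZ dactZ dact_gen fctE /= scalerA; congr (_ *: _).
    have -> : pt_a (dunkl_scale xi s) = val xi *: pt_a s by [].
    by rewrite /pairing -scalemxAr [RHS]mxE.
  + by rewrite dact_gen /= dunkl_scale_act.
  + by rewrite dact_gen.
Qed.

Lemma dunkl_char_scale xi s z :
  dunkl_char s (act_centre xi z) = dunkl_char (dunkl_scale xi s) z.
Proof.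
rewrite /dunkl_char /=; congr (_ .[1]).
have := @dact_scale xi (act xi) (centre_val z) one_fun (raddf0 (act xi)) (raddfD (act
  xi))
  (presented_lift_is_scalable (@act_gen_relator _ _ _ zeta_prim xi))
  (presented_lift_is_monoid_morphism (@act_gen_relator _ _ _ zeta_prim xi))
  (act_genE zeta_prim xi).
by move=> /(congr1 (fun f : M => f s)).
Qed.

End DunklCharacter.

(** The shuffle has degree 2i - n; multiplication by xi^n avoids a negative exponent. *)
Lemma shuffle_scale (K : fieldType) (A : algType K) (a : A -> A)
    (xi : K) (p q : A) n i :
  zmod_morphism a -> monoid_morphism a ->
  xi != 0 -> a p = xi^-1 *: p -> a q = xi *: q ->
  xi ^+ n *: a (shuffle p q n i) = xi ^+ (i + i) *: shuffle p q n i.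
Proof.
move=> aB [a1 aM] xi0 ap aq.
have a0 : a 0 = 0 by have := aB 0 0; rewrite subr0 subrr.
have aN v : a (- v) = - a v by rewrite -[- v]sub0r aB a0 sub0r.
have aD u v : a (u + v) = a u + a v by rewrite -{1}[v]opprK aB aN opprK.
elim: n i => [|n IHn] [|i].
- by rewrite /shuffle !expr0 coef1 a1 !scale1r.
- by rewrite /shuffle expr0 coef1 a0 !scaler0.
- rewrite shuffleS0 aM ap exprS -scalerAl scalerA mulrAC mulfV // mul1r.
  by rewrite scalerAr IHn expr0 !scale1r.
- have e1 t : xi ^+ n.+1 *: (xi^-1 *: p * t) = p * (xi ^+ n *: t).
    by rewrite -scalerAl scalerA exprS mulrAC mulfV // mul1r scalerAr.
  have e2 t : xi ^+ n.+1 *: (xi *: q * t) = xi ^+ 2 *: (q * (xi ^+ n *: t)).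
    rewrite -scalerAl scalerA -scalerAr scalerA; congr (_ *: _).
    by rewrite exprS expr2 -!mulrA; congr (_ * _); rewrite mulrC.
  rewrite shuffleSS aD !aM ap aq scalerDr e1 e2 !IHn -!scalerAr scalerA -exprD.
  by rewrite [RHS]scalerDr; congr (_ + xi ^+ _ *: _); rewrite addSn addnS.
Qed.

(** * Fixed points *)

Section MuFixed.
Import mpoly.
Variables (K : numClosedFieldType) (d : nat) (zeta : K).
Hypotheses (zeta_prim : d.-primitive_root zeta) (d_gt1 : (1 < d)%N) (d_odd : odd d).
Local Notation S := (dunkl_point d zeta).
Local Notation M := (S -> {poly K}).
Local Notation "w '@' s" := (dunkl_act zeta_prim w s) (at level 20).
Local Notation r := (wrefl zeta_prim).
Local Notation H := (cherednik zeta_prim).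
Local Notation Z := (centre_alg H).
Local Notation gen := (gen zeta_prim).
Local Notation dact := (dact (zeta_prim := zeta_prim)).
Local Notation cgen := (cgen zeta_prim).
Local Notation cpar := (cpar zeta_prim).
Local Notation csym := (csym zeta_prim).
Local Notation one_fun := (@one_fun K d zeta).
Local Notation E := (sym_idem d csym).
Let d_gt0 : (0 < d)%N. Proof. exact: ltnW. Qed.
Let rel := cherednik_relP zeta_prim d_odd.

Lemma central_mem z : centralizes cpar cgen csym z -> z \in centre H.
Proof. by move=> zC; apply/centreP; exact: centralizes_central zC. Qed.

Lemma cpar_centralizes : centralizes cpar cgen csym cpar.
Proof. by split=> [t|l|i]; exact: c_central rel _. Qed.

Definition Zpar : Z := CentreAlg (central_mem cpar_centralizes).
Definition Zeuler : Z := CentreAlg (central_mem (euler_centralizes d_gt1 zeta_prim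
  rel)).
Definition ZinvV : Z := CentreAlg (central_mem (invV_centralizes d_gt1 zeta_prim rel)).
Definition ZinvVdual : Z := CentreAlg (central_mem (invVdual_centralizes d_gt1
  zeta_prim rel)).
Definition Zmixed i : Z := CentreAlg (central_mem (inv_mixed_centralizes d_gt1
  zeta_prim rel i)).

Definition coordinate (i : 'I_4) : Z :=
  match val i with 0 => Zpar | 1 => Zmixed 0 | 2 => Zmixed d | _ => Zeuler end.

Local Notation CM := (calogero_moser zeta_prim).
Local Notation fixed := (mu_fixed zeta_prim d).

Lemma fixedE (chi : {lrmorphism Z -> K^o}) (xi : nonzero K) z :
  fixed chi -> val xi ^+ d = 1 -> chi (act_centre xi z) = chi z.
Proof.
move=> chi_fixed xi1.
have e : nonzero_inv (nonzero_inv xi) = xi by apply/val_inj; rewrite /= invrK.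
have u : d.-unity_root (val (nonzero_inv xi)).
  by apply/unity_rootP; rewrite /= exprVn xi1 invr1.
have := chi_fixed _ u; rewrite /act_point e.
by move=> /(congr1 (fun f : {lrmorphism Z -> K^o} => f z)).
Qed.

Definition zeta_unit : nonzero K := exist _ zeta (prim_root_neq0 zeta_prim).

Lemma fixed_eq0 (chi : {lrmorphism Z -> K^o}) z n m : fixed chi ->
  zeta ^+ m *: act_centre zeta_unit z = zeta ^+ n *: z ->
  zeta ^+ m != zeta ^+ n -> chi z = 0.
Proof.
move=> chi_fixed zE nm; have := congr1 chi zE; rewrite !linearZ /=.
rewrite fixedE //; last exact: (prim_expr_order zeta_prim).
move/eqP; rewrite -subr_eq0 -scalerBl scaler_eq0 subr_eq0 (negPf nm) /=.
by move/eqP.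
Qed.

Lemma act_cgen xi l : act xi (cgen l) = (if l.1 then val xi else (val xi)^-1) *: cgen l.
Proof.
by case: l => [[] b]; rewrite /cgen act_genE /= ?gen_VdualZ ?gen_VZ.
Qed.

Lemma zeta_neq m n : (m != n %[mod d])%N -> zeta ^+ m != zeta ^+ n.
Proof. by rewrite (eq_prim_root_expr zeta_prim). Qed.

Let d_gt2 : (2 < d)%N. Proof. by move: d_odd d_gt1; case: (d) => [|[|[|n]]]. Qed.

Lemma fixed_invV (chi : {lrmorphism Z -> K^o}) : fixed chi -> chi ZinvV = 0.
Proof.
move=> chi_fixed; apply: (@fixed_eq0 chi _ 0 2 chi_fixed); last first.
  by apply: zeta_neq; rewrite mod0n modn_small.
apply/val_inj; rewrite /= [act _ _](rmorphM (act zeta_unit)) /= !act_cgen /=.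
rewrite -scalerAl -scalerAr !scalerA; congr (_ *: _).
by have z0 := prim_root_neq0 zeta_prim; field.
Qed.

Lemma fixed_invVdual (chi : {lrmorphism Z -> K^o}) : fixed chi -> chi ZinvVdual = 0.
Proof.
move=> chi_fixed; apply: (@fixed_eq0 chi _ 2 0 chi_fixed); last first.
  by apply: zeta_neq; rewrite mod0n modn_small.
apply/val_inj; rewrite /= [act _ _](rmorphM (act zeta_unit)) /= !act_cgen /=.
by rewrite -scalerAl -scalerAr !scalerA expr0 mul1r.
Qed.

Lemma fixed_mixed (chi : {lrmorphism Z -> K^o}) i : fixed chi -> (0 < i < d)%N ->
  chi (Zmixed i) = 0.
Proof.
move=> chi_fixed /andP[i0 id]; apply: (@fixed_eq0 chi _ (i + i) d chi_fixed);
  last first.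
  apply: zeta_neq; rewrite modnn eq_sym -/(d %| i + i)%N addnn -mul2n Gauss_dvdr.
    by rewrite gtnNdvd.
  by rewrite coprimen2.
have sh b : zeta ^+ d *: act zeta_unit (shuffle (cgen (false, b)) (cgen (true, ~~ b))
  d i) =
    zeta ^+ (i + i) *: shuffle (cgen (false, b)) (cgen (true, ~~ b)) d i.
  apply: shuffle_scale.
  - exact: (presented_lift_is_zmod_morphism (@act_gen_relator _ _ _ zeta_prim _)).
  - exact: (presented_lift_is_monoid_morphism (@act_gen_relator _ _ _ zeta_prim _)).
  - exact: prim_root_neq0 zeta_prim.
  - by rewrite act_cgen.
  - by rewrite act_cgen.
apply/val_inj; rewrite /= [act _ _](raddfD (act zeta_unit)) /=.
by rewrite !scalerDr; congr (_ + _); [exact: (sh false) | exact: (sh true)].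
Qed.

Definition coords (chi : Z -> K) (i : 'I_4) : K := chi (coordinate i).

(** One P serves all fixed characters. Tame elements form a subalgebra containing the known
    generators: those of degree divisible by d are coordinates, and the others take the value 0. *)
Definition tame (z : Z) : Prop := exists P : {mpoly K[4]},
  forall chi : {lrmorphism Z -> K^o}, fixed chi -> chi z = meval (coords chi) P.

Lemma tameD z z' : tame z -> tame z' -> tame (z + z').
Proof.
move=> [P zP] [P' zP']; exists (P + P') => chi chi_fixed.
by rewrite mevalD raddfD /= zP // zP'.
Qed.

Lemma tameM z z' : tame z -> tame z' -> tame (z * z').
Proof.
move=> [P zP] [P' zP']; exists (P * P') => chi chi_fixed.
by rewrite mevalM rmorphM /= zP // zP'.
Qed.

Lemma tameZ k z : tame z -> tame (k *: z).
Proof.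
move=> [P zP]; exists (k *: P) => chi chi_fixed.
by rewrite mevalZ linearZ /= zP.
Qed.

Lemma tame1 : tame 1.
Proof. by exists 1 => chi _; rewrite meval1 rmorph1. Qed.

Lemma tame_eq0 z : (forall chi : {lrmorphism Z -> K^o}, fixed chi -> chi z = 0) ->
  tame z.
Proof. by move=> z0; exists 0 => chi chi_fixed; rewrite meval0 z0. Qed.

Lemma tame_coordinate i : tame (coordinate i).
Proof.
exists 'X_i => chi _.
by rewrite mevalXU.
Qed.
End MuFixed.

(** * Generation of the centre and the relation at fixed characters *)

Section MuFixedCoordinates.
Import mpoly.
Variables (K : numClosedFieldType) (d : nat) (zeta : K).
Hypotheses (zeta_prim : d.-primitive_root zeta) (d_gt1 : (1 < d)%N) (d_odd : odd d).
Local Notation S := (dunkl_point d zeta).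
Local Notation M := (S -> {poly K}).
Local Notation "w '@' s" := (dunkl_act zeta_prim w s) (at level 20).
Local Notation r := (wrefl zeta_prim).
Local Notation H := (cherednik zeta_prim).
Local Notation Z := (centre_alg H).
Local Notation gen := (gen zeta_prim).
Local Notation dact := (dact (zeta_prim := zeta_prim)).
Local Notation cgen := (cgen zeta_prim).
Local Notation cpar := (cpar zeta_prim).
Local Notation csym := (csym zeta_prim).
Local Notation one_fun := (@one_fun K d zeta).
Local Notation E := (sym_idem d csym).
Local Notation Zpar := (Zpar zeta_prim d_odd).
Local Notation Zeuler := (Zeuler zeta_prim d_gt1 d_odd).
Local Notation ZinvV := (ZinvV zeta_prim d_gt1 d_odd).
Local Notation ZinvVdual := (ZinvVdual zeta_prim d_gt1 d_odd).
Local Notation Zmixed := (Zmixed zeta_prim d_gt1 d_odd).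
Local Notation coordinate := (coordinate zeta_prim d_gt1 d_odd).
Local Notation coords := (coords (zeta_prim := zeta_prim) d_gt1 d_odd).
Local Notation tame := (tame (zeta_prim := zeta_prim) d_gt1 d_odd).
Local Notation fixed := (mu_fixed zeta_prim d).
Let d_gt0 : (0 < d)%N. Proof. exact: ltnW. Qed.
Let rel := cherednik_relP zeta_prim d_odd.

Let sE := s_sym_idem rel.
Let Es := sym_idem_s rel.
Let EE := sym_idem_idem d_gt0 rel.

Definition tame_mem (h : H) : Prop := exists2 z : Z, tame z & centre_val z = h.

Let tame_central : forall (z t : H), tame_mem z -> z * t = t * z.
Proof. by move=> _ t [z _ <-]; exact/centreP/(valP z). Qed.

Let tame_one : tame_mem 1. Proof. by exists 1 => //; exact: tame1. Qed.

Let tame_add z z' : tame_mem z -> tame_mem z' -> tame_mem (z + z').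
Proof. by move=> [u tu <-] [v tv <-]; exists (u + v) => //; exact: tameD. Qed.

Let tame_mul z z' : tame_mem z -> tame_mem z' -> tame_mem (z * z').
Proof. by move=> [u tu <-] [v tv <-]; exists (u * v) => //; exact: tameM. Qed.

Let tame_scale k z : tame_mem z -> tame_mem (k *: z).
Proof. by move=> [u tu <-]; exists (k *: u) => //; exact: tameZ. Qed.

Let tame_c : tame_mem cpar.
Proof. by exists Zpar => //; exact: (tame_coordinate _ _ _ (Ordinal (isT : (0 <
  4)%N))). Qed.

Let tame_euler : tame_mem (euler cgen).
Proof. by exists Zeuler => //; exact: (tame_coordinate _ _ _ (Ordinal (isT : (3 <
  4)%N))). Qed.

Let tame_invV : tame_mem (invV cgen).
Proof. by exists ZinvV => //; apply: tame_eq0 => chi; exact: fixed_invV. Qed.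

Let tame_invVdual : tame_mem (invVdual cgen).
Proof. by exists ZinvVdual => //; apply: tame_eq0 => chi; exact: fixed_invVdual. Qed.

Let inv_mixed_gt i : (d < i)%N -> inv_mixed d cgen i = 0.
Proof. by move=> di; rewrite /inv_mixed !shuffle_gt // addr0. Qed.

Let tame_mixed i : tame_mem (inv_mixed d cgen i).
Proof.
have [i0|i0] := posnP i.
  by rewrite i0; exists (Zmixed 0) => //; exact: (tame_coordinate _ _ _ (Ordinal (isT
    : (1 < 4)%N))).
have [id|di|->] := ltngtP i d.
- by exists (Zmixed i) => //; apply: tame_eq0 => chi chi_fixed;
  rewrite fixed_mixed // i0.
- by rewrite inv_mixed_gt //; exists 0 => //; apply: tame_eq0 => chi _; rewrite raddf0.
- by exists (Zmixed d) => //; exact: (tame_coordinate _ _ _ (Ordinal (isT : (2 <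
  4)%N))).
Qed.

Lemma spherical_all h : exists2 z : Z, tame z & E * h * E = centre_val z * E.
Proof.
suff : spherical E tame_mem h by case=> _ [z tz <-] e; exists z.
(* The induction adds generators to the left of h. A word u is kept there to collect letters;
   reflections and c are moved across it to the left. *)
suff sph u : spherical E tame_mem (word_val cgen u * h).
  by have := sph [::]; rewrite /word_val big_nil mul1r.
have sD := sphericalD tame_add.
have sZ k := @sphericalZ _ _ E tame_mem tame_scale k.
elim/(@cherednik_gen_ind _ _ _ zeta_prim d_odd): h u => [|h h' IHh IHh'|k h IHh||l h
  IHh|i h IHh|h IHh] u.
- by rewrite mulr0; apply: spherical0 => //; exact: tame_scale.
- by rewrite mulrDr; exact: sD.
- by rewrite -scalerAr; exact: sZ.
- rewrite mulr1; exact: (@spherical_word _ _ _ _ _ _ _ d_gt1 zeta_prim rel E tame_mem).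
- have := IHh (rcons u l); rewrite /word_val -cats1 big_cat big_seq1.
  by rewrite -mulrA.
- have [k usE] : exists k, word_val cgen u * csym i = k *: (csym i * word_val cgen
  (flip u)).
    have flipK : flip (flip u) = u.
      rewrite /flip -map_comp -[RHS]map_id; apply: eq_map => -[a b] /=.
      by rewrite negbK.
    exists (zeta ^+ (i * word_weight d (flip u)))^-1; rewrite (s_word rel) flipK.
    by rewrite scalerK // expf_neq0 // (prim_root_neq0 zeta_prim).
  rewrite mulrA usE -scalerAl -mulrA; apply: sZ.
  by apply: spherical_sl => //; exact: Es.
- rewrite mulrA -(c_central rel) -mulrA.
  by apply: sphericalM tame_c (IHh u).
Qed.

Lemma central_idem_inj (z z' : Z) : centre_val z * E = centre_val z' * E -> z = z'.
Proof.
move=> zz'; apply/val_inj/eqP; rewrite -subr_eq0; apply/eqP.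
apply: (central_idem_eq0 d_gt1 d_odd) => [t|].
  by have /centreP zC := valP z; have /centreP zC' := valP z';
    rewrite mulrBl mulrBr zC zC'.
by rewrite mulrBl zz' subrr.
Qed.

Lemma tame_all (z : Z) : tame z.
Proof.
have [z' tz' e] := spherical_all (centre_val z).
suff -> : z = z' by [].
apply: central_idem_inj; rewrite -e.
by have /centreP zC := valP z; rewrite -zC -mulrA EE.
Qed.

(** The relation in H E has cofactors that need not be central. Multiplying it by E on both sides
    replaces each cofactor h by E h E = z E with z central. *)
Lemma relation_ideal : exists z1 z2 z3 : Z,
  Zmixed 0 * Zmixed d -
    Zeuler ^+ d.-2 * (Zeuler + d%:R *: Zpar) * (Zeuler - d%:R *: Zpar) =
  ZinvV * z1 + ZinvVdual * z2 + Zmixed 1 * z3.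
Proof.
set q := (X in exists _ _ _, X = _).
have cC i := centralizes_central d_odd (inv_mixed_centralizes d_gt1 zeta_prim rel i).
have vC := centralizes_central d_odd (invV_centralizes d_gt1 zeta_prim rel).
have vdC := centralizes_central d_odd (invVdual_centralizes d_gt1 zeta_prim rel).
have euC := centralizes_central d_odd (euler_centralizes d_gt1 zeta_prim rel).
have [h1 [h2 [h3 hE]]] := mod_ideal_relation d_gt1 zeta_prim rel sE vC vdC euC cC.
have [z1 _ e1] := spherical_all h1.
have [z2 _ e2] := spherical_all h2.
have [z3 _ e3] := spherical_all h3.
exists z1, z2, z3; apply: central_idem_inj.
have qE : centre_val q * E = invV cgen * h1 + invVdual cgen * h2 + inv_mixed d cgen 1
  * h3.
  rewrite -hE; congr (_ * E).
  have valX z n : centre_val (z ^+ n) = centre_val z ^+ n :> H.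
    elim: n => [|n IHn]; first by rewrite !expr0.
    by rewrite !exprS -IHn.
  rewrite /q /= valX /inv_mixed !shuffle0 !shufflenn /=.
  by congr (_ * _ - _); exact: addrC.
have -> : centre_val q * E = E * (centre_val q * E) * E.
  have /centreP qC := valP q.
  by rewrite -(mulrA E) -(mulrA _ E E) EE mulrA -qC -mulrA EE.
rewrite qE mulrDr mulrDr 2!mulrDl.
have step z h z' : (forall t, z * t = t * z) -> E * h * E = centre_val z' * E ->
    E * (z * h) * E = z * centre_val z' * E.
  by move=> zC e; rewrite mulrA -zC -!mulrA (mulrA E) e.
by rewrite (step _ _ _ vC e1) (step _ _ _ vdC e2) (step _ _ _ (cC 1%N) e3) -2!mulrDl.
Qed.

Lemma fixed_relation (chi : {lrmorphism Z -> K^o}) : fixed chi ->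
  (chi Zeuler - d%:R * chi Zpar) * (chi Zeuler + d%:R * chi Zpar) *
    chi Zeuler ^+ (d - 2) = chi (Zmixed 0) * chi (Zmixed d).
Proof.
move=> chi_fixed; have [z1 [z2 [z3 relE]]] := relation_ideal.
have e0 : chi (ZinvV * z1 + ZinvVdual * z2 + Zmixed 1 * z3) = 0.
  rewrite !raddfD /= !rmorphM /= fixed_invV // fixed_invVdual // fixed_mixed //.
  by rewrite !mul0r !addr0.
have e : chi (Zmixed 0 * Zmixed d) =
    chi (Zeuler ^+ d.-2 * (Zeuler + d%:R *: Zpar) * (Zeuler - d%:R *: Zpar)).
  apply/eqP; rewrite -subr_eq0; apply/eqP; rewrite -[RHS]e0 -relE.
  exact/esym/(raddfB chi).
apply: etrans (etrans (esym e) (rmorphM chi _ _)).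
have ZE : chi (d%:R *: Zpar) = d%:R * chi Zpar by rewrite linearZ.
rewrite !rmorphM rmorphXn raddfD raddfB /= !ZE subn2.
by rewrite -[RHS]mulrA [RHS]mulrC; congr (_ * _); exact: mulrC.
Qed.
End MuFixedCoordinates.

Lemma ord2_ind (P : 'I_2 -> Prop) : P 0 -> P 1 -> forall j, P j.
Proof.
move=> P0 P1 [[|[|j]] //= j2].
- by rewrite (_ : Ordinal j2 = 0) //; exact: val_inj.
- by rewrite (_ : Ordinal j2 = 1) //; exact: val_inj.
Qed.

(** * Fixed characters given by Dunkl points *)

Section Existence.
Variables (K : numClosedFieldType) (d : nat) (zeta : K).
Hypotheses (zeta_prim : d.-primitive_root zeta) (d_gt1 : (1 < d)%N) (d_odd : odd d).
Local Notation S := (dunkl_point d zeta).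
Local Notation "w '@' s" := (dunkl_act zeta_prim w s) (at level 20).
Local Notation r := (wrefl zeta_prim).
Local Notation H := (cherednik zeta_prim).
Local Notation Z := (centre_alg H).
Local Notation dact := (dact (zeta_prim := zeta_prim)).
Local Notation cgen := (cgen zeta_prim).
Local Notation one_fun := (@one_fun K d zeta).
Local Notation Zpar := (Zpar zeta_prim d_odd).
Local Notation Zeuler := (Zeuler zeta_prim d_gt1 d_odd).
Local Notation Zmixed := (Zmixed zeta_prim d_gt1 d_odd).
Local Notation fixed := (mu_fixed zeta_prim d).
Let d_gt0 : (0 < d)%N. Proof. exact: ltnW. Qed.

(** With both vectors on the first axis, rescaling by a d-th root of unity is the action of a
    rotation in W, so the character is fixed; its values at c, R and eu are a, l^d and bl. *)
Definition axis_triple (a l b : K) : K * 'cV[K]_2 * 'rV[K]_2 :=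
  (a, l *: delta_mx 0 0, b *: delta_mx 0 0).

Lemma axis_regular a l b : l != 0 -> dunkl_regular d zeta (axis_triple a l b).
Proof.
move=> l0; apply/(dunkl_regularP zeta_prim) => i.
by rewrite pairing_root !mxE /= mulr1 !mulr0 subr0.
Qed.

Definition axis_point a l b (l0 : l != 0) : S :=
  exist (fun s => is_true (dunkl_regular d zeta s)) _ (axis_regular a b l0).

Lemma axis_point_scale a l b (l0 : l != 0) (xi : nonzero K) : val xi ^+ d = 1 ->
  exists w, dunkl_scale zeta_prim xi (axis_point a b l0) = w @ axis_point a b l0.
Proof.
move=> xi1; have [|i xiE] := prim_rootP zeta_prim (_ : (val xi)^-1 ^+ d = 1).
  by rewrite exprVn xi1 invr1.
exists (wmul (r i) (r 0)); apply/val_inj; rewrite dunkl_actM /=.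
rewrite /pt_c /pt_a /pt_b /= !(invmx_refl zeta_prim) xiE -[sval xi]invrK xiE.
have l1 : lift ord0 ord0 = 1 :> 'I_2 by exact: val_inj.
congr (_, _, _).
- apply/colP.
  have [e0 e1] := refl_col zeta 0 (refl zeta i *m (l *: delta_mx 0 0)).
  have [f0 f1] := refl_col zeta i (l *: delta_mx 0 0).
  by apply: ord2_ind; rewrite ?e0 ?e1 ?f0 ?f1 !mxE /= ?expr0 ?invr1 ?mul1r ?mulr1
    ?mulr0.
- apply/rowP; apply: ord2_ind; rewrite !mxE !big_ord_recl !big_ord0 !l1 !mxE.
    rewrite !big_ord_recl !big_ord0 !l1 !mxE /=.
    by rewrite !(mulr0, mul0r, addr0, add0r) mulr1 invr1 mulr1 mulrC.
  rewrite !big_ord_recl !big_ord0 !l1 !mxE /=.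
  by rewrite !(mulr0, mul0r, addr0, add0r).
Qed.

Lemma dunkl_char_fixed a l b (l0 : l != 0) :
  fixed (dunkl_char (zeta_prim := zeta_prim) (axis_point a b l0) : {lrmorphism Z ->
    K^o}).
Proof.
move=> xi /unity_rootP xi1; apply: spectrum_eq => z.
have xi1' : val (nonzero_inv xi) ^+ d = 1 by rewrite /= exprVn xi1 invr1.
have [w sw] := axis_point_scale a b l0 xi1'.
rewrite /act_point; apply: etrans (dunkl_char_scale _ _ z) _.
by rewrite sw /dunkl_char dact_central_one.
Qed.

Lemma dunkl_char_par a l b (l0 : l != 0) :
  dunkl_char (axis_point a b l0) Zpar = a.
Proof. by rewrite /dunkl_char dact_gen /= alg_polyC hornerC. Qed.

Lemma dunkl_char_dual a l b (l0 : l != 0) :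
  dunkl_char (axis_point a b l0) (Zmixed d) = l ^+ d.
Proof.
rewrite /dunkl_char /= /inv_mixed !shufflenn dactD fctE.
have expE e (s : S) n : dact (cgen (true, e) ^+ n) one_fun s = (pt_a s (vec_letter e)
  0 ^+ n)%:P.
  elim: n => [|n IHn]; first by rewrite expr0 dact1.
  by rewrite exprS dactM dact_Vdual IHn -mul_polyC -polyCM -exprS.
rewrite !expE -polyCD hornerC /pt_a !mxE /= mulr0 mulr1 expr0n.
by rewrite gtn_eqF // add0r.
Qed.

Lemma dunkl_char_euler a l b (l0 : l != 0) :
  dunkl_char (axis_point a b l0) Zeuler = b * l.
Proof.
set s := axis_point a b l0; have a0 : pt_a s 0 0 = l by rewrite !mxE /= mulr1.
have a1 : pt_a s 1 0 = 0 by rewrite !mxE /= mulr0.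
rewrite /dunkl_char /= /euler dactD !dactM fctE dact_Vdual /= a1 scale0r addr0.
(* The reflection terms vanish because s_i moves the vector to the second axis, where X is zero. *)
rewrite dact_gen /= big1 ?addr0 => [|i _]; last first.
  rewrite dact_Vdual pt_a_refl /=; have [-> _] := refl_col zeta i (pt_a s).
  by rewrite a1 mulr0 scale0r scaler0.
rewrite dact_Vdual a0 pairingE !mxE /= !mulr1 !mulr0 addr0.
by rewrite !hornerE /= !mulr1.
Qed.
End Existence.

Local Open Scope classical_set_scope.

Definition fixed_surface (K : fieldType) (d : nat) : set 'rV[K]_4 :=
  [set p : 'rV[K]_4 |
          let a := p 0 0 in let u := p 0 1 in
          let v := p 0 2 in let e := p 0 3 in
          (e - d%:R * a) * (e + d%:R * a) * e ^+ (d - 2) = u * v].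

Lemma ord4_ind (P : 'I_4 -> Prop) : P 0 -> P 1 -> P 2 -> P 3 -> forall j, P j.
Proof.
move=> P0 P1 P2 P3 [[|[|[|[|j]]]] //= j4].
- by rewrite (_ : Ordinal j4 = 0) //; exact: val_inj.
- by rewrite (_ : Ordinal j4 = 1) //; exact: val_inj.
- by rewrite (_ : Ordinal j4 = 2) //; exact: val_inj.
- by rewrite (_ : Ordinal j4 = 3) //; exact: val_inj.
Qed.

(** * The isomorphism with the surface *)

Section Points.
Import mpoly.
Variables (K : numClosedFieldType) (d : nat) (zeta : K).
Hypotheses (zeta_prim : d.-primitive_root zeta) (d_gt1 : (1 < d)%N) (d_odd : odd d).
Local Notation H := (cherednik zeta_prim).
Local Notation Z := (centre_alg H).
Local Notation coordinate := (coordinate zeta_prim d_gt1 d_odd).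
Local Notation coords := (coords (zeta_prim := zeta_prim) d_gt1 d_odd).
Local Notation fixed := (mu_fixed zeta_prim d).
Local Notation Zpar := (Zpar zeta_prim d_odd).
Local Notation Zeuler := (Zeuler zeta_prim d_gt1 d_odd).
Local Notation Zmixed := (Zmixed zeta_prim d_gt1 d_odd).
Let d_gt0 : (0 < d)%N. Proof. exact: ltnW. Qed.

Definition coord_row (chi : Z -> K) : 'rV[K]_4 := \row_i coords chi i.

Lemma coord_rowE chi :
  [/\ coord_row chi 0 0 = chi Zpar, coord_row chi 0 1 = chi (Zmixed 0),
      coord_row chi 0 2 = chi (Zmixed d) & coord_row chi 0 3 = chi Zeuler].
Proof. by split; rewrite mxE. Qed.

Lemma coord_row_surface (chi : {lrmorphism Z -> K^o}) : fixed chi ->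
  fixed_surface d (coord_row chi).
Proof.
move=> chi_fixed; rewrite /fixed_surface /=; have [-> -> -> ->] := coord_rowE chi.
exact: fixed_relation.
Qed.

(** A d-th root l of v and b = e / l realize the coordinates a, v and e; then u is right as well,
    because both points satisfy the equation and v can be cancelled. *)
Lemma surface_point (p : 'rV[K]_4) : fixed_surface d p -> p 0 2 != 0 ->
  exists2 chi : {lrmorphism Z -> K^o}, fixed chi & coord_row chi = p.
Proof.
rewrite /fixed_surface /= => pS v0; pose l := d.-root (p 0 2).
have ld : l ^+ d = p 0 2 by exact: rootCK.
have l0 : l != 0 by apply: contraNneq v0 => l0; rewrite -ld l0 expr0n gtn_eqF.
pose chi : {lrmorphism Z -> K^o} := dunkl_char (zeta_prim := zeta_prim)
  (axis_point zeta_prim (p 0 0) (p 0 3 / l) l0).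
have chi_fixed : fixed chi by exact: dunkl_char_fixed.
exists chi => //.
have [c0 c1 c2 c3] := coord_rowE chi.
have e0 : coord_row chi 0 0 = p 0 0 by rewrite c0; exact: dunkl_char_par.
have e2 : coord_row chi 0 2 = p 0 2 by rewrite c2 -ld; exact: dunkl_char_dual.
have e3 : coord_row chi 0 3 = p 0 3.
  by rewrite c3; apply: etrans (dunkl_char_euler _ _ _ _ _ _) _; rewrite divfK.
apply/rowP; apply: ord4_ind => //.
apply: (mulIf v0); rewrite -pS -[in LHS]e2.
by have := coord_row_surface chi_fixed; rewrite /fixed_surface /= e0 e2 e3 => ->.
Qed.

Lemma meval_line n (q : 'I_n -> {poly K}) (P : {mpoly K[n]}) :
  exists h : {poly K}, forall t, h.[t] = meval (fun i => (q i).[t]) P.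
Proof.
exists (\sum_(m <- msupp P) P@_m *: \prod_i q i ^+ m i) => t.
rewrite mevalE horner_sum; apply: eq_bigr => m _.
rewrite hornerZ horner_prod; congr (_ * _); apply: eq_bigr => i _.
by rewrite horner_exp.
Qed.

Lemma poly_zero_off (h k : {poly K}) : k != 0 ->
  (forall t, k.[t] != 0 -> h.[t] = 0) -> forall t, h.[t] = 0.
Proof.
move=> k0 hk t; suff /eqP : h * k = 0 by rewrite mulf_eq0 (negPf k0) orbF => /eqP ->;
  rewrite horner0.
apply: poly_eq0_nat => j _; rewrite hornerM.
by have [->|/hk ->] := eqVneq k.[j%:R] 0; rewrite ?mulr0 ?mul0r.
Qed.

(** The left side of the equation at e + t, as a polynomial in t; a product of monic linear factors,
    it is nonzero whatever a and e are. *)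
Definition relation_poly (a e : K) : {poly K} :=
  ('X + (e - d%:R * a)%:P) * ('X + (e + d%:R * a)%:P) * ('X + e%:P) ^+ (d - 2).

Lemma relation_polyE a e t : (relation_poly a e).[t] =
  (e + t - d%:R * a) * (e + t + d%:R * a) * (e + t) ^+ (d - 2).
Proof.
rewrite /relation_poly !hornerM horner_exp !hornerD !hornerX !hornerC.
by congr (_ * _ * _); [ring | ring | rewrite addrC].
Qed.

Lemma relation_poly_neq0 a e : relation_poly a e != 0.
Proof.
by rewrite !mulf_neq0 ?expf_neq0 // -size_poly_eq0 size_XaddC.
Qed.

Definition row4 (a u v e : K) : 'I_4 -> K :=
  fun i => match val i with 0 => a | 1 => u | 2 => v | _ => e end.

Lemma meval_row4 (p : 'rV[K]_4) P :
  meval (p 0) P = meval (row4 (p 0 0) (p 0 1) (p 0 2) (p 0 3)) P.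
Proof. by apply: meval_eq; apply: ord4_ind. Qed.

(* Points with v <> 0 carry characters; a point with u <> 0 is a limit of these
   along (a, u, v(t), e + t), and a point with u = v = 0 is a limit of points
   with u <> 0, v = 0. *)
Lemma surface_dense (P : {mpoly K[4]}) :
  (forall chi : {lrmorphism Z -> K^o}, fixed chi -> meval (coords chi) P = 0) ->
  forall p : 'rV[K]_4, fixed_surface d p -> meval (p 0) P = 0.
Proof.
move=> P0.
have P1 (a u v e : K) : v != 0 ->
    (e - d%:R * a) * (e + d%:R * a) * e ^+ (d - 2) = u * v ->
    meval (row4 a u v e) P = 0.
  move=> v0 rel; pose p : 'rV[K]_4 := \row_i row4 a u v e i.
  have pS : fixed_surface d p by rewrite /fixed_surface /= !mxE.
  have [|chi chi_fixed chi_p] := surface_point pS; first by rewrite mxE.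
  rewrite -[RHS](P0 chi chi_fixed); apply: meval_eq => i.
  by have := congr1 (fun r : 'rV[K]_4 => r 0 i) chi_p; rewrite !mxE => ->.
have P2 (a u v e : K) : u != 0 ->
    (e - d%:R * a) * (e + d%:R * a) * e ^+ (d - 2) = u * v ->
    meval (row4 a u v e) P = 0.
  move=> u0 rel.
  pose q (i : 'I_4) : {poly K} := match val i with 0 => a%:P | 1 => u%:P
     | 2 => u^-1 *: relation_poly a e | _ => 'X + e%:P end.
  have [h hE] := meval_line q P.
  have qE t : (fun i : 'I_4 => (q i).[t]) =1 row4 a u (u^-1 * (relation_poly a
    e).[t]) (e + t).
    apply: ord4_ind; rewrite /q /row4 /= ?hornerC ?hornerZ //.
    by rewrite hornerD hornerX hornerC addrC.
  have h0 : h.[0] = 0.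
    apply: (@poly_zero_off h (relation_poly a e)); first exact: relation_poly_neq0.
    move=> t rt; rewrite hE (meval_eq _ (qE t)); apply: P1.
      by rewrite mulf_neq0 // invr_eq0.
    by rewrite mulrA mulfV // mul1r relation_polyE.
  rewrite -h0 hE (meval_eq _ (qE 0)) relation_polyE !addr0 rel.
  by rewrite mulrA mulVf // mul1r.
move=> p; rewrite /fixed_surface /= meval_row4.
move: (p 0 0) (p 0 1) (p 0 2) (p 0 3) => a u v e rel.
have [u0|u0] := eqVneq u 0; last exact: P2.
have [v0|v0] := eqVneq v 0; last exact: P1.
rewrite {}u0 {}v0 mulr0 in rel *.
pose q (i : 'I_4) : {poly K} := match val i with 0 => a%:P | 1 => 'X | 2 => 0 | _ =>
  e%:P end.
have [h hE] := meval_line q P.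
have qE t : (fun i : 'I_4 => (q i).[t]) =1 row4 a t 0 e.
  by apply: ord4_ind; rewrite /q /row4 /= ?hornerC ?hornerX.
rewrite -(meval_eq _ (qE 0)) -hE.
apply: (@poly_zero_off h 'X); first by rewrite polyX_eq0.
move=> t; rewrite hornerX hE (meval_eq _ (qE t)) => t0.
by apply: P2; rewrite ?mulr0.
Qed.

(** Any two choices agree at fixed characters, hence on the surface by density; this is why
    evaluation at a point of the surface is multiplicative and linear in z. *)
Definition coord_poly (z : Z) : {mpoly K[4]} := xget 0 [set P : {mpoly K[4]} |
  forall chi : {lrmorphism Z -> K^o}, fixed chi -> chi z = meval (coords chi) P].

Lemma coord_polyE (chi : {lrmorphism Z -> K^o}) z : fixed chi ->
  chi z = meval (coords chi) (coord_poly z).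
Proof.
have [P zP] := tame_all d_gt1 d_odd z.
by move: chi; rewrite /coord_poly; case: xgetP => [_ -> //|/(_ P)].
Qed.

Section SurfaceCharacter.
Variable p : fixed_surface (K := K) d.

Let meval_p (P Q : {mpoly K[4]}) :
  (forall chi : {lrmorphism Z -> K^o}, fixed chi ->
     meval (coords chi) P = meval (coords chi) Q) ->
  meval (val p 0) P = meval (val p 0) Q.
Proof.
move=> PQ; apply/eqP; rewrite -subr_eq0 -mevalB; apply/eqP.
apply: surface_dense; last exact: set_valP.
by move=> chi chi_fixed; rewrite mevalB PQ // subrr.
Qed.

Definition surface_char (z : Z) : K^o := meval (val p 0) (coord_poly z).

Fact surface_char_zmod : zmod_morphism surface_char.
Proof.
move=> x y; rewrite /surface_char -mevalB; apply: meval_p => chi chi_fixed.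
by rewrite mevalB -!coord_polyE // raddfB.
Qed.

Fact surface_char_monoid : monoid_morphism surface_char.
Proof.
split=> [|x y]; rewrite /surface_char -?(meval1 (val p 0)) -?mevalM;
  apply: meval_p => chi chi_fixed.
  by rewrite meval1 -coord_polyE // rmorph1.
by rewrite mevalM -!coord_polyE // rmorphM.
Qed.

Fact surface_char_scalable : scalable surface_char.
Proof.
move=> k x; rewrite /surface_char -[RHS]mevalZ; apply: meval_p => chi chi_fixed.
by rewrite mevalZ -!coord_polyE // linearZ.
Qed.

Definition surface_point_of : {lrmorphism Z -> K^o} := HB.pack surface_char
  (GRing.isZmodMorphism.Build Z K^o surface_char surface_char_zmod)
  (GRing.isMonoidMorphism.Build Z K^o surface_char surface_char_monoid)
  (GRing.isScalable.Build K Z K^o *:%R surface_char surface_char_scalable).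

Lemma surface_char_fixed : fixed surface_point_of.
Proof.
move=> xi xi1; apply: spectrum_eq => z; rewrite /= /surface_char.
apply: meval_p => chi chi_fixed; rewrite -!coord_polyE //.
apply: fixedE => //; have /unity_rootP xi_d := xi1.
by rewrite /= exprVn xi_d invr1.
Qed.

Lemma surface_char_coords : coord_row surface_char = val p.
Proof.
apply/rowP => i; rewrite mxE /coords /surface_char.
rewrite -[RHS](mevalXU (val p 0) i); apply: meval_p => chi chi_fixed.
by rewrite -coord_polyE // mevalXU.
Qed.

End SurfaceCharacter.

Lemma meval_coords (P : {mpoly K[4]}) : exists z : Z,
  forall chi : {lrmorphism Z -> K^o}, chi z = meval (coords chi) P.
Proof.
exists (\sum_(m <- msupp P) P@_m *: \prod_i coordinate i ^+ m i) => chi.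
rewrite mevalE raddf_sum; apply: eq_bigr => m _ /=; rewrite linearZ rmorph_prod.
by congr (_ * _); apply: eq_bigr => i _; rewrite rmorphXn.
Qed.

Lemma mu_fixed_isomorphic : isomorphic (subvariety (mu_fixed zeta_prim d))
  (@subvariety K (affine_space K 4) (fixed_surface d)).
Proof.
pose f (chi : subvariety (mu_fixed zeta_prim d)) :
    @subvariety K (affine_space K 4) (fixed_surface d) :=
  exist _ (coord_row (val chi : {lrmorphism Z -> K^o}))
    (mem_set (coord_row_surface (set_valP chi))).
pose g (p : @subvariety K (affine_space K 4) (fixed_surface d)) :
    subvariety (mu_fixed zeta_prim d) :=
  exist _ (surface_point_of p) (mem_set (surface_char_fixed p)).
exists f, g; split.
- move=> chi; apply/val_inj/spectrum_eq => z /=; rewrite /surface_char /=.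
  rewrite [RHS](coord_polyE z (set_valP chi)); apply: meval_eq => i.
  by rewrite mxE.
- by move=> p; apply/val_inj; exact: surface_char_coords.
- move=> phi [_ [P ->] ->]; have [z zP] := meval_coords P.
  exists (fun chi : {lrmorphism Z -> K^o} => chi z); first by exists z.
  apply/funext => chi /=; rewrite zP; apply: meval_eq => i.
  by rewrite mxE.
- move=> phi [_ [z ->] ->]; exists (fun p : 'rV[K]_4 => meval (p 0) (coord_poly z)).
    by exists (coord_poly z).
  by apply/funext.
Qed.

End Points.

Theorem theorem7p1 (R : realType) (d : nat) (d_gt1 : (1 < d)%N)
    (d_odd : odd d) (zeta : R[i]) (zeta_prim : d.-primitive_root zeta) :
  isomorphic
    (subvariety (mu_fixed zeta_prim d))
    (@subvariety R[i] (affine_space R[i] 4)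
       [set p : 'rV[R[i]]_4 |
          let a := p 0 0 in let u := p 0 1 in
          let v := p 0 2 in let e := p 0 3 in
          (e - d%:R * a) * (e + d%:R * a) * e ^+ (d - 2) = u * v]).
Proof. exact: mu_fixed_isomorphic. Qed.
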